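(* Let $\mathfrak{h}$ be a Hilbert space and let $\mathsf{k}_1,\mathsf{k}_2$ be complex Hilbert spaces with fixed countable orthonormal bases. Let $(U^1_t)_{t\ge 0}$ and $(U^2_t)_{t\ge 0}$ be unitary quantum stochastic cocycles on $\mathfrak{h}$ with noise dimension spaces $\mathsf{k}_1$ and $\mathsf{k}_2$ respectively, satisfying the quantum stochastic differential equations $$dU^l_t = U^l_t\; {}^{(l)}\!F^{\mu_l}_{\nu_l}\, \Lambda^{\nu_l}_{\mu_l}(dt),\qquad U^l_0 = I_{\mathfrak{h}\otimes\mathcal{F}^{(l)}},\qquad l=1,2,$$ for matrices of bounded operators $[{}^{(l)}\!F^{\mu_l}_{\nu_l}]$ having block form $$\begin{bmatrix} {}^{(l)}\!K & {}^{(l)}\!M\\ {}^{(l)}\!L & {}^{(l)}\!W-{}^{(l)}\!I\end{bmatrix}\in B\big(\mathfrak{h}\oplus(\mathfrak{h}\otimes\mathsf{k}_l)\big),\qquad {}^{(l)}\!I:=I_{\mathfrak{h}\otimes\mathsf{k}_l},$$ which satisfy the structure relations for unitarity: ${}^{(l)}\!L\in B(\mathfrak{h};\mathfrak{h}\otimes\mathsf{k}_l)$, ${}^{(l)}\!W\in B(\mathfrak{h}\otimes\mathsf{k}_l)$ is unitary, ${}^{(l)}\!M=-({}^{(l)}\!L)^*\,{}^{(l)}\!W$, and ${}^{(l)}\!K=iH_l-\tfrac12({}^{(l)}\!L)^*\,{}^{(l)}\!L$ with $H_l\in B(\mathfrak{h})$ selfadjoint. Let $\mathsf{k}:=\mathsf{k}_1\oplus\mathsf{k}_2$,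 with orthonormal basis obtained by concatenating those of $\mathsf{k}_1$ and $\mathsf{k}_2$, and let $(U_t)_{t\ge0}$ be the unitary quantum stochastic cocycle on $\mathfrak{h}$ with noise dimension space $\mathsf{k}$ satisfying the quantum stochastic differential equation $$U_t = I_{\mathfrak{h}\otimes\mathcal{F}_{\mathsf{k}}}+\int_0^t U_sF^\mu_\nu\,\Lambda^\nu_\mu(ds),$$ where $$[F^\mu_\nu]=\begin{bmatrix} {}^{(1)}\!K+{}^{(2)}\!K & {}^{(1)}\!M & {}^{(2)}\!M\\ {}^{(1)}\!L & {}^{(1)}\!W-{}^{(1)}\!I & 0\\ {}^{(2)}\!L & 0 & {}^{(2)}\!W-{}^{(2)}\!I\end{bmatrix}\in B\big(\mathfrak{h}\oplus(\mathfrak{h}\otimes\mathsf{k}_1)\oplus(\mathfrak{h}\otimes\mathsf{k}_2)\big).$$ Let $U^{(1,2)}_n(t)$ ($n\in\mathbb{N}$, $t\ge0$) be the Trotter products of $(U^1_t)_{t\ge0}$ and $(U^2_t)_{t\ge0}$ defined in the context. Then, for each $t\ge0$, $$U^{(1,2)}_n(t)\to U_t\quad\text{as } n\to\infty$$ in the strong operator topology on $B(\mathfrak{h}\otimes\mathcal{F}_{\mathsf{k}})$.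
   Context: **Fock space.** For a complex Hilbert space $\mathsf{k}$ with fixed countable orthonormal basis (the *noise dimension space* ), put $\mathsf{K}:=L^2(\mathbb{R}_+;\mathsf{k})$ and let $\mathcal{F}_{\mathsf{k}}$ be the symmetric Fock space over $\mathsf{K}$, with exponential vectors $\varepsilon(f)$, $f\in\mathsf{K}$ (so $\langle\varepsilon(f),\varepsilon(g)\rangle=e^{\langle f,g\rangle}$; inner products are linear in the second argument), and normalised exponential vectors $\varpi(f):=e^{-\|f\|^2/2}\varepsilon(f)$. For an interval $[s,t[$, $\mathcal{F}_{\mathsf{k},[s,t[}$ denotes the symmetric Fock space over $L^2([s,t[;\mathsf{k})$; one identifies $\mathcal{F}_{\mathsf{k}}=\mathcal{F}_{\mathsf{k},[0,s[}\otimes\mathcal{F}_{\mathsf{k},[s,t[}\otimes\mathcal{F}_{\mathsf{k},[t,\infty[}$ via $\varpi(f)=\varpi(f|_{[0,s[})\otimes\varpi(f|_{[s,t[})\otimes\varpi(f|_{[t,\infty[})$. Write $\mathcal{F}^{(l)}:=\mathcal{F}_{\mathsf{k}_l}$ for $l=1,2$; for $\mathsf{k}=\mathsf{k}_1\oplus\mathsf{k}_2$ identify $\mathcal{F}_{\mathsf{k}}=\mathcal{F}^{(1)}\otimes\mathcal{F}^{(2)}$ via $\varpi\binom{f^1}{f^2}=\varpi(f^1)\otimes\varpi(f^2)$. Let $I^{(l)}$ be the identity operator on $\mathcal{F}^{(l)}$. **Processes.** A bounded quantum stochastic process on $\mathfrak{h}$ with noise dimension space $\mathsf{k}$ is a family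 $(X_t)_{t\ge0}$ of bounded operators on $\mathfrak{h}\otimes\mathcal{F}_{\mathsf{k}}$ that is adapted: $X_t\in B(\mathfrak{h}\otimes\mathcal{F}_{\mathsf{k},[0,t[})\otimes I_{\mathcal{F}_{\mathsf{k},[t,\infty[}}$ for all $t$. It is unitary (contractive) if each $X_t$ is. **Time shift and cocycles.** Let $\Gamma(\theta_t):\mathcal{F}_{\mathsf{k}}\to\mathcal{F}_{\mathsf{k},[t,\infty[}$ be the unitary determined by $\Gamma(\theta_t)\varpi(f)=\varpi(\theta_tf)$, where $(\theta_tf)(s)=f(s-t)$ for $s\ge t$. Define $\Theta^{\mathsf{k}}_t(X)=I_{\mathcal{F}_{\mathsf{k},[0,t[}}\otimes\Gamma(\theta_t)X\Gamma(\theta_t)^*$ for $X\in B(\mathcal{F}_{\mathsf{k}})$, and $\Theta_t:=\mathrm{id}_{B(\mathfrak{h})}\,\overline{\otimes}\,\Theta^{\mathsf{k}}_t$ on $B(\mathfrak{h}\otimes\mathcal{F}_{\mathsf{k}})$. A unitary quantum stochastic cocycle is a unitary quantum stochastic process with $U_0=I$ and $U_{s+t}=U_s\Theta_s(U_t)$ for all $s,t\ge0$. **Quantum stochastic differential equations.** $\{\Lambda^\mu_\nu:\mu,\nu\ge0\}$ denotes the fundamental quantum semimartingales (time, creation, annihilation and preservation processes) of Hudson–Parthasarathy quantum stochastic calculus for $\mathsf{k}$ with respect to its fixed basis; repeated Greek indices are summed from $0$. A block operator $F\in B(\mathfrak{h}\oplus(\mathfrak{h}\otimes\mathsf{k}))$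 is identified with the matrix $[F^\mu_\nu]_{\mu,\nu\ge0}$ of operators on $\mathfrak{h}$ via the basis of $\mathsf{k}$ ($\mu$ is the row index, index $0$ corresponding to the summand $\mathfrak{h}$). The equation $U_t=I+\int_0^tU_sF^\mu_\nu\Lambda^\nu_\mu(ds)$, also written $dU_t=U_tF^\mu_\nu\Lambda^\nu_\mu(dt)$, $U_0=I$, for a strongly continuous bounded process $(U_t)$, means in weak form that for all $u,v\in\mathfrak{h}$ and all step functions $f,g\in\mathsf{K}$, $$\langle u\otimes\varepsilon(f),(U_t-I)\,v\otimes\varepsilon(g)\rangle=\int_0^t\big\langle u\otimes\varepsilon(f),U_s\big(E_{f(s)}^*FE_{g(s)}v\otimes\varepsilon(g)\big)_{\!\ast}\big\rangle\,ds,$$ where, here, the subscript $\ast$ abbreviates the following: the integrand is $\sum_{\mu,\nu\ge0}\overline{f^\mu(s)}\,g^\nu(s)\,\langle u\otimes\varepsilon(f),U_s(F^\mu_\nu v\otimes\varepsilon(g))\rangle$ with $f^0=g^0\equiv1$ and $f^j,g^k$ ($j,k\ge1$) the basis components of $f,g$, the sum being understood as $\langle u\otimes\varepsilon(f),U_s(F_{f(s),g(s)}v\otimes\varepsilon(g))\rangle$ with $F_{c,d}:=E_c^*FE_d\in B(\mathfrak{h})$ and $E_c:\mathfrak{h}\to\mathfrak{h}\oplus(\mathfrak{h}\otimes\mathsf{k})$, $E_cv=(v,v\otimes c)$. When $F$ satisfies the structure relations for unitarity (of the form stated in the claim), the equation has a unique strongly continuous solution, and the solution is a unitary quantum stochastic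 cocycle; the block matrix $[F^\mu_\nu]$ in the claim for $\mathsf{k}_1\oplus\mathsf{k}_2$ satisfies these relations. **Trotter products.** Let $\Sigma_{2,1}:B(\mathfrak{h}\otimes\mathcal{F}^{(2)}\otimes\mathcal{F}^{(1)})\to B(\mathfrak{h}\otimes\mathcal{F}^{(1)}\otimes\mathcal{F}^{(2)})=B(\mathfrak{h}\otimes\mathcal{F}_{\mathsf{k}})$ be the tensor flip. Define $$U^{(1,2)}_t:=(U^1_t\otimes I^{(2)})\,\Sigma_{2,1}(U^2_t\otimes I^{(1)}),\qquad U^{(1,2)}_{s,t}:=\Theta_s(U^{(1,2)}_{t-s}),\quad 0\le s\le t.$$ For $t\ge0$, $n\in\mathbb{N}$, put $t^n_k:=2^{-n}([2^nt]+k)$ for $k\in\mathbb{Z}$, $k\ge-[2^nt]$, where $[\,\cdot\,]$ is the integer part. Then $$U^{(1,2)}_n(t):=\big(U^{(1,2)}_{0,2^{-n}}\,U^{(1,2)}_{2^{-n},2\cdot2^{-n}}\cdots U^{(1,2)}_{t^n_{-1},t^n_0}\big)\,U^{(1,2)}_{t^n_0,t}$$ (the bracketed product being the identity if $[2^nt]=0$). *)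

(* Defs.v *)
From HB Require Import structures.
From mathcomp Require Import all_boot all_order all_algebra.
From mathcomp Require Import complex ring.
From mathcomp Require Import all_classical all_reals all_analysis.

Set Implicit Arguments.
Unset Strict Implicit.
Unset Printing Implicit Defensive.

Import Order.TTheory GRing.Theory Num.Theory.
Import numFieldNormedType.Exports.

Local Open Scope classical_set_scope.
Local Open Scope complex_scope.
Local Open Scope ring_scope.

HB.mixin Record isHilbert (R : realType) H & CompleteNormedModule R[i] H := {
  inner : H -> H -> R[i];
  inner_linear : forall u, linear (inner u : H -> R[i]^o);
  inner_conj : forall u v, inner v u = (inner u v)^*;
  inner_norm : forall u, inner u u = `|u| ^+ 2
}.

#[short(type="hilbertType")]
HB.structure Definition Hilbert (R : realType) :=
  {H of CompleteNormedModule R[i] H & isHilbert R H}.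

(* The product type carries the sup norm in MathComp-Analysis, hence an alias. *)
Definition hsum (R : realType) (H K : hilbertType R) : Type := (H * K)%type.

Section HilbertSum.
Variables (R : realType) (H K : hilbertType R).
Local Notation C := R[i].
Local Notation HK := (hsum H K).

HB.instance Definition _ := GRing.Lmodule.copy HK (H * K)%type.

Definition hsum_norm (x : HK) : C := sqrtC (`|x.1| ^+ 2 + `|x.2| ^+ 2).

Lemma hsum_sq_ge0 (x : HK) : 0 <= `|x.1| ^+ 2 + `|x.2| ^+ 2 :> C.
Proof. by rewrite addr_ge0 ?exprn_ge0. Qed.

Lemma hsum_norm_ge0 x : 0 <= hsum_norm x.
Proof. by rewrite sqrtC_ge0 hsum_sq_ge0. Qed.

Lemma hsum_normZ (l : C) (x : HK) : hsum_norm (l *: x) = `|l| * hsum_norm x.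
Proof.
rewrite /hsum_norm !normrZ !exprMn -mulrDr sqrtCM ?nnegrE ?exprn_ge0 ?hsum_sq_ge0//.
by rewrite sqrCK.
Qed.

Lemma hsum_norm0_eq0 (x : HK) : hsum_norm x = 0 -> x = 0.
Proof.
case: x => x y /eqP; rewrite sqrtC_eq0 /= paddr_eq0 ?exprn_ge0//.
by rewrite !sqrf_eq0 !normr_eq0 => /andP[/eqP-> /eqP->].
Qed.

Lemma hsum_normD (x y : HK) : hsum_norm (x + y) <= hsum_norm x + hsum_norm y.
Proof.
have sq z : hsum_norm z ^+ 2 = `|z.1| ^+ 2 + `|z.2| ^+ 2 by rewrite sqrtCK.
rewrite -ler_sqr ?nnegrE ?addr_ge0 ?hsum_norm_ge0//.
rewrite sqrrD !sq.
apply: (@le_trans _ _ ((`|x.1| + `|y.1|) ^+ 2 + (`|x.2| + `|y.2|) ^+ 2)).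
  by rewrite lerD// ler_sqr ?nnegrE ?addr_ge0// ler_normD.
have cs : `|x.1| * `|y.1| + `|x.2| * `|y.2| <= hsum_norm x * hsum_norm y.
  rewrite -ler_sqr ?nnegrE ?addr_ge0 ?mulr_ge0 ?hsum_norm_ge0//.
  rewrite exprMn !sq -subr_ge0.
  rewrite (_ : _ - _ = (`|x.1| * `|y.2| - `|x.2| * `|y.1|) ^+ 2); last by ring.
  by rewrite real_exprn_even_ge0// rpredB// rpredM// normr_real.
rewrite (_ : (_ + _) ^+ 2 + (_ + _) ^+ 2 = `|x.1| ^+ 2 + `|x.2| ^+ 2
    + (`|x.1| * `|y.1| + `|x.2| * `|y.2|) *+ 2
    + (`|y.1| ^+ 2 + `|y.2| ^+ 2)); last by ring.
by rewrite lerD2r lerD2l lerMn2r.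
Qed.

HB.instance Definition _ := Lmodule_isNormed.Build C HK
  hsum_normD hsum_normZ hsum_norm0_eq0.

Lemma hsum_normE (x : HK) : `|x| = sqrtC (`|x.1| ^+ 2 + `|x.2| ^+ 2) :> C.
Proof. by []. Qed.

Lemma hsum_norm_fst (x : HK) : `|x.1| <= `|x|.
Proof.
by rewrite -ler_sqr ?nnegrE// hsum_normE sqrtCK lerDl exprn_ge0.
Qed.

Lemma hsum_norm_snd (x : HK) : `|x.2| <= `|x|.
Proof.
by rewrite -ler_sqr ?nnegrE// hsum_normE sqrtCK lerDr exprn_ge0.
Qed.

Lemma hsum_norm_le (x : HK) : `|x| <= `|x.1| + `|x.2|.
Proof.
rewrite -ler_sqr ?nnegrE ?addr_ge0// hsum_normE sqrtCK sqrrD.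
by rewrite lerD2r lerDl mulrn_wge0// mulr_ge0.
Qed.

Lemma hsum_complete (F : set_system HK) : ProperFilter F -> cauchy F -> cvg F.
Proof.
move=> FF /cauchyP Fc.
have /cauchy_cvg/cvg_ex[l1 Fl1] : cauchy ((fun x : HK => x.1) @ F).
  apply: cauchy_exP => e e0; have [x Fx] := Fc e e0; exists x.1.
  apply: (@filterS _ F _ (ball x e)) => // y; rewrite -ball_normE => xy.
  rewrite /= -ball_normE; exact: le_lt_trans (hsum_norm_fst (x - y)) xy.
have /cauchy_cvg/cvg_ex[l2 Fl2] : cauchy ((fun x : HK => x.2) @ F).
  apply: cauchy_exP => e e0; have [x Fx] := Fc e e0; exists x.2.
  apply: (@filterS _ F _ (ball x e)) => // y; rewrite -ball_normE => xy.
  rewrite /= -ball_normE; exact: le_lt_trans (hsum_norm_snd (x - y)) xy.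
apply/cvg_ex; exists ((l1, l2) : HK).
apply/cvgrPdist_lt => e e0; near=> x.
rewrite (le_lt_trans (hsum_norm_le _))//= [ltRHS]splitr ltrD//.
- near: x; move/cvgrPdist_lt : Fl1; apply; exact: divr_gt0.
- near: x; move/cvgrPdist_lt : Fl2; apply; exact: divr_gt0.
Unshelve. all: by end_near. Qed.

HB.instance Definition _ := Uniform_isComplete.Build HK hsum_complete.

Definition hsum_inner (x y : HK) : C := inner x.1 y.1 + inner x.2 y.2.

Lemma hsum_inner_linear x : linear (hsum_inner x : HK -> C^o).
Proof.
by move=> a y z; rewrite /hsum_inner !inner_linear/= scalerDr addrACA.
Qed.

Lemma hsum_inner_conj x y : hsum_inner y x = (hsum_inner x y)^*.
Proof. by rewrite /hsum_inner rmorphD/= -!inner_conj. Qed.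

Lemma hsum_inner_norm (x : HK) : hsum_inner x x = `|x| ^+ 2.
Proof. by rewrite /hsum_inner !inner_norm hsum_normE sqrtCK. Qed.

HB.instance Definition _ := isHilbert.Build R HK
  hsum_inner_linear hsum_inner_conj hsum_inner_norm.

End HilbertSum.

Section Operators.
Variable R : realType.
Local Notation C := R[i].

Definition bounded_op (H K : hilbertType R) (A : H -> K) : Prop :=
  linear A /\ exists M : C, forall x, `|A x| <= M * `|x|.

(* The bounded operator determined by T (a x) = b x for x in D. *)
Definition op_such_that (X : Type) (H K : hilbertType R)
    (D : set X) (a : X -> H) (b : X -> K) : H -> K :=
  get [set T : H -> K | bounded_op T /\ forall x, D x -> T (a x) = b x].

Definition adj (H K : hilbertType R) (A : H -> K) : K -> H :=
  get [set B : K -> H | bounded_op B /\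
                        forall x y, inner x (A y) = inner (B x) y].

Definition unitary (H K : hilbertType R) (A : H -> K) : Prop :=
  [/\ bounded_op A, adj A \o A = id & A \o adj A = id].

Definition selfadjoint (H : hilbertType R) (A : H -> H) : Prop :=
  bounded_op A /\ adj A = A.

(* The closed linear span of S is the whole space. *)
Definition total (H : hilbertType R) (S : set H) : Prop :=
  forall V : set H, closed V -> V 0 ->
    (forall a u v, V u -> V v -> V (a *: u + v)) -> S `<=` V -> V = setT.

Definition orthonormal_basis (J : countType) (H : hilbertType R) (e : J -> H) :
    Prop :=
  (forall i j, inner (e i) (e j) = (i == j)%:R) /\ total (range e).

Definition dsum_op (H K H' K' : hilbertType R) (A : H -> H') (B : K -> K') :
    hsum H K -> hsum H' K' :=
  fun x => (A x.1, B x.2).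

(* The operator [A B; C D] on H (+) K. *)
Definition block_op (H K : hilbertType R)
    (A : H -> H) (B : K -> H) (C : H -> K) (D : K -> K) : hsum H K -> hsum H K :=
  fun x => (A x.1 + B x.2, C x.1 + D x.2).

Definition row_op (H K1 K2 : hilbertType R) (B1 : K1 -> H) (B2 : K2 -> H) :
    hsum K1 K2 -> H :=
  fun x => B1 x.1 + B2 x.2.

Definition col_op (H K1 K2 : hilbertType R) (C1 : H -> K1) (C2 : H -> K2) :
    H -> hsum K1 K2 :=
  fun u => (C1 u, C2 u).

End Operators.

Section SquareIntegrable.
Variable R : realType.
Local Notation C := R[i].
Local Notation mu := (@lebesgue_measure R).

Definition Cintegral (D : set R) (phi : R -> C) : C :=
  (\int[mu]_(s in D) complex.Re (phi s)) +i* (\int[mu]_(s in D) complex.Im (phi s)).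

Definition cexp (z : C) : C :=
  (expR (complex.Re z))%:C * (cos (complex.Im z) +i* sin (complex.Im z)).

Variable k : hilbertType R.

Definition simple_on (D : set R) (g : R -> k) : Prop :=
  finite_set (g @` D) /\ forall c : k, measurable (D `&` g @^-1` [set c]).

(* Bochner measurability *)
Definition strongly_measurable (D : set R) (f : R -> k) : Prop :=
  exists g : nat -> R -> k, (forall n, simple_on D (g n)) /\
    forall s, D s -> (fun n => g n s) @ \oo --> f s.

Definition sqnorm (f : R -> k) (s : R) : R := complex.Re (inner (f s) (f s)).

(* Functions are total on R; only their restriction to the interval matters. *)
Definition L2 (I : interval R) (f : R -> k) : Prop :=
  strongly_measurable [set` I] f /\
  (\int[mu]_(s in [set` I]) (sqnorm f s)%:E < +oo)%E.

Definition L2inner (I : interval R) (f g : R -> k) : C :=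
  Cintegral [set` I] (fun s => inner (f s) (g s)).

Definition step_function (f : R -> k) : Prop :=
  exists s : seq (R * R * k), forall t,
    f t = \sum_(p <- s) (if p.1.1 <= t < p.1.2 then p.2 else 0).

End SquareIntegrable.

(* Hilbert tensor products and Fock spaces are used through their defining
   properties, which determine them up to a unique unitary isomorphism. *)
Section TensorFock.
Variable R : realType.
Local Notation C := R[i].

Record tensor_product (H K : hilbertType R) := TensorProduct {
  tensor_space :> hilbertType R;
  tens : H -> K -> tensor_space;
  tens_linear_l : forall v, linear (tens^~ v);
  tens_linear_r : forall u, linear (tens u);
  tens_inner : forall u v u' v',
    inner (tens u v) (tens u' v') = inner u u' * inner v v';
  tens_total : total [set tens p.1 p.2 | p in [set: H * K]] }.

(* Functions equal almost everywhere on I get the same exponential vector,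
   by the inner product formula. *)
Record fock_space (k : hilbertType R) (I : interval R) := FockSpace {
  fock_carrier :> hilbertType R;
  expv : (R -> k) -> fock_carrier;
  expv_inner : forall f g, L2 I f -> L2 I g ->
    inner (expv f) (expv g) = cexp (L2inner I f g);
  expv_total : total (expv @` [set f | L2 I f]) }.

Definition nexpv (k : hilbertType R) (I : interval R) (F : fock_space k I)
    (f : R -> k) : F :=
  (expR (- (complex.Re (L2inner I f f) / 2)))%:C *: expv F f.

Record realization := Realization {
  tensor : forall H K : hilbertType R, tensor_product H K;
  fock : forall (k : hilbertType R) (I : interval R), fock_space k I }.

End TensorFock.

Section Processes.
Variables (R : realType) (S : realization R).
Local Notation C := R[i].
Local Notation "H ⊗ K" := (tensor_space (tensor S H K))
  (at level 40, left associativity).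
Local Notation "u ⊠ v" := (tens (tensor S _ _) u v)
  (at level 40, left associativity).
Local Notation "'ε' f" := (expv (fock S _ _) f) (at level 10, f at level 9).
Local Notation "'ϖ' f" := (nexpv (fock S _ _) f) (at level 10, f at level 9).

Definition tensor_op (H K H' K' : hilbertType R) (A : H -> H') (B : K -> K') :
    H ⊗ K -> H' ⊗ K' :=
  op_such_that setT (fun p => p.1 ⊠ p.2) (fun p => A p.1 ⊠ B p.2).

Definition Fock (k : hilbertType R) : hilbertType R := fock S k `[0, +oo[%R.
Definition Fock_past (k : hilbertType R) (t : R) : hilbertType R :=
  fock S k `[0, t[%R.
Definition Fock_future (k : hilbertType R) (t : R) : hilbertType R :=
  fock S k `[t, +oo[%R.

Section OneNoise.
Variables h k : hilbertType R.

(* u ⊗ ϖ(f) |-> (u ⊗ ϖ(f|[0,t[)) ⊗ ϖ(f|[t,oo[) *)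
Definition split_past (t : R) :
    h ⊗ Fock k -> (h ⊗ Fock_past k t) ⊗ Fock_future k t :=
  op_such_that [set p : h * (R -> k) | L2 `[0, +oo[%R p.2]
    (fun p => p.1 ⊠ ϖ p.2) (fun p => p.1 ⊠ ϖ p.2 ⊠ ϖ p.2).

(* u ⊗ ϖ(f) |-> ϖ(f|[0,t[) ⊗ (u ⊗ ϖ(f|[t,oo[)) *)
Definition split_future (t : R) :
    h ⊗ Fock k -> Fock_past k t ⊗ (h ⊗ Fock_future k t) :=
  op_such_that [set p : h * (R -> k) | L2 `[0, +oo[%R p.2]
    (fun p => p.1 ⊠ ϖ p.2) (fun p => ϖ p.2 ⊠ (p.1 ⊠ ϖ p.2)).

Definition adapted (t : R) (X : h ⊗ Fock k -> h ⊗ Fock k) : Prop :=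
  exists2 Y : h ⊗ Fock_past k t -> h ⊗ Fock_past k t, bounded_op Y &
    X = adj (split_past t) \o tensor_op Y id \o split_past t.

(* Γ(θ_t) *)
Definition shift_op (t : R) : Fock k -> Fock_future k t :=
  op_such_that (L2 `[0, +oo[%R) (fun f => ϖ f) (fun f => ϖ (fun s => f (s - t))).

(* Θ_t: id_B(h) tensored with X |-> I ⊗ Γ(θ_t) X Γ(θ_t)^* is spatially
   implemented, by ampliating Γ(θ_t) to h. *)
Definition time_shift (t : R) (X : h ⊗ Fock k -> h ⊗ Fock k) :
    h ⊗ Fock k -> h ⊗ Fock k :=
  let G : h ⊗ Fock k -> h ⊗ Fock_future k t := tensor_op id (shift_op t) in
  adj (split_future t) \o tensor_op id (G \o X \o adj G) \o split_future t.

(* Processes are total functions of a real time; only t >= 0 matters. *)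
Definition bounded_process (U : R -> h ⊗ Fock k -> h ⊗ Fock k) : Prop :=
  forall t : R, 0 <= t -> bounded_op (U t) /\ adapted t (U t).

Definition unitary_process (U : R -> h ⊗ Fock k -> h ⊗ Fock k) : Prop :=
  bounded_process U /\ forall t : R, 0 <= t -> unitary (U t).

Definition unitary_cocycle (U : R -> h ⊗ Fock k -> h ⊗ Fock k) : Prop :=
  [/\ unitary_process U, U 0 = id &
    forall s t : R, 0 <= s -> 0 <= t -> U (s + t) = U s \o time_shift s (U t)].

Definition strongly_continuous (U : R -> h ⊗ Fock k -> h ⊗ Fock k) : Prop :=
  forall x, {within `[0, +oo[, continuous (fun t => U t x)}.

(* E_c v = (v, v ⊗ c) *)
Definition E_op (c : k) (v : h) : hsum h (h ⊗ k) := (v, v ⊠ c).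

Definition qsde (F : hsum h (h ⊗ k) -> hsum h (h ⊗ k))
    (U : R -> h ⊗ Fock k -> h ⊗ Fock k) : Prop :=
  [/\ bounded_process U, strongly_continuous U &
    forall t : R, 0 <= t -> forall (u v : h) (f g : R -> k),
      step_function f -> step_function g ->
      inner (u ⊠ ε f : h ⊗ Fock k) (U t (v ⊠ ε g) - v ⊠ ε g) =
      Cintegral `[0, t] (fun s => inner (u ⊠ ε f : h ⊗ Fock k)
        (U s ((adj (E_op (f s)) \o F \o E_op (g s)) v ⊠ ε g)))].

(* K = iH - L^*L/2 and M = - L^*W with W unitary, H bounded selfadjoint *)
Definition unitarity_relations
    (K : h -> h) (M : h ⊗ k -> h) (L : h -> h ⊗ k) (W : h ⊗ k -> h ⊗ k) : Prop :=
  [/\ bounded_op L, unitary W,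
      (forall x, M x = - adj L (W x)) &
      exists2 H : h -> h, selfadjoint H &
        forall v, K v = 'i%C *: H v - 2^-1 *: adj L (L v)].

End OneNoise.

Section TwoNoises.
Variables h k1 k2 : hilbertType R.
Local Notation k12 := (hsum k1 k2).

(* h ⊗ (k1 ⊕ k2) = (h ⊗ k1) ⊕ (h ⊗ k2) *)
Definition distr_op : h ⊗ k12 -> hsum (h ⊗ k1) (h ⊗ k2) :=
  @op_such_that R _ (h ⊗ k12) (hsum (h ⊗ k1) (h ⊗ k2)) setT (fun p : h * k12 => p.1 ⊠ p.2)
    (fun p => (p.1 ⊠ p.2.1, p.1 ⊠ p.2.2) : hsum (h ⊗ k1) (h ⊗ k2)).

(* A block operator on h ⊕ (h ⊗ k1) ⊕ (h ⊗ k2), seen on h ⊕ (h ⊗ (k1 ⊕ k2)) *)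
Definition undistr (F : hsum h (hsum (h ⊗ k1) (h ⊗ k2)) ->
                        hsum h (hsum (h ⊗ k1) (h ⊗ k2))) :
    hsum h (h ⊗ k12) -> hsum h (h ⊗ k12) :=
  let D : hsum h (h ⊗ k12) -> hsum h (hsum (h ⊗ k1) (h ⊗ k2)) :=
    dsum_op id distr_op in
  adj D \o F \o D.

(* u ⊗ ϖ(f1, f2) |-> (u ⊗ ϖ(f1)) ⊗ ϖ(f2) *)
Definition split_noise : h ⊗ Fock k12 -> h ⊗ Fock k1 ⊗ Fock k2 :=
  op_such_that
    [set p : h * ((R -> k1) * (R -> k2)) |
      L2 `[0, +oo[%R p.2.1 /\ L2 `[0, +oo[%R p.2.2]
    (fun p => p.1 ⊠ ϖ (fun s => (p.2.1 s, p.2.2 s) : k12))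
    (fun p => p.1 ⊠ ϖ p.2.1 ⊠ ϖ p.2.2).

(* (u ⊗ y) ⊗ x |-> (u ⊗ x) ⊗ y *)
Definition flip_op : h ⊗ Fock k2 ⊗ Fock k1 -> h ⊗ Fock k1 ⊗ Fock k2 :=
  op_such_that setT
    (fun p : h * Fock k1 * Fock k2 => p.1.1 ⊠ p.2 ⊠ p.1.2)
    (fun p => p.1.1 ⊠ p.1.2 ⊠ p.2).

(* Σ_{2,1} *)
Definition tensor_flip
    (X : h ⊗ Fock k2 ⊗ Fock k1 -> h ⊗ Fock k2 ⊗ Fock k1) :
    h ⊗ Fock k1 ⊗ Fock k2 -> h ⊗ Fock k1 ⊗ Fock k2 :=
  flip_op \o X \o adj flip_op.

Variables (U1 : R -> h ⊗ Fock k1 -> h ⊗ Fock k1)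
          (U2 : R -> h ⊗ Fock k2 -> h ⊗ Fock k2).

(* U^(1,2)_t *)
Definition product_process (t : R) : h ⊗ Fock k12 -> h ⊗ Fock k12 :=
  adj split_noise \o
    (tensor_op (U1 t) id \o tensor_flip (tensor_op (U2 t) id)) \o
  split_noise.

(* U^(1,2)_{s,t} *)
Definition product_evolution (s t : R) : h ⊗ Fock k12 -> h ⊗ Fock k12 :=
  time_shift s (product_process (t - s)).

(* U^(1,2)_n(t) *)
Definition trotter_product (n : nat) (t : R) : h ⊗ Fock k12 -> h ⊗ Fock k12 :=
  let N := Num.truncn (2 ^+ n * t) in
  let d (j : nat) : R := j%:R / 2 ^+ n in
  (\big[(fun A B => A \o B)/id]_(0 <= j < N) product_evolution (d j) (d j.+1))
    \o product_evolution (d N) t.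

End TwoNoises.
End Processes.

(* Main.v *)
Require Import Defs.
From mathcomp Require Import all_boot all_order all_algebra.
From mathcomp Require Import complex ring lra.
From mathcomp Require Import all_classical all_reals all_analysis.
From mathcomp Require Import measurable_realfun.

Set Implicit Arguments.
Unset Strict Implicit.
Unset Printing Implicit Defensive.

Import Order.TTheory GRing.Theory Num.Theory.
Import numFieldNormedType.Exports.
Local Open Scope classical_set_scope.
Local Open Scope ring_scope.

(** The operators of the statement are compared through their matrix elements
[mel X f g], the operators on the initial space obtained by sandwiching [X] between
exponential vectors of [f] and [g]. Vectors [u ⊠ ε f] with [f] a step function with
dyadic breakpoints span a dense subspace ([dyadic_clspan]). Trotter products are
contractions and [U t] is an isometry, so that convergence of these matrix elements
already gives strong convergence ([weak_to_strong]).

For fixed dyadic [f] and [g] and a mesh finer than their breakpoints, the matrix element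
of an ordered product along the mesh is the composition of the matrix elements of its
steps ([mel_mul]): a step is adapted to its right endpoint, while the following steps only
act after it. The cocycle [U] factorises along the same mesh ([mel_cocycle]). On a
mesh interval of length [t] the functions have constant values [c] and [d]. Two Picard
iterations of the quantum stochastic differential equation give the matrix element
[e^(t<c,d>) (1 + t E_c^* F E_d) + O(t^2)] for [U] ([qsde_estimate]). The matrix element of
the product process is the composition of the matrix elements of [U1] and [U2]
([mel_noise_product]), each with such an expansion. The inner products add up over the
two noises, and so do the coefficients because the block matrix does not couple the
noises ([coefficient_undistr]). Hence one step of the Trotter product agrees with
[U] up to [O(t^2)] ([local_agreement_exists]), uniformly along the mesh because [f] and
[g] have finitely many values. Replacing the steps one after the other, while the other
factors stay bounded, about [2^n t] errors of order [4^-n] add up to [O(2^-n)]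
([trotter_error]).

Tensor products and Fock spaces are known through their inner products and total
families only. The operators between them are therefore built by extension from total
sets ([bounded_extension], [isometric_extension]), adjoints by Riesz representation
([riesz]), and ampliations by Gram-Schmidt ([orthogonal_legs]). Density of dyadic
exponential vectors comes from outer regularity of Lebesgue measure
([dyadic_limit_measurable]). *)

(** * Real-valued norms *)

Section RealNorm.
Variables (R : realType).
Local Notation C := R[i].

(** Norms take values in the partially ordered field [R[i]]; this is the same
norm read in [R], where linear arithmetic is available. *)
Definition hn (V : normedZmodType C) (x : V) : R := complex.Re `|x|.

Lemma ReD (a b : C) : complex.Re (a + b) = complex.Re a + complex.Re b.
Proof. by case: a b => ? ? []. Qed.

Lemma ReN (a : C) : complex.Re (- a) = - complex.Re a.
Proof. by case: a. Qed.

Lemma ReB (a b : C) : complex.Re (a - b) = complex.Re a - complex.Re b.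
Proof. by rewrite ReD ReN. Qed.

Lemma ImD (a b : C) : complex.Im (a + b) = complex.Im a + complex.Im b.
Proof. by case: a b => ? ? []. Qed.

Lemma ReZ (t : R) (w : C) : complex.Re (t%:C%C * w) = t * complex.Re w.
Proof. by case: w => a b /=; rewrite mul0r subr0. Qed.

Section General.
Variable V : normedZmodType C.
Implicit Types x y : V.

Lemma hnE x : `|x| = (hn x)%:C%C.
Proof. by rewrite RRe_real// normr_real. Qed.

Lemma hn_ge0 x : 0 <= hn x.
Proof. by have := normr_ge0 x; rewrite hnE lecR. Qed.

Lemma hn0 : hn (0 : V) = 0.
Proof. by rewrite /hn normr0. Qed.

Lemma hn0_eq0 x : hn x = 0 -> x = 0.
Proof. by move=> h; apply/eqP; rewrite -normr_eq0 hnE h. Qed.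

Lemma hnN x : hn (- x) = hn x.
Proof. by rewrite /hn normrN. Qed.

Lemma hnB x y : hn (x - y) = hn (y - x).
Proof. by rewrite -hnN opprB. Qed.

Lemma hnD x y : hn (x + y) <= hn x + hn y.
Proof. by have := ler_normD x y; rewrite !hnE -rmorphD/= lecR. Qed.

Lemma hn_dist x y z : hn (x - z) <= hn (x - y) + hn (y - z).
Proof. by rewrite (_ : x - z = (x - y) + (y - z)) ?hnD// addrA subrK. Qed.

Lemma hn_le_small x : (forall e : R, 0 < e -> hn x <= e) -> x = 0.
Proof.
move=> h; apply: hn0_eq0; apply/eqP; rewrite eq_le hn_ge0 andbT.
by apply/ler_addgt0Pr => e e0; rewrite add0r h.
Qed.

End General.

Lemma hnM (a b : C) : hn (a * b) = hn a * hn b.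
Proof. by apply: complexI; rewrite rmorphM/= -!hnE normrM. Qed.

Lemma hn_real (r : R) : 0 <= r -> hn (r%:C%C : C) = r.
Proof. by move=> r0; rewrite /hn ger0_norm ?lecR. Qed.

Lemma hn_realE (r : R) : hn (r%:C%C : C) = `|r|.
Proof. by rewrite /hn normc_def/= expr0n addr0 sqrtr_sqr. Qed.

Lemma Re_le_hn (z : C) : `|complex.Re z| <= hn z.
Proof. by have := normc_ge_Re z; rewrite hnE lecR. Qed.

Lemma hn_i : hn ('i%C : C) = 1.
Proof. by rewrite /hn normc_def/= expr0n expr1n add0r sqrtr1. Qed.

Lemma Im_le_hn (z : C) : `|complex.Im z| <= hn z.
Proof.
rewrite -[hn z]mulr1 -hn_i -hnM -[X in `|X|]opprK normrN.
by rewrite -ReiNIm Re_le_hn.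
Qed.

Lemma hn_le_ReIm (z : C) : hn z <= `|complex.Re z| + `|complex.Im z|.
Proof.
rewrite [z]complexE (le_trans (hnD _ _))// hnM hn_i mul1r !hn_realE.
by rewrite /= !(mul0r, mul1r, mulr0, addr0, add0r, oppr0, subr0).
Qed.

Lemma hn_conj (z : C) : hn z^* = hn z.
Proof. by rewrite /hn norm_conjC. Qed.

Lemma hnZ (V : normedModType C) (a : C) (x : V) : hn (a *: x) = hn a * hn x.
Proof. by apply: complexI; rewrite rmorphM/= -!hnE normrZ. Qed.

Section Topology.
Variable V : normedModType C.

Lemma cvg_hnP (u : nat -> V) (l : V) :
  (u @ \oo --> l) <->
  (forall e : R, 0 < e -> exists N, forall n, (N <= n)%N -> hn (u n - l) < e).
Proof.
split => [/cvgrPdist_lt ul e e0|h].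
  have /ul[N _ hN] : 0 < e%:C%C :> C by rewrite ltcR.
  by exists N => n Nn; have := hN n Nn; rewrite hnE ltcR hnB.
apply/cvgrPdist_lt => e e0.
have eE : e = (complex.Re e)%:C%C by rewrite RRe_real// gtr0_real.
have [|N hN] := h (complex.Re e); first by move: e0; rewrite eE ltcR.
by exists N => // n Nn; rewrite eE hnE ltcR hnB; exact: hN.
Qed.

Lemma closed_hnP (A : set V) :
  closed A <-> (forall x, (forall e : R, 0 < e -> exists2 y, A y & hn (y - x) < e) -> A x).
Proof.
split => [cA x hx|h x cx].
  apply: cA => B /nbhs_ballP[e /= e0 eB].
  have eE : e = (complex.Re e)%:C%C by rewrite RRe_real// gtr0_real.
  have [|y Ay xy] := hx (complex.Re e); first by move: e0; rewrite eE ltcR.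
  exists y; split => //; apply: eB; rewrite -ball_normE/=.
  by rewrite eE hnE ltcR hnB.
apply: h => e e0.
have eC : 0 < e%:C%C :> C by rewrite ltcR.
have [y [Ay xy]] := cx _ (nbhsx_ballx x _ eC); exists y => //.
by move: xy; rewrite -ball_normE/= hnE ltcR hnB.
Qed.

End Topology.

Lemma complete_hn (V : completeNormedModType C) (u : nat -> V) :
  (forall e : R, 0 < e -> exists N, forall n m, (N <= n)%N -> (N <= m)%N ->
     hn (u n - u m) < e) -> exists l : V, u @ \oo --> l.
Proof.
move=> h; have /cauchy_cvg/cvg_ex[l ul] : cauchy (u @ \oo); last by exists l.
apply: cauchy_exP => e e0.
have eE : e = (complex.Re e)%:C%C by rewrite RRe_real// gtr0_real.
have [|N hN] := h (complex.Re e); first by move: e0; rewrite eE ltcR.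
exists (u N); exists N => // n /= Nn.
by rewrite -ball_normE/= eE hnE ltcR; exact: hN.
Qed.

Lemma harmonic_small (e : R) : 0 < e -> exists N, forall n, (N <= n)%N -> n.+1%:R^-1 < e.
Proof.
move=> e0; have [N _ hN] := near_infty_natSinv_lt (PosNum e0).
by exists N => n Nn; exact: hN.
Qed.

End RealNorm.

(** * Hilbert space geometry *)

Section Inner.
Variables (R : realType) (H : hilbertType R).
Local Notation C := R[i].
Implicit Types x y z : H.

Lemma innerDr x y z : inner x (y + z) = inner x y + inner x z.
Proof. by have := inner_linear x 1 y z; rewrite !scale1r. Qed.

Lemma inner0r x : inner x 0 = 0.
Proof. by apply: (addrI (inner x 0)); rewrite -innerDr !addr0. Qed.

Lemma innerZr a x y : inner x (a *: y) = a * inner x y.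
Proof. by have := inner_linear x a y 0; rewrite inner0r !addr0. Qed.

Lemma innerDl x y z : inner (x + y) z = inner x z + inner y z.
Proof. by rewrite inner_conj innerDr rmorphD/= -!inner_conj. Qed.

Lemma innerZl a x y : inner (a *: x) y = a^* * inner x y.
Proof. by rewrite inner_conj innerZr rmorphM/= -!inner_conj. Qed.

Lemma inner0l x : inner 0 x = 0.
Proof. by rewrite inner_conj inner0r rmorph0. Qed.

Lemma innerNr x y : inner x (- y) = - inner x y.
Proof. by rewrite -scaleN1r innerZr mulN1r. Qed.

Lemma innerNl x y : inner (- x) y = - inner x y.
Proof. by rewrite inner_conj innerNr rmorphN/= -inner_conj. Qed.

Lemma innerBr x y z : inner x (y - z) = inner x y - inner x z.
Proof. by rewrite innerDr innerNr. Qed.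

Lemma innerBl x y z : inner (x - y) z = inner x z - inner y z.
Proof. by rewrite innerDl innerNl. Qed.

Lemma inner_sumr (I : Type) (s : seq I) (F : I -> H) x :
  inner x (\sum_(i <- s) F i) = \sum_(i <- s) inner x (F i).
Proof.
by elim: s => [|i s IH]; rewrite ?big_nil ?inner0r// !big_cons innerDr IH.
Qed.

Lemma inner_suml (I : Type) (s : seq I) (F : I -> H) x :
  inner (\sum_(i <- s) F i) x = \sum_(i <- s) inner (F i) x.
Proof.
by elim: s => [|i s IH]; rewrite ?big_nil ?inner0l// !big_cons innerDl IH.
Qed.

Lemma innerxx x : inner x x = ((hn x) ^+ 2)%:C%C.
Proof. by rewrite inner_norm hnE rmorphXn. Qed.

Lemma hn_sq x : hn x ^+ 2 = complex.Re (inner x x).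
Proof. by rewrite innerxx. Qed.

Lemma Re_inner_sym x y : complex.Re (inner y x) = complex.Re (inner x y).
Proof. by rewrite inner_conj; case: (inner x y). Qed.

Lemma hn_sqD x y :
  hn (x + y) ^+ 2 = hn x ^+ 2 + 2 * complex.Re (inner x y) + hn y ^+ 2.
Proof.
rewrite !hn_sq innerDl !innerDr !ReD (Re_inner_sym x y).
by ring.
Qed.

Lemma hn_sqB x y :
  hn (x - y) ^+ 2 = hn x ^+ 2 - 2 * complex.Re (inner x y) + hn y ^+ 2.
Proof. by rewrite hn_sqD innerNr ReN hnN; ring. Qed.

Lemma conjM_hn (z : C) : z^* * z = (hn z ^+ 2)%:C%C.
Proof. by rewrite mulrC -normCK hnE rmorphXn. Qed.

Lemma conj_realC (r : R) : (r%:C%C : C)^* = r%:C%C.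
Proof. by apply: conj_Creal; apply/complex_realP; exists r. Qed.

Lemma cauchy_schwarz x y : hn (inner x y) <= hn x * hn y.
Proof.
have [y0|yn0] := eqVneq (hn y) 0.
  by rewrite (hn0_eq0 y0) inner0r !hn0 mulr0.
have yp : 0 < hn y ^+ 2 by rewrite exprn_gt0// lt_def yn0 hn_ge0.
rewrite -ler_sqr ?nnegrE ?mulr_ge0 ?hn_ge0// exprMn -(ler_pM2l yp).
have := sqr_ge0 (hn ((hn y ^+ 2)%:C%C *: x - inner y x *: y)).
rewrite hn_sqB !hnZ hn_realE innerZl innerZr conj_realC [inner y x]inner_conj.
rewrite conjM_hn -rmorphM/= hn_conj !exprMn /= ger0_norm ?sqr_ge0//.
by nra.
Qed.

Lemma hn_inner_diff x y x' y' :
  hn (inner x y - inner x' y') <= hn (x - x') * hn y + hn x' * hn (y - y').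
Proof.
rewrite (_ : _ - _ = inner (x - x') y + inner x' (y - y')).
  by rewrite (le_trans (hnD _ _))// lerD// cauchy_schwarz.
by rewrite innerBl innerBr addrA subrK.
Qed.

Lemma inner_ext x y : (forall z, inner z x = inner z y) -> x = y.
Proof.
move=> h; apply/eqP; rewrite -subr_eq0; apply/eqP/hn0_eq0/eqP.
by rewrite -sqrf_eq0 hn_sq innerBr h subrr.
Qed.

Lemma inner_extl x y : (forall z, inner x z = inner y z) -> x = y.
Proof. by move=> h; apply: inner_ext => z; rewrite inner_conj h -inner_conj. Qed.

Lemma parallelogram x y :
  hn (x - y) ^+ 2 = 2 * hn x ^+ 2 + 2 * hn y ^+ 2 - hn (x + y) ^+ 2.
Proof. by rewrite hn_sqB hn_sqD; ring. Qed.

End Inner.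

Section ClosedSpan.
Variables (R : realType) (H : hilbertType R).
Local Notation C := R[i].

Definition closed_subspace (V : set H) : Prop :=
  [/\ closed V, V 0 & forall a u v, V u -> V v -> V (a *: u + v)].

Definition clspan (S : set H) : set H :=
  [set x | forall V, closed_subspace V -> S `<=` V -> V x].

Lemma total_clspan (S : set H) x : Defs.total S -> clspan S x.
Proof. by move=> tS V [cV V0 Vl] SV; rewrite (tS V cV V0 Vl SV). Qed.

Lemma clspan_total (S : set H) : (forall x, clspan S x) -> Defs.total S.
Proof. by move=> h V cV V0 Vl SV; apply/seteqP; split => // x _; exact: h. Qed.

Lemma sub_clspan (S : set H) : S `<=` clspan S.
Proof. by move=> x Sx V _; exact. Qed.

Lemma clspan_subspace (S : set H) : closed_subspace (clspan S).
Proof.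
split.
- apply/closed_hnP => x hx V cV SV; have [cl _ _] := cV.
  move/closed_hnP: cl; apply => e e0.
  by have [y Sy yx] := hx e e0; exists y => //; exact: Sy.
- by move=> V [].
- by move=> a u v Su Sv V cV SV; have [_ _ h] := cV; apply: h; [exact: Su|exact: Sv].
Qed.

Lemma closed_subspaceZ (V : set H) a u : closed_subspace V -> V u -> V (a *: u).
Proof. by move=> [_ V0 h] Vu; rewrite -[_ *: _]addr0; exact: h. Qed.

End ClosedSpan.

(** * Bounded operators, Riesz representation and adjoints *)

Section Bounded.
Variable R : realType.
Local Notation C := R[i].
Implicit Types H K L : hilbertType R.

Lemma bounded_opP H K (A : H -> K) : bounded_op A <->
  linear A /\ exists2 M : R, 0 <= M & forall x, hn (A x) <= M * hn x.
Proof.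
split => [[lA [M hM]]|[lA [M M0 hM]]]; split => //.
  exists (hn M); first exact: hn_ge0.
  move=> x; have := hM x; rewrite !hnE => AM.
  have : (hn (A x))%:C%C <= (complex.Re (M * (hn x)%:C%C))%:C%C :> C.
    have re : M * (hn x)%:C%C \is Num.real.
      by rewrite ger0_real// (le_trans _ AM)// lecR hn_ge0.
    by rewrite (RRe_real re).
  rewrite lecR => /le_trans; apply.
  rewrite (le_trans (ler_norm _))// (le_trans (Re_le_hn _))// hnM hn_real//.
  exact: hn_ge0.
by exists M%:C%C => x; rewrite !hnE -rmorphM/= lecR.
Qed.

Section Linear.
Variables (H K : hilbertType R) (A : H -> K).
Hypothesis lA : linear A.

Lemma opD x y : A (x + y) = A x + A y.
Proof. by have := lA 1 x y; rewrite !scale1r. Qed.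

Lemma op0 : A 0 = 0.
Proof. by apply: (addrI (A 0)); rewrite -opD !addr0. Qed.

Lemma opZ a x : A (a *: x) = a *: A x.
Proof. by have := lA a x 0; rewrite op0 !addr0. Qed.

Lemma opN x : A (- x) = - A x.
Proof. by rewrite -scaleN1r opZ scaleN1r. Qed.

Lemma opB x y : A (x - y) = A x - A y.
Proof. by rewrite opD opN. Qed.

Lemma op_sum (I : Type) (s : seq I) (F : I -> H) :
  A (\sum_(i <- s) F i) = \sum_(i <- s) A (F i).
Proof. by elim: s => [|i s IH]; rewrite ?big_nil ?op0// !big_cons opD IH. Qed.

End Linear.

Lemma bounded_op_id H : bounded_op (@id H).
Proof. by apply/bounded_opP; split => //; exists 1 => // x; rewrite mul1r. Qed.

Lemma bounded_op_comp H K L (A : K -> L) (B : H -> K) :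
  bounded_op A -> bounded_op B -> bounded_op (A \o B).
Proof.
move=> /bounded_opP[lA [M M0 hM]] /bounded_opP[lB [N N0 hN]].
apply/bounded_opP; split; first by move=> a x y /=; rewrite lB lA.
exists (M * N); first exact: mulr_ge0.
by move=> x /=; rewrite (le_trans (hM _))// -mulrA ler_wpM2l.
Qed.

Lemma bounded_opD H K (A B : H -> K) :
  bounded_op A -> bounded_op B -> bounded_op (A \+ B).
Proof.
move=> /bounded_opP[lA [M M0 hM]] /bounded_opP[lB [N N0 hN]].
apply/bounded_opP; split; first by move=> a x y /=; rewrite lB lA scalerDr addrACA.
exists (M + N); first exact: addr_ge0.
by move=> x /=; rewrite (le_trans (hnD _ _))// mulrDl lerD.
Qed.

Lemma bounded_opZ H K a (A : H -> K) :
  bounded_op A -> bounded_op (fun x => a *: A x).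
Proof.
move=> /bounded_opP[lA [M M0 hM]].
apply/bounded_opP; split.
  by move=> b x y /=; rewrite lA scalerDr !scalerA mulrC.
exists (hn a * M); first by rewrite mulr_ge0 ?hn_ge0.
by move=> x /=; rewrite hnZ -mulrA ler_wpM2l ?hn_ge0.
Qed.

Lemma bounded_opN H K (A : H -> K) : bounded_op A -> bounded_op (fun x => - A x).
Proof.
by move=> /(bounded_opZ (-1)); under eq_fun do rewrite scaleN1r.
Qed.

Lemma closed_subspace_preim H K (A : H -> K) (V : set K) :
  bounded_op A -> closed_subspace V -> closed_subspace (A @^-1` V).
Proof.
move=> /bounded_opP[lA [M M0 hM]] [/closed_hnP cV V0 Vl]; split.
- apply/closed_hnP => x hx /=; apply: cV => e e0.
  have [|y Vy xy] := hx (e / (M + 1)); first by rewrite divr_gt0 ?ltr_wpDl.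
  exists (A y) => //; rewrite -(opB lA) (le_lt_trans (hM _))//.
  have := hn_ge0 (y - x); move: xy; rewrite ltr_pdivlMr ?ltr_wpDl//.
  by nra.
- by rewrite /= (op0 lA).
- by move=> a u v /= Vu Vv; rewrite lA; exact: Vl.
Qed.

(** Lets density arguments propagate identities between bounded operators. *)
Lemma closed_subspace_eq H K (A B : H -> K) :
  bounded_op A -> bounded_op B -> closed_subspace [set x | A x = B x].
Proof.
move=> bA bB.
have bAB : bounded_op (A \+ (fun x => - B x)).
  by apply: bounded_opD => //; exact: bounded_opN.
have -> : [set x | A x = B x] = (A \+ (fun x => - B x)) @^-1` [set 0].
  apply/seteqP; split => x /=; first by move->; rewrite subrr.
  by move/eqP; rewrite subr_eq0 => /eqP.
apply: closed_subspace_preim => //; split => //.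
- apply/closed_hnP => x h; apply: hn_le_small => e e0.
  by have [y -> ] := h e e0; rewrite sub0r hnN => /ltW.
- by move=> a u v -> ->; rewrite scaler0 addr0.
Qed.

Lemma clspan_map H K (A : H -> K) (S : set H) (T : set K) x :
  bounded_op A -> (forall y, S y -> clspan T (A y)) -> clspan S x -> clspan T (A x).
Proof.
move=> bA h Sx.
apply: (Sx (A @^-1` clspan T)) => //.
by apply: closed_subspace_preim => //; exact: clspan_subspace.
Qed.

Lemma total_eq_op H K (A B : H -> K) (S : set H) :
  bounded_op A -> bounded_op B -> Defs.total S ->
  (forall x, S x -> A x = B x) -> A =1 B.
Proof.
move=> bA bB tS h x.
by apply: (total_clspan x tS (closed_subspace_eq bA bB)).
Qed.

(** Density in one argument of an identity between inner products; an identity in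
two arguments follows by using it twice. *)
Lemma inner_eq_preim H K (A : H -> K) (S : set H) a b x :
  bounded_op A -> (forall y, S y -> inner a (A y) = inner b y) ->
  clspan S x -> inner a (A x) = inner b x.
Proof.
move=> bA h Sx; apply: (Sx [set x | inner a (A x) = inner b x]) => //.
move/bounded_opP: bA => [lA [M M0 hM]]; split => /=.
- apply/closed_hnP => z hz /=; apply/eqP; rewrite -subr_eq0; apply/eqP.
  apply: hn_le_small => e e0.
  have P0 : 0 < hn a * M + hn b + 1 by rewrite ltr_wpDl ?addr_ge0 ?mulr_ge0 ?hn_ge0.
  have [|y /= Vy xy] := hz (e / (hn a * M + hn b + 1)); first by rewrite divr_gt0.
  rewrite (_ : _ - _ = inner a (A (z - y)) + inner b (y - z)).
    rewrite (le_trans (hnD _ _))// (le_trans (lerD (cauchy_schwarz _ _) (cauchy_schwarz _ _)))//.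
    move: xy; rewrite ltr_pdivlMr// => xy.
    have := hM (z - y); have := hn_ge0 a; have := hn_ge0 b; have := hn_ge0 (y - z).
    rewrite (hnB z y) => p1 p2 p3 p4.
    have : hn a * hn (A (z - y)) <= hn a * (M * hn (y - z)) by rewrite ler_wpM2l.
    by nra.
  by rewrite (opB lA) !innerBr Vy addrA subrK.
- by rewrite (op0 lA) !inner0r.
- by move=> c u v ? ?; rewrite lA !innerDr !innerZr; congr (_ * _ + _).
Qed.

End Bounded.

Section Riesz.
Variables (R : realType) (H : hilbertType R).
Local Notation C := R[i].

(** Its minimiser is the vector representing [phi]. *)
Let energy (phi : H -> C) (z : H) : R := hn z ^+ 2 - 2 * complex.Re (phi z).

(** The parallelogram law makes the minimising sequences of [energy phi] converge,
and the first variation at the minimiser [z] is [inner z y - phi y]. *)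
Lemma riesz (phi : H -> C) (M : R) :
  (forall a u v, phi (a *: u + v) = a * phi u + phi v) ->
  (forall y, hn (phi y) <= M * hn y) ->
  exists z, forall y, phi y = inner z y.
Proof.
move=> lphi bphi.
have phi0 : phi 0 = 0.
  have := lphi 1 0 0; rewrite scaler0 addr0 mul1r -[X in X = _]addr0.
  by move/addrI => <-.
have phiZ a u : phi (a *: u) = a * phi u by rewrite -[a *: u]addr0 lphi phi0 addr0.
have phiD u v : phi (u + v) = phi u + phi v by rewrite -[u]scale1r lphi mul1r scale1r.
pose J := energy phi.
have Jlb (z : H) : - M ^+ 2 <= J z.
  have h1 : complex.Re (phi z) <= M * hn z.
    by rewrite (le_trans (ler_norm _))// (le_trans (Re_le_hn _)).
  by rewrite /J /energy; have := sqr_ge0 (hn z - M); nra.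
have JD (z : H) (t : R) (y : H) : J (z + t%:C%C *: y) =
    J z + t ^+ 2 * hn y ^+ 2 + 2 * t * (complex.Re (inner z y) - complex.Re (phi y)).
  rewrite /J /energy hn_sqD innerZr hnZ hn_realE phiD phiZ ReD !ReZ exprMn real_normK ?num_real//.
  by ring.
have hinf : has_inf (range J).
  by split; [exists (J 0), 0|exists (- M ^+ 2) => _ [z _ <-]].
pose m : R := inf (range J).
have mJ (z : H) : m <= J z by apply: ge_inf; [case: hinf|exists z].
have /choice[z hz] : forall n : nat, exists z, J z < m + n.+1%:R^-1.
  move=> n; have n0 : 0 < n.+1%:R^-1 :> R by rewrite invr_gt0.
  by have [_ [z _ <-] hz] := inf_adherent n0 hinf; exists z.
have Jpar (x y : H) : hn (x - y) ^+ 2 <= 2 * (J x - m) + 2 * (J y - m).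
  have mid : 4 * J ((2^-1 : R)%:C%C *: (x + y)) =
      hn (x + y) ^+ 2 - 4 * (complex.Re (phi x) + complex.Re (phi y)) :> R.
    rewrite /J /energy phiZ hnZ hn_real ?invr_ge0// ReZ phiD ReD exprMn.
    by field.
  have := mJ ((2^-1 : R)%:C%C *: (x + y)).
  rewrite parallelogram; move: mid; move: (J (_ *: _)) => j; rewrite /J /energy => mid hj.
  by lra.
have [l zl] : exists l : H, z @ \oo --> l.
  apply: complete_hn => e e0.
  have e20 : 0 < e ^+ 2 / 4 by rewrite divr_gt0// exprn_gt0.
  have [N hN] := harmonic_small e20; exists N => n k Nn Nk.
  rewrite -ltr_sqr ?nnegrE ?hn_ge0 ?ltW//.
  apply: le_lt_trans (Jpar _ _) _.
  have zN i : (N <= i)%N -> J (z i) < m + e ^+ 2 / 4.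
    by move=> Ni; rewrite (lt_trans (hz i))// ltrD2l hN.
  by have := zN n Nn; have := zN k Nk; lra.
have Re_eq (y : H) : complex.Re (inner l y) = complex.Re (phi y).
  set r := complex.Re (inner l y) - complex.Re (phi y).
  have var (t : R) : 0 <= t ^+ 2 * hn y ^+ 2 + 2 * t * r.
    apply/ler_addgt0Pr => e e0.
    have d0 : 0 < e / (4 * `|t| * hn y + 2).
      by rewrite divr_gt0// ltr_wpDl// !mulr_ge0 ?hn_ge0.
    move/cvg_hnP : zl => /(_ _ d0)[N1 hN1].
    have e20 : 0 < e / 2 by rewrite divr_gt0.
    have [N2 hN2] := harmonic_small e20.
    pose n := maxn N1 N2.
    have h1 := hN1 n (leq_maxl _ _); have h2 := hN2 n (leq_maxr _ _).
    have h3 : J (z n) < m + e / 2 by rewrite (lt_trans (hz n))// ltrD2l.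
    have h4 := mJ (z n + t%:C%C *: y).
    rewrite JD in h4.
    have h5 : `|complex.Re (inner (z n) y) - complex.Re (inner l y)| <= hn (z n - l) * hn y.
      by rewrite -ReB -innerBl (le_trans (Re_le_hn _))// cauchy_schwarz.
    have h6 : 2 * `|t| * (hn (z n - l) * hn y) <= e / 2.
      move: h1; rewrite ltr_pdivlMr; last by rewrite ltr_wpDl// !mulr_ge0 ?hn_ge0.
      by have := hn_ge0 (z n - l); nra.
    have h7 : `|2 * t * (complex.Re (inner (z n) y) - complex.Re (inner l y))| <= e / 2.
      by rewrite !normrM ger0_norm// (le_trans _ h6)// ler_wpM2l// mulr_ge0.
    move: h7; rewrite ler_norml => /andP[h7 h8].
    by rewrite /r; nra.
  apply/eqP; rewrite -subr_eq0 -/r; apply: contraT => r0.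
  have Y1 : 0 < hn y ^+ 2 + 1 by rewrite ltr_wpDl ?sqr_ge0.
  have := var (- r / (hn y ^+ 2 + 1)).
  rewrite (_ : _ + _ = - (r ^+ 2 * (hn y ^+ 2 + 2)) / (hn y ^+ 2 + 1) ^+ 2); last first.
    by field; rewrite lt0r_neq0.
  rewrite leNgt pmulr_llt0 ?invr_gt0 ?exprn_gt0//.
  by rewrite oppr_lt0 mulr_gt0 ?exprn_even_gt0// ltr_wpDl ?sqr_ge0.
exists l => y; apply/eqP; rewrite eq_complex Re_eq eqxx /=.
have := Re_eq ('i%C *: y); rewrite innerZr phiZ.
by case: (inner l y) (phi y) => a b [c d] /=; rewrite !mul0r !mul1r !sub0r => /oppr_inj ->.
Qed.

End Riesz.

Section Adjoint.
Variable R : realType.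
Local Notation C := R[i].
Implicit Types H K L : hilbertType R.

Lemma adj_spec H K (A : H -> K) : bounded_op A ->
  bounded_op (adj A) /\ forall x y, inner x (A y) = inner (adj A x) y.
Proof.
move=> /bounded_opP[lA [M M0 hM]].
have /choice[B hB] : forall x, exists z, forall y, inner x (A y) = inner z y.
  move=> x; apply: (@riesz _ _ _ (hn x * M)).
    by move=> a u v; rewrite lA innerDr innerZr.
  by move=> y; rewrite (le_trans (cauchy_schwarz _ _))// -mulrA ler_wpM2l ?hn_ge0.
suff : exists B : K -> H, bounded_op B /\ forall x y, inner x (A y) = inner (B x) y.
  by move/(@getPex _ [set B : K -> H | bounded_op B /\ forall x y, inner x (A y) = inner (B x) y]).
exists B; split => //; apply/bounded_opP; split.
  move=> a x y; apply: inner_extl => z.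
  by rewrite -hB !innerDl !innerZl -!hB.
exists M => // x.
have [->|B0] := eqVneq (hn (B x)) 0; first by rewrite mulr_ge0 ?hn_ge0.
have Bp : 0 < hn (B x) by rewrite lt_def B0 hn_ge0.
rewrite -(ler_pM2l Bp) -expr2 hn_sq -hB (le_trans (ler_norm _))//.
rewrite (le_trans (Re_le_hn _))// (le_trans (cauchy_schwarz _ _))//.
by have := hM (B x); have := hn_ge0 x; nra.
Qed.

Lemma bounded_adj H K (A : H -> K) : bounded_op A -> bounded_op (adj A).
Proof. by move=> /adj_spec[]. Qed.

Lemma inner_adjl H K (A : H -> K) x y : bounded_op A ->
  inner (adj A x) y = inner x (A y).
Proof. by move=> /adj_spec[_ ->]. Qed.

Lemma inner_adjr H K (A : H -> K) x y : bounded_op A ->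
  inner y (adj A x) = inner (A y) x.
Proof. by move=> bA; rewrite inner_conj inner_adjl// -inner_conj. Qed.

Definition isometric H K (A : H -> K) : Prop :=
  bounded_op A /\ forall x y, inner (A x) (A y) = inner x y.

Lemma isometric_hn H K (A : H -> K) x : isometric A -> hn (A x) = hn x.
Proof.
move=> [_ iA]; apply/eqP; rewrite -(@eqrXn2 _ 2)// ?hn_ge0//.
by rewrite !hn_sq iA.
Qed.

Lemma isometric_adjK H K (A : H -> K) x : isometric A -> adj A (A x) = x.
Proof. by move=> [bA iA]; apply: inner_ext => z; rewrite inner_adjr. Qed.

Lemma unitary_isometric H K (A : H -> K) : unitary A -> isometric A.
Proof.
move=> [bA adjA _]; split => // x y.
by rewrite -inner_adjl// -[adj A (A x)]/((adj A \o A) x) adjA.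
Qed.

Definition contractive H K (A : H -> K) : Prop :=
  bounded_op A /\ forall x, hn (A x) <= hn x.

Lemma isometric_contractive H K (A : H -> K) : isometric A -> contractive A.
Proof. by move=> iA; split=> [|x]; [case: iA|rewrite isometric_hn]. Qed.

Lemma contractive_adj H K (A : H -> K) : contractive A -> contractive (adj A).
Proof.
move=> [bA cA]; split; first exact: bounded_adj.
move=> x; have [->|B0] := eqVneq (hn (adj A x)) 0; first exact: hn_ge0.
have Bp : 0 < hn (adj A x) by rewrite lt_def B0 hn_ge0.
rewrite -(ler_pM2l Bp) -expr2 hn_sq inner_adjl// (le_trans (ler_norm _))//.
rewrite (le_trans (Re_le_hn _))// (le_trans (cauchy_schwarz _ _))//.
by rewrite mulrC ler_wpM2r ?hn_ge0.
Qed.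

Lemma contractive_comp H K L (A : K -> L) (B : H -> K) :
  contractive A -> contractive B -> contractive (A \o B).
Proof.
move=> [bA cA] [bB cB]; split; first exact: bounded_op_comp.
by move=> x; exact: le_trans (cA _) (cB _).
Qed.

End Adjoint.

Section Extension.
Variable R : realType.
Local Notation C := R[i].
Variables (X : Type) (H K : hilbertType R) (D : set X) (a : X -> H) (b : X -> K).
Local Notation T := (op_such_that D a b).

(** Formal linear combinations of the points of [D], so that density arguments
need no case analysis on membership. *)
Let lincomb (V : hilbertType R) (f : X -> V) (p : seq (C * {x | D x})) : V :=
  \sum_(q <- p) q.1 *: f (sval q.2).

Let lincombE c p p' (V : hilbertType R) (f : X -> V) :
  lincomb f ([seq (c * q.1, q.2) | q <- p] ++ p') =
  c *: lincomb f p + lincomb f p'.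
Proof.
rewrite /lincomb big_cat big_map/= scaler_sumr; congr (_ + _).
by apply: eq_bigr => q _; rewrite scalerA.
Qed.

(** A densely defined bounded linear map extends: the closure of its graph is
again a graph, whose domain is a closed subspace. *)
Lemma bounded_extension (M : R) :
  0 <= M -> Defs.total (a @` D) ->
  (forall p, hn (lincomb b p) <= M * hn (lincomb a p)) ->
  [/\ bounded_op T, forall x, D x -> T (a x) = b x & forall x, hn (T x) <= M * hn x].
Proof.
move=> M0 tA hM.
pose Gr (x : H) (y : K) := forall e : R, 0 < e ->
  exists p, hn (lincomb a p - x) < e /\ hn (lincomb b p - y) < e.
have Gr_gen x : D x -> Gr (a x) (b x).
  move=> Dx e e0; exists [:: (1, exist _ x Dx)].
  by rewrite /lincomb !big_seq1/= !scale1r !subrr !hn0.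
have Gr_lin (c : C) (x : H) (y : K) (x' : H) (y' : K) : Gr x y -> Gr x' y' -> Gr (c *: x + x') (c *: y + y').
  move=> h h' e e0.
  have c0 : 0 < hn c + 1 by rewrite ltr_wpDl ?hn_ge0.
  have d0 : 0 < e / 2 / (hn c + 1) by rewrite !divr_gt0.
  have [|p [p1 p2]] := h (e / 2 / (hn c + 1)); first by [].
  have [|q [q1 q2]] := h' (e / 2); first by rewrite divr_gt0.
  exists ([seq (c * r.1, r.2) | r <- p] ++ q); rewrite !lincombE.
  have tri (V : hilbertType R) (u u' v v' : V) : hn (u - v) < e / 2 / (hn c + 1) ->
      hn (u' - v') < e / 2 -> hn (c *: u + u' - (c *: v + v')) < e.
    move=> uv uv'; rewrite opprD addrACA -scalerBr (le_lt_trans (hnD _ _))// hnZ.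
    move: uv; rewrite ltr_pdivlMr//; have := hn_ge0 (u - v); have := hn_ge0 c.
    by nra.
  by split; apply: tri.
have Gr_bd (x : H) (y : K) : Gr x y -> hn y <= M * hn x.
  move=> h; apply/ler_addgt0Pr => e e0.
  have M1 : 0 < M + 1 by rewrite ltr_wpDl.
  have [|p [p1 p2]] := h (e / (M + 1)); first by rewrite divr_gt0.
  have h1 : hn y <= hn (lincomb b p) + hn (y - lincomb b p).
    by rewrite -[X in hn X <= _](subrK (lincomb b p)) addrC hnD.
  have h2 : hn (lincomb a p) <= hn x + hn (lincomb a p - x).
    by rewrite -[X in hn X <= _](subrK x) addrC hnD.
  have h3 := hM p; rewrite hnB in h1.
  move: p1 p2; rewrite !ltr_pdivlMr//; have := hn_ge0 (lincomb a p - x).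
  by have := hn_ge0 (lincomb b p - y); nra.
have Gr0 : Gr 0 0.
  by move=> e e0; exists [::]; rewrite /lincomb !big_nil !subrr !hn0.
have GrB (x : H) (y : K) (x' : H) (y' : K) : Gr x y -> Gr x' y' -> hn (y - y') <= M * hn (x - x').
  move=> h h'; apply: Gr_bd.
  by rewrite [y - y']addrC [x - x']addrC -(scaleN1r y') -(scaleN1r x'); exact: Gr_lin.
have Gr_dom (x : H) : exists y, Gr x y.
  apply: (total_clspan x tA (V := [set x | exists y, Gr x y])); last first.
    by move=> _ [z Dz <-]; exists (b z); exact: Gr_gen.
  split; last 2 first.
  - by exists 0.
  - by move=> c u v [y hy] [y' hy']; exists (c *: y + y'); exact: Gr_lin.
  apply/closed_hnP => z hz /=.
  have /choice[u hu] : forall n : nat, exists p : H * K, Gr p.1 p.2 /\ hn (p.1 - z) < n.+1%:R^-1.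
    move=> n; have [|y [w hw] yz] := hz n.+1%:R^-1; first by rewrite invr_gt0.
    by exists (y, w).
  have M1 : 0 < M + 1 by rewrite ltr_wpDl.
  have [l ul] : exists l : K, (fun n => (u n).2) @ \oo --> l.
    apply: complete_hn => e e0.
    have d0 : 0 < e / 2 / (M + 1) by rewrite !divr_gt0.
    have [N hN] := harmonic_small d0; exists N => n k Nn Nk.
    have [G1 d1] := hu n; have [G2 d2] := hu k.
    apply: le_lt_trans (GrB _ _ _ _ G1 G2) _.
    have := hn_dist (u n).1 z (u k).1; rewrite (hnB z).
    move: (lt_trans d1 (hN _ Nn)) (lt_trans d2 (hN _ Nk)).
    rewrite !ltr_pdivlMr// => b1 b2 b3.
    have := hn_ge0 ((u n).1 - z); have := hn_ge0 ((u k).1 - z).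
    by nra.
  exists l => e e0.
  have e20 : 0 < e / 2 by rewrite divr_gt0.
  move/cvg_hnP : ul => /(_ _ e20)[N1 hN1]; have [N2 hN2] := harmonic_small e20.
  pose n := maxn N1 N2.
  have h1 := hN1 n (leq_maxl _ _); have h2 := hN2 n (leq_maxr _ _).
  have [G1 d1] := hu n; have [p [p1 p2]] := G1 _ e20.
  exists p; split.
  - have := hn_dist (lincomb a p) (u n).1 z.
    by have := lt_trans d1 h2; lra.
  - by have := hn_dist (lincomb b p) (u n).2 l; lra.
have [T0 hT0] := choice Gr_dom.
have Gr_fun x y : Gr x y -> T0 x = y.
  move=> h; apply/eqP; rewrite -subr_eq0; apply/eqP/hn0_eq0/eqP.
  rewrite eq_le hn_ge0 andbT.
  by have := GrB _ _ _ _ (hT0 x) h; rewrite subrr hn0 mulr0.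
have bT0 : bounded_op T0.
  apply/bounded_opP; split; last by exists M => // x; exact: Gr_bd.
  by move=> c x y; apply: Gr_fun; exact: Gr_lin.
have [bT hT] : bounded_op T /\ forall x, D x -> T (a x) = b x.
  apply: (@getPex _ [set T : H -> K | bounded_op T /\ forall x, D x -> T (a x) = b x]).
  by exists T0; split => // x Dx; apply: Gr_fun; exact: Gr_gen.
split => // x; have -> : T x = T0 x.
  apply: total_eq_op tA _ _ => // _ [z Dz <-]; rewrite hT//; apply/esym.
  by apply: Gr_fun; exact: Gr_gen.
exact: Gr_bd.
Qed.

(** Inner products of combinations are determined by those of the generators, so the
bound required for an extension holds with constant 1. *)
Lemma isometric_extension :
  Defs.total (a @` D) ->
  (forall x y, D x -> D y -> inner (b x) (b y) = inner (a x) (a y)) ->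
  isometric T /\ forall x, D x -> T (a x) = b x.
Proof.
move=> tA hab.
have [p|bT hT _] := bounded_extension ler01 tA.
  rewrite mul1r -ler_sqr ?nnegrE ?hn_ge0// !hn_sq /lincomb !inner_suml.
  rewrite le_eqVlt; apply/orP; left; apply/eqP; congr complex.Re.
  apply: eq_bigr => q _; rewrite !inner_sumr; apply: eq_bigr => r _.
  by rewrite !innerZr !innerZl hab//; exact: svalP.
split => //; split => // x y.
apply: (inner_eq_preim (S := a @` D)) => //; last exact: total_clspan.
move=> _ [z Dz <-]; rewrite hT// inner_conj [RHS]inner_conj; congr (_ ^*).
apply: (inner_eq_preim (S := a @` D)) => //; last exact: total_clspan.
by move=> _ [z' Dz' <-]; rewrite hT// hab.
Qed.

End Extension.

(** * Tensor products *)

Section Tensor.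
Variables (R : realType) (H K : hilbertType R) (T : tensor_product H K).
Local Notation C := R[i].
Local Notation "u ⊠ v" := (tens T u v) (at level 40, left associativity).

Lemma tensZl a u v : (a *: u) ⊠ v = a *: (u ⊠ v).
Proof. by apply: (@opZ _ _ _ (fun u => u ⊠ v)); exact: tens_linear_l. Qed.

Lemma tensZr a u v : u ⊠ (a *: v) = a *: (u ⊠ v).
Proof. by apply: (@opZ _ _ _ (tens T u)); exact: tens_linear_r. Qed.

Lemma hn_tens u v : hn (u ⊠ v) = hn u * hn v.
Proof.
apply/eqP; rewrite -(@eqrXn2 _ 2) ?mulr_ge0 ?hn_ge0//.
by rewrite hn_sq tens_inner !innerxx -rmorphM/= exprMn.
Qed.

Lemma bounded_tensr u : bounded_op (tens T u).
Proof.
apply/bounded_opP; split; first exact: tens_linear_r.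
by exists (hn u); [exact: hn_ge0|move=> v; rewrite hn_tens].
Qed.

Lemma bounded_tensl v : bounded_op (tens T ^~ v).
Proof.
apply/bounded_opP; split; first exact: tens_linear_l.
by exists (hn v); [exact: hn_ge0|move=> u; rewrite hn_tens mulrC].
Qed.

(** Contraction of the second factor against [phi]. *)
Definition slice (phi : K) : T -> H := adj (tens T ^~ phi).

Lemma bounded_slice phi : bounded_op (slice phi).
Proof. by apply: bounded_adj; exact: bounded_tensl. Qed.

Lemma inner_slice u phi z : inner u (slice phi z) = inner (u ⊠ phi) z.
Proof. by rewrite inner_adjr//; exact: bounded_tensl. Qed.

Lemma slice_tens phi u v : slice phi (u ⊠ v) = inner phi v *: u.
Proof.
by apply: inner_ext => w; rewrite inner_slice tens_inner innerZr mulrC.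
Qed.

Lemma hn_slice phi z : hn (slice phi z) <= hn phi * hn z.
Proof.
have [->|B0] := eqVneq (hn (slice phi z)) 0; first by rewrite mulr_ge0 ?hn_ge0.
have Bp : 0 < hn (slice phi z) by rewrite lt_def B0 hn_ge0.
rewrite -(ler_pM2l Bp) -expr2 hn_sq inner_slice (le_trans (ler_norm _))//.
rewrite (le_trans (Re_le_hn _))// (le_trans (cauchy_schwarz _ _))//.
by rewrite hn_tens mulrA.
Qed.

Lemma clspan_tensl (S : set H) (Q : set T) u v :
  (forall w, S w -> clspan Q (w ⊠ v)) -> clspan S u -> clspan Q (u ⊠ v).
Proof. by move=> h; apply: clspan_map h; exact: bounded_tensl. Qed.

Lemma clspan_tensr (S : set K) (Q : set T) u v :
  (forall w, S w -> clspan Q (u ⊠ w)) -> clspan S v -> clspan Q (u ⊠ v).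
Proof. by move=> h; apply: clspan_map h; exact: bounded_tensr. Qed.

Lemma clspan_tens_total (Q : set T) z :
  (forall u v, clspan Q (u ⊠ v)) -> clspan Q z.
Proof.
move=> h; apply: (total_clspan z (@tens_total _ _ _ T) (clspan_subspace Q)).
by move=> _ [[u v] _ <-]; exact: h.
Qed.

(** Gram-Schmidt on the second legs. Any bilinear expression in a finite tensor keeps its
value, so norms may be computed with orthogonal legs; zero vectors are kept, hence no
normalisation is needed. *)
Lemma orthogonal_legs (p : seq (H * K)) :
  exists2 q : seq (H * K),
    pairwise (fun a b => inner a.2 b.2 == 0) q &
    forall (V : hilbertType R) (beta : H -> K -> V),
      (forall v, linear (beta^~ v)) -> (forall u, linear (beta u)) ->
      \sum_(x <- p) beta x.1 x.2 = \sum_(x <- q) beta x.1 x.2.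
Proof.
elim: p => [|[u v] p [q oq hq]]; first by exists [::] => // *; rewrite !big_nil.
pose c (e : K) : C := inner e v / inner e e.
pose r := v - \sum_(x <- q) c x.2 *: x.2.
have cE e : c e * inner e e = inner e v.
  have [->|e0] := eqVneq e 0; first by rewrite /c !inner0l mulr0.
  by rewrite /c divfK// inner_norm sqrf_eq0 normr_eq0.
exists ((u, r) :: [seq (x.1 + c x.2 *: u, x.2) | x <- q]).
- rewrite /= pairwise_map; apply/andP; split; last by apply: sub_pairwise oq.
  have orth s : pairwise (fun a b : H * K => inner a.2 b.2 == 0) s ->
      all (fun x : H * K => inner x.2 (\sum_(y <- s) c y.2 *: y.2) == inner x.2 v) s.
    elim: s => //= x s IH /andP[xs os]; rewrite big_cons innerDr innerZr cE.
    rewrite inner_sumr big1_seq ?addr0 ?eqxx; last first.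
      by move=> y /andP[_ ys]; rewrite innerZr (eqP (allP xs _ ys)) mulr0.
    apply/allP => y ys; rewrite innerDr innerZr.
    rewrite inner_conj (eqP (allP xs _ ys)) rmorph0 mulr0 add0r.
    exact: (allP (IH os)).
  apply/allP => _ /mapP[x xq ->] /=.
  rewrite inner_conj /r innerBr (eqP (allP (orth _ oq) _ xq)) subrr rmorph0.
  by rewrite eqxx.
- move=> V beta bl br; rewrite !big_cons big_map/= (hq _ _ bl br).
  rewrite {1}(_ : v = r + \sum_(x <- q) c x.2 *: x.2); last by rewrite subrK.
  rewrite (opD (br u)) -addrA; congr (_ + _).
  rewrite (op_sum (br u)) -big_split/=; apply: eq_bigr => x _.
  by rewrite (opD (bl x.2)) (opZ (br u)) (opZ (bl x.2)) addrC.
Qed.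

Lemma hn_orthogonal_sum (q : seq (H * K)) :
  pairwise (fun a b => inner a.2 b.2 == 0) q ->
  hn (\sum_(x <- q) x.1 ⊠ x.2) ^+ 2 = \sum_(x <- q) hn x.1 ^+ 2 * hn x.2 ^+ 2.
Proof.
elim: q => [|x q IH]; first by rewrite !big_nil hn0 expr0n.
move=> /= /andP[xq oq]; rewrite !big_cons hn_sqD IH// hn_tens exprMn.
rewrite inner_sumr big1_seq ?mulr0 ?addr0// => y /andP[_ yq].
by rewrite tens_inner (eqP (allP xq _ yq)) mulr0.
Qed.

End Tensor.

Section TensorOp.
Variables (R : realType) (S : realization R).
Local Notation C := R[i].
Local Notation "H ⊗ K" := (tensor_space (tensor S H K))
  (at level 40, left associativity).
Local Notation "u ⊠ v" := (tens (tensor S _ _) u v)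
  (at level 40, left associativity).
Implicit Types H K : hilbertType R.

(** With orthogonal second legs both squared norms are sums over the terms, and the
bound holds term by term. *)
Lemma ampliation_bound H K H' (A : H -> H') (M : R) (p : seq (H * K)) :
  0 <= M -> linear A -> (forall x, hn (A x) <= M * hn x) ->
  hn (\sum_(x <- p) A x.1 ⊠ x.2 : H' ⊗ K) <= M * hn (\sum_(x <- p) x.1 ⊠ x.2 : H ⊗ K).
Proof.
move=> M0 lA hM; have [q oq hq] := orthogonal_legs p.
rewrite (hq _ (fun u v => A u ⊠ v)); last 2 first.
- by move=> v a x y; rewrite lA tens_linear_l.
- by move=> u a x y; rewrite tens_linear_r.
rewrite (hq _ (fun u v => u ⊠ v)); last 2 first.
- by move=> v a x y; rewrite tens_linear_l.
- by move=> u a x y; rewrite tens_linear_r.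
rewrite -ler_sqr ?nnegrE ?mulr_ge0 ?hn_ge0// exprMn hn_orthogonal_sum//.
rewrite (_ : \sum_(x <- q) A x.1 ⊠ x.2 =
  \sum_(x <- [seq (A x.1, x.2) | x <- q]) x.1 ⊠ x.2); last by rewrite big_map.
rewrite hn_orthogonal_sum; last by rewrite pairwise_map; apply: sub_pairwise oq.
have le1 (x : H * K) :
    hn (A x.1) ^+ 2 * hn x.2 ^+ 2 <= M ^+ 2 * (hn x.1 ^+ 2 * hn x.2 ^+ 2).
  rewrite mulrA ler_wpM2r ?sqr_ge0// -exprMn ler_sqr ?nnegrE ?mulr_ge0 ?hn_ge0//.
by rewrite big_map mulr_sumr; apply: ler_sum => x _; exact: le1.
Qed.

Lemma hn_sum_flip H K (p : seq (H * K)) :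
  hn (\sum_(x <- p) x.2 ⊠ x.1 : K ⊗ H) = hn (\sum_(x <- p) x.1 ⊠ x.2 : H ⊗ K).
Proof.
apply/eqP; rewrite -(@eqrXn2 _ 2) ?hn_ge0//; apply/eqP.
rewrite !hn_sq !inner_suml; congr complex.Re; apply: eq_bigr => x _.
by rewrite !inner_sumr; apply: eq_bigr => y _; rewrite !tens_inner mulrC.
Qed.

Lemma ampliation_boundr H K K' (A : K -> K') (M : R) (p : seq (H * K)) :
  0 <= M -> linear A -> (forall x, hn (A x) <= M * hn x) ->
  hn (\sum_(x <- p) x.1 ⊠ A x.2 : H ⊗ K') <= M * hn (\sum_(x <- p) x.1 ⊠ x.2 : H ⊗ K).
Proof.
move=> M0 lA hM; rewrite -[X in _ <= _ * X]hn_sum_flip.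
have := hn_sum_flip [seq (x.1, A x.2) | x <- p]; rewrite !big_map/= => <-.
have := ampliation_bound [seq (x.2, x.1) | x <- p] M0 lA hM.
by rewrite !big_map.
Qed.

Lemma tensor_op_boundedE H K H' K' (A : H -> H') (B : K -> K') (M : R) :
  0 <= M -> linear A -> linear B ->
  (forall p : seq (H * K), hn (\sum_(x <- p) A x.1 ⊠ B x.2 : H' ⊗ K') <=
     M * hn (\sum_(x <- p) x.1 ⊠ x.2 : H ⊗ K)) ->
  [/\ bounded_op (tensor_op A B : H ⊗ K -> H' ⊗ K'),
      forall u v, tensor_op A B (u ⊠ v) = A u ⊠ B v &
      forall x : H ⊗ K, hn (tensor_op A B x : H' ⊗ K') <= M * hn x].
Proof.
move=> M0 lA lB hM.
have [|p|bT hT nT] := @bounded_extension R (H * K)%type (H ⊗ K) (H' ⊗ K') setT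
  (fun p => p.1 ⊠ p.2) (fun p => A p.1 ⊠ B p.2) M M0.
- exact: tens_total.
- have := hM [seq (x.1 *: (sval x.2).1, (sval x.2).2) | x <- p].
  rewrite !big_map/=.
  under eq_bigr do rewrite (opZ lA) tensZl.
  by under [X in _ <= _ * hn X]eq_bigr do rewrite tensZl.
- by split => // u v; exact: (hT (u, v)).
Qed.

Lemma tensor_op_idr H H' K (A : H -> H') : bounded_op A ->
  bounded_op (tensor_op A id : H ⊗ K -> H' ⊗ K) /\
  forall u v, (tensor_op A id : H ⊗ K -> H' ⊗ K) (u ⊠ v) = A u ⊠ v.
Proof.
move=> /bounded_opP[lA [M M0 hM]].
have lid : linear (@id K) by [].
have [p|bT hT _] := @tensor_op_boundedE H K H' K A id M M0 lA lid => //.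
exact: ampliation_bound.
Qed.

Lemma tensor_op_idl H K K' (A : K -> K') : bounded_op A ->
  bounded_op (tensor_op id A : H ⊗ K -> H ⊗ K') /\
  forall u v, (tensor_op id A : H ⊗ K -> H ⊗ K') (u ⊠ v) = u ⊠ A v.
Proof.
move=> /bounded_opP[lA [M M0 hM]].
have lid : linear (@id H) by [].
have [p|bT hT _] := @tensor_op_boundedE H K H K' id A M M0 lid lA => //.
exact: ampliation_boundr.
Qed.

Lemma contractive_ampliation H H' K (A : H -> H') :
  contractive A -> contractive (tensor_op A id : H ⊗ K -> H' ⊗ K).
Proof.
move=> [bA cA]; have /bounded_opP[lA _] := bA.
have lid : linear (@id K) by [].
have [p|bT hT nT] := @tensor_op_boundedE H K H' K A id 1 ler01 lA lid.
  by apply: ampliation_bound => // x; rewrite mul1r.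
by split => // x; rewrite -[leRHS]mul1r.
Qed.

Lemma contractive_ampliationr H K K' (A : K -> K') :
  contractive A -> contractive (tensor_op id A : H ⊗ K -> H ⊗ K').
Proof.
move=> [bA cA]; have /bounded_opP[lA _] := bA.
have lid : linear (@id H) by [].
have [p|bT hT nT] := @tensor_op_boundedE H K H K' id A 1 ler01 lid lA.
  by apply: ampliation_boundr => // x; rewrite mul1r.
by split => // x; rewrite -[leRHS]mul1r.
Qed.

Lemma isometric_ampliationr H K K' (A : K -> K') :
  isometric A -> isometric (tensor_op id A : H ⊗ K -> H ⊗ K').
Proof.
move=> [bA iA].
have [||iT _] := @isometric_extension R (H * K)%type (H ⊗ K) (H ⊗ K') setT
  (fun p => p.1 ⊠ p.2) (fun p => p.1 ⊠ A p.2).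
- exact: tens_total.
- by move=> [u v] [u' v'] _ _ /=; rewrite !tens_inner iA.
- exact: iT.
Qed.

End TensorOp.

(** * Bochner measurability *)

Section Simple.
Variable R : realType.

(** [simple_on] for arbitrary codomains: auxiliary functions with boolean or real values
obey the same closure properties. *)
Definition finitely_valued (T : Type) (D : set R) (g : R -> T) : Prop :=
  finite_set (g @` D) /\ forall c : T, measurable (D `&` g @^-1` [set c]).

Lemma finitely_valued_preim T (D : set R) (g : R -> T) (B : set T) :
  finitely_valued D g -> measurable (D `&` g @^-1` B).
Proof.
move=> [fg mg].
rewrite (_ : _ `&` _ = \bigcup_(c in g @` D `&` B) (D `&` g @^-1` [set c])).
  by apply: fin_bigcup_measurable => //; exact: finite_setIl.
apply/seteqP; split => s /=.
  by move=> [Ds Bs]; exists (g s) => //; split => //; exists s.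
by move=> [c [_ Bc]] [Ds ->].
Qed.

Lemma finitely_valued_op T1 T2 T (D : set R) (g1 : R -> T1) (g2 : R -> T2)
    (op : T1 -> T2 -> T) :
  finitely_valued D g1 -> finitely_valued D g2 ->
  finitely_valued D (fun s => op (g1 s) (g2 s)).
Proof.
move=> h1 h2; split.
  have [[f1 _] [f2 _]] := (h1, h2).
  apply: sub_finite_set (finite_image2 op f1 f2).
  by move=> _ [s Ds <-]; exists (g1 s); [exists s|exists (g2 s) => //; exists s].
move=> c; have [f1 m1] := h1.
rewrite (_ : _ `&` _ = \bigcup_(a in g1 @` D)
    ((D `&` g1 @^-1` [set a]) `&` (D `&` g2 @^-1` [set b | op a b = c]))).
  apply: fin_bigcup_measurable => // a _.
  by apply: measurableI => //; exact: finitely_valued_preim.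
apply/seteqP; split => s /=.
  by move=> [Ds e]; exists (g1 s) => //; exists s.
by move=> [a _] [[Ds ->] [_ e]].
Qed.

Lemma finitely_valued_measurable d (T : measurableType d) (D : set R) (g : R -> T) :
  finitely_valued D g -> measurable_fun D g.
Proof. by move=> h _ B _; exact: finitely_valued_preim. Qed.

Lemma finitely_valued_sub T (D E : set R) (g : R -> T) :
  measurable E -> E `<=` D -> finitely_valued D g -> finitely_valued E g.
Proof.
move=> mE ED [fg mg]; split.
  by apply: sub_finite_set fg; exact: image_subset.
move=> c; rewrite (_ : _ `&` _ = E `&` (D `&` g @^-1` [set c])).
  exact: measurableI.
by apply/seteqP; split => s /= [Es]; [split => //; split => //; exact: ED|case].
Qed.

Lemma finitely_valued_mem (D A : set R) :
  measurable D -> measurable A -> finitely_valued D (fun s => s \in A).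
Proof.
move=> mD mA; split.
  by apply: sub_finite_set (finite_set2 true false) => b _ /=; case: b; [left|right].
case.
  rewrite (_ : _ `&` _ = D `&` A); first exact: measurableI.
  by apply/seteqP; split => s /= [Ds h]; split => //; [exact: set_mem|exact: mem_set].
rewrite (_ : _ `&` _ = D `\` A); first exact: measurableD.
by apply/seteqP; split => s /= [Ds h]; split => //; [move/negbT: h; rewrite notin_setE|exact: memNset].
Qed.

End Simple.

Section StronglyMeasurable.
Variable R : realType.
Local Notation C := R[i].
Implicit Types k : hilbertType R.

Lemma strongly_measurable_op k1 k2 k (D : set R) (f1 : R -> k1) (f2 : R -> k2)
    (op : k1 -> k2 -> k) :
  (forall (u : nat -> k1) (v : nat -> k2) a b, u @ \oo --> a -> v @ \oo --> b ->
     (fun n => op (u n) (v n)) @ \oo --> op a b) ->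
  strongly_measurable D f1 -> strongly_measurable D f2 ->
  strongly_measurable D (fun s => op (f1 s) (f2 s)).
Proof.
move=> cop [g1 [s1 l1]] [g2 [s2 l2]].
exists (fun n s => op (g1 n s) (g2 n s)); split.
  by move=> n; exact: (finitely_valued_op op (s1 n) (s2 n)).
by move=> s Ds; apply: cop; [exact: l1|exact: l2].
Qed.

Lemma strongly_measurable_simple k (D : set R) (g : R -> k) :
  finitely_valued D g -> strongly_measurable D g.
Proof. by move=> h; exists (fun _ => g); split => // s _; exact: cvg_cst. Qed.

Lemma strongly_measurable_sub k (D E : set R) (g : R -> k) :
  measurable E -> E `<=` D -> strongly_measurable D g -> strongly_measurable E g.
Proof.
move=> mE ED [h [sh lh]]; exists h; split.
  by move=> n; apply: finitely_valued_sub (sh n).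
by move=> s Es; apply: lh; exact: ED.
Qed.

Lemma strongly_measurable_eq k (D : set R) (g h : R -> k) :
  (forall s, D s -> g s = h s) -> strongly_measurable D g -> strongly_measurable D h.
Proof.
by move=> gh [u [su lu]]; exists u; split => // s Ds; rewrite -gh//; exact: lu.
Qed.

Lemma finitely_valued_glue (T : Type) (D E : set R) (g h : R -> T) :
  measurable D -> measurable E -> finitely_valued D g -> finitely_valued E h ->
  finitely_valued (D `|` E) (fun s => if s \in D then g s else h s).
Proof.
move=> mD mE sg sh; split.
  have [[f1 _] [f2 _]] := (sg, sh).
  have f12 : finite_set (g @` D `|` h @` E) by rewrite finite_setU.
  apply: sub_finite_set f12 => _ [s DEs <-] /=.
  case: ifPn => [|/negP sD]; first by rewrite in_setE; left; exists s.
  by right; exists s => //; case: DEs => // Ds; case: sD; rewrite in_setE.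
move=> c; rewrite (_ : _ `&` _ =
    (D `&` g @^-1` [set c]) `|` ((E `&` h @^-1` [set c]) `\` D)).
  apply: measurableU; first by case: sg.
  by apply: measurableD => //; case: sh.
apply/seteqP; split => s /=.
  move=> [DEs]; case: ifPn => [|/negP sD]; first by rewrite in_setE; left.
  have nD : ~ D s by move=> Ds; apply: sD; rewrite in_setE.
  by move=> hs; right; split => //; split => //; case: DEs.
move=> [[Ds gs]|[[Es hs] nD]].
  by split; [left|rewrite mem_set].
by split; [right|rewrite memNset].
Qed.

Lemma strongly_measurable_glue k (D E : set R) (g h : R -> k) :
  measurable D -> measurable E -> strongly_measurable D g -> strongly_measurable E h ->
  strongly_measurable (D `|` E) (fun s => if s \in D then g s else h s).
Proof.
move=> mD mE [u [su lu]] [v [sv lv]].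
exists (fun n s => if s \in D then u n s else v n s); split.
  by move=> n; exact: (finitely_valued_glue mD mE (su n) (sv n)).
move=> s DEs; case: ifPn => [|/negP sD]; first by rewrite in_setE; exact: lu.
by apply: lv; case: DEs => // Ds; case: sD; rewrite in_setE.
Qed.

Lemma cvg_inner k (u v : nat -> k) (a b : k) :
  u @ \oo --> a -> v @ \oo --> b -> forall e : R, 0 < e ->
  exists N, forall n, (N <= n)%N -> hn (inner (u n) (v n) - inner a b) < e.
Proof.
move=> /cvg_hnP ua /cvg_hnP vb e e0.
have a0 : 0 < hn a + 1 by rewrite ltr_wpDl ?hn_ge0.
have b0 : 0 < hn b + 1 by rewrite ltr_wpDl ?hn_ge0.
have [|N1 h1] := ua (e / 2 / (hn b + 1)); first by rewrite !divr_gt0.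
have [|N2 h2] := vb (Num.min 1 (e / 2 / (hn a + 1))).
  by rewrite lt_min ltr01 !divr_gt0.
exists (maxn N1 N2) => n; rewrite geq_max => /andP[n1 n2].
have := h1 n n1; have := h2 n n2; rewrite lt_min => /andP[].
rewrite !ltr_pdivlMr// => v1 va ub.
apply: le_lt_trans (hn_inner_diff _ _ _ _) _.
have vn : hn (v n) <= hn b + 1.
  by have := hn_dist (v n) b 0; rewrite !subr0; lra.
have p1 := hn_ge0 (u n - a); have p2 := hn_ge0 (v n - b); have p3 := hn_ge0 a.
by nra.
Qed.

Lemma cvg_Re_inner k (u v : nat -> k) (a b : k) :
  u @ \oo --> a -> v @ \oo --> b ->
  (fun n => complex.Re (inner (u n) (v n))) @ \oo --> complex.Re (inner a b).
Proof.
move=> ua vb; apply/cvgrPdist_lt => e e0.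
have [N hN] := cvg_inner ua vb e0; exists N => // n Nn.
by rewrite -ReB (le_lt_trans (Re_le_hn _))// hnB; exact: hN.
Qed.

Lemma cvg_Im_inner k (u v : nat -> k) (a b : k) :
  u @ \oo --> a -> v @ \oo --> b ->
  (fun n => complex.Im (inner (u n) (v n))) @ \oo --> complex.Im (inner a b).
Proof.
move=> ua vb; apply/cvgrPdist_lt => e e0.
have [N hN] := cvg_inner ua vb e0; exists N => // n Nn.
rewrite (_ : _ - _ = complex.Im (inner a b - inner (u n) (v n))).
  by rewrite (le_lt_trans (Im_le_hn _))// hnB; exact: hN.
by case: (inner a b) (inner (u n) (v n)) => ? ? [].
Qed.

Lemma measurable_Re_inner k (D : set R) (f g : R -> k) :
  strongly_measurable D f -> strongly_measurable D g ->
  measurable_fun D (fun s => complex.Re (inner (f s) (g s))).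
Proof.
move=> [u [su lu]] [v [sv lv]].
apply: (measurable_fun_cvg (h := fun n s => complex.Re (inner (u n s) (v n s)))).
  move=> n; apply: finitely_valued_measurable.
  exact: (finitely_valued_op (fun a b => complex.Re (inner a b)) (su n) (sv n)).
by move=> s Ds; apply: cvg_Re_inner; [exact: lu|exact: lv].
Qed.

Lemma measurable_Im_inner k (D : set R) (f g : R -> k) :
  strongly_measurable D f -> strongly_measurable D g ->
  measurable_fun D (fun s => complex.Im (inner (f s) (g s))).
Proof.
move=> [u [su lu]] [v [sv lv]].
apply: (measurable_fun_cvg (h := fun n s => complex.Im (inner (u n s) (v n s)))).
  move=> n; apply: finitely_valued_measurable.
  exact: (finitely_valued_op (fun a b => complex.Im (inner a b)) (su n) (sv n)).
by move=> s Ds; apply: cvg_Im_inner; [exact: lu|exact: lv].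
Qed.

Lemma cvg_hsum k1 k2 (u : nat -> k1) (v : nat -> k2) a b :
  u @ \oo --> a -> v @ \oo --> b ->
  (fun n => (u n, v n) : hsum k1 k2) @ \oo --> ((a, b) : hsum k1 k2).
Proof.
move=> /cvg_hnP ua /cvg_hnP vb; apply/cvg_hnP => e e0.
have e2 : 0 < e / 2 by rewrite divr_gt0.
have [N1 h1] := ua _ e2; have [N2 h2] := vb _ e2.
exists (maxn N1 N2) => n; rewrite geq_max => /andP[n1 n2].
rewrite [ltRHS]splitr (le_lt_trans _ (ltrD (h1 n n1) (h2 n n2)))//.
have := hsum_norm_le ((u n, v n) - (a, b) : hsum k1 k2).
by rewrite !hnE -rmorphD/= lecR.
Qed.

End StronglyMeasurable.

(** * Square-integrable functions *)

Section L2facts.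
Variable R : realType.
Local Notation C := R[i].
Local Notation mu := (@lebesgue_measure R).
Implicit Types k : hilbertType R.

Lemma sqnormE k (f : R -> k) s : sqnorm f s = hn (f s) ^+ 2.
Proof. by rewrite hn_sq. Qed.

Lemma sqnorm_ge0 k (f : R -> k) s : 0 <= sqnorm f s.
Proof. by rewrite sqnormE sqr_ge0. Qed.

Lemma measurable_sqnorm k (D : set R) (f : R -> k) :
  strongly_measurable D f -> measurable_fun D (sqnorm f).
Proof. by move=> mf; exact: measurable_Re_inner. Qed.

Lemma emeasurable_sqnorm k (D : set R) (f : R -> k) :
  strongly_measurable D f -> measurable_fun D (EFin \o sqnorm f).
Proof. by move=> mf; apply/measurable_EFinP; exact: measurable_sqnorm. Qed.

Lemma integrable_realZ (I : interval R) (c : R) (phi : R -> R) :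
  mu.-integrable [set` I] (EFin \o phi) ->
  mu.-integrable [set` I] (EFin \o (fun s => c * phi s)).
Proof.
move=> jphi; have j : mu.-integrable [set` I] (fun s => c%:E * (EFin \o phi) s)%E.
  exact: integrableZl.
by apply: eq_integrable j => // s _ /=; rewrite EFinM.
Qed.

Lemma integrable_realD (I : interval R) (phi psi : R -> R) :
  mu.-integrable [set` I] (EFin \o phi) -> mu.-integrable [set` I] (EFin \o psi) ->
  mu.-integrable [set` I] (EFin \o (fun s => phi s + psi s)).
Proof.
move=> j1 j2; have j : mu.-integrable [set` I] ((EFin \o phi) \+ (EFin \o psi))%E.
  exact: integrableD.
by apply: eq_integrable j => // s _ /=; rewrite EFinD.
Qed.

Lemma L2P k (I : interval R) (f : R -> k) :
  L2 I f <-> strongly_measurable [set` I] f /\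
             mu.-integrable [set` I] (EFin \o sqnorm f).
Proof.
have absE : (\int[mu]_(s in [set` I]) `|(EFin \o sqnorm f) s| =
    \int[mu]_(s in [set` I]) (sqnorm f s)%:E)%E.
  by apply: eq_integral => s _ /=; rewrite ger0_norm//; exact: (sqnorm_ge0 f s).
split=> -[mf h]; split => //.
  apply/integrableP; split; first exact: emeasurable_sqnorm.
  by rewrite absE.
by have /integrableP[_] := h; rewrite absE.
Qed.

Lemma L2_le k (I : interval R) (f : R -> k) (phi : R -> R) :
  strongly_measurable [set` I] f -> mu.-integrable [set` I] (EFin \o phi) ->
  (forall s, s \in I -> hn (f s) ^+ 2 <= phi s) -> L2 I f.
Proof.
move=> mf iphi le; apply/L2P; split => //.
apply: le_integrable iphi => //; first exact: emeasurable_sqnorm.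
move=> s Is; rewrite /= lee_fin ger0_norm ?sqnorm_ge0// sqnormE.
by rewrite (le_trans (le s Is))// ler_norm.
Qed.

Lemma L2_sub k (I J : interval R) (f : R -> k) :
  [set` J] `<=` [set` I] -> L2 I f -> L2 J f.
Proof.
move=> JI /L2P[mf iphi]; apply/L2P; split.
  exact: strongly_measurable_sub mf.
exact: integrableS iphi.
Qed.

Lemma L2_eq k (I : interval R) (f g : R -> k) :
  (forall s, s \in I -> f s = g s) -> L2 I f -> L2 I g.
Proof.
move=> fg /L2P[mf iphi]; apply: (L2_le _ iphi).
  exact: strongly_measurable_eq mf.
by move=> s Is; rewrite sqnormE fg.
Qed.

Lemma inner_le_sqnorm k (a b : k) : hn (inner a b) <= hn a ^+ 2 + hn b ^+ 2.
Proof.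
rewrite (le_trans (cauchy_schwarz _ _))//.
by have := sqr_ge0 (hn a - hn b); have := sqr_ge0 (hn a); have := sqr_ge0 (hn b); nra.
Qed.

Lemma integrable_sqnormD k (I : interval R) (f g : R -> k) : L2 I f -> L2 I g ->
  mu.-integrable [set` I] (EFin \o (fun s => hn (f s) ^+ 2 + hn (g s) ^+ 2)).
Proof.
move=> /L2P[mf jf] /L2P[mg jg].
apply: eq_integrable (integrable_realD jf jg) => // s _ /=.
by rewrite !sqnormE.
Qed.

Lemma integrable_Re_inner k (I : interval R) (f g : R -> k) : L2 I f -> L2 I g ->
  mu.-integrable [set` I] (EFin \o (fun s => complex.Re (inner (f s) (g s)))).
Proof.
move=> Lf Lg; have [mf _] := Lf; have [mg _] := Lg.
apply: le_integrable (integrable_sqnormD Lf Lg) => //.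
  by apply/measurable_EFinP; exact: measurable_Re_inner.
move=> s _ /=; rewrite lee_fin [leRHS]ger0_norm ?addr_ge0 ?sqr_ge0//.
by rewrite (le_trans (Re_le_hn _))// inner_le_sqnorm.
Qed.

Lemma integrable_Im_inner k (I : interval R) (f g : R -> k) : L2 I f -> L2 I g ->
  mu.-integrable [set` I] (EFin \o (fun s => complex.Im (inner (f s) (g s)))).
Proof.
move=> Lf Lg; have [mf _] := Lf; have [mg _] := Lg.
apply: le_integrable (integrable_sqnormD Lf Lg) => //.
  by apply/measurable_EFinP; exact: measurable_Im_inner.
move=> s _ /=; rewrite lee_fin [leRHS]ger0_norm ?addr_ge0 ?sqr_ge0//.
by rewrite (le_trans (Im_le_hn _))// inner_le_sqnorm.
Qed.

Lemma eq_Cintegral (D : set R) (phi psi : R -> C) :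
  (forall s, D s -> phi s = psi s) -> Cintegral D phi = Cintegral D psi.
Proof.
by move=> h; congr Complex; apply: eq_Rintegral => s /set_mem Ds; rewrite h.
Qed.

Lemma eq_L2inner k (I : interval R) (f g f' g' : R -> k) :
  (forall s, s \in I -> f s = f' s) -> (forall s, s \in I -> g s = g' s) ->
  L2inner I f g = L2inner I f' g'.
Proof. by move=> ff gg; apply: eq_Cintegral => s Is; rewrite ff// gg. Qed.

Lemma L2inner0l k (I : interval R) (g : R -> k) : L2inner I (fun=> 0) g = 0.
Proof.
rewrite /L2inner /Cintegral; under eq_Rintegral do rewrite inner0l.
under [X in Complex _ X]eq_Rintegral do rewrite inner0l.
by rewrite Rintegral_cst// mul0r.
Qed.

Lemma L2inner_Im k (I : interval R) (f : R -> k) :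
  complex.Im (L2inner I f f) = 0 :> R.
Proof.
rewrite /L2inner /=; under eq_Rintegral do rewrite innerxx.
by rewrite Rintegral_cst// mul0r.
Qed.

Lemma half_line_split (t : R) : 0 <= t ->
  [set` `[0, +oo[] = [set` `[0, t[] `|` [set` `[t, +oo[] :> set R.
Proof. by move=> t0; rewrite -itv_bndbnd_setU// bnd_simp. Qed.

Lemma half_line_disjoint (t : R) : [disjoint [set` `[0, t[] & [set` `[t, +oo[]].
Proof.
apply/disj_setPS => s /= []; rewrite !in_itv/= andbT => /andP[_ st].
by rewrite leNgt st.
Qed.

Lemma L2inner_split k (t : R) (f g : R -> k) : 0 <= t ->
  L2 `[0, +oo[ f -> L2 `[0, +oo[ g ->
  L2inner `[0, +oo[ f g = L2inner `[0, t[ f g + L2inner `[t, +oo[ f g.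
Proof.
move=> t0 Lf Lg; rewrite /L2inner /Cintegral.
rewrite (_ : forall a b c d : R, (a +i* b) + (c +i* d) = (a + c) +i* (b + d))%C//.
have jR := integrable_Re_inner Lf Lg; have jI := integrable_Im_inner Lf Lg.
rewrite (half_line_split t0) in jR jI *.
by rewrite !Rintegral_setU//; exact: half_line_disjoint.
Qed.

Definition splice (T : Type) (t : R) (f g : R -> T) : R -> T :=
  fun s => if s < t then f s else g s.

Lemma splice_past T (t : R) (f g : R -> T) s : s \in `[0, t[ -> splice t f g s = f s.
Proof. by rewrite in_itv/= /splice => /andP[_ ->]. Qed.

Lemma splice_future T (t : R) (f g : R -> T) s : s \in `[t, +oo[ -> splice t f g s = g s.
Proof. by rewrite in_itv/= /splice andbT ltNge => ->. Qed.

Lemma past_sub (t : R) : [set` `[0, t[] `<=` ([set` `[0, +oo[] : set R).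
Proof. by move=> s /=; rewrite !in_itv/= => /andP[->]. Qed.

Lemma future_sub (t : R) : 0 <= t -> [set` `[t, +oo[] `<=` ([set` `[0, +oo[] : set R).
Proof. by move=> t0 s /=; rewrite !in_itv/= !andbT; exact: le_trans. Qed.

Lemma L2_splice k (t : R) (f g : R -> k) : 0 <= t ->
  L2 `[0, t[ f -> L2 `[t, +oo[ g -> L2 `[0, +oo[ (splice t f g).
Proof.
move=> t0 Lf Lg.
have /L2P[mf jf] : L2 `[0, t[ (splice t f g) by apply: L2_eq Lf => s /splice_past->.
have /L2P[mg jg] : L2 `[t, +oo[ (splice t f g) by apply: L2_eq Lg => s /splice_future->.
have mc : strongly_measurable [set` `[0, +oo[] (splice t f g).
  rewrite (half_line_split t0).
  apply: strongly_measurable_eq (strongly_measurable_glue _ _ mf mg) => // s _.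
  by case: ifP.
apply/L2P; split => //; apply/integrableP; split.
  exact: emeasurable_sqnorm.
rewrite (half_line_split t0) ge0_integral_setU//; last exact: half_line_disjoint.
  by apply: lte_add_pinfty; [case/integrableP: jf|case/integrableP: jg].
apply: measurableT_comp => //; apply/measurable_EFinP.
by rewrite -(half_line_split t0); exact: measurable_sqnorm.
Qed.

Lemma L2_zero k (I : interval R) : L2 I (fun=> 0 : k).
Proof.
have m0 : strongly_measurable [set` I] (fun=> 0 : k).
  apply: strongly_measurable_simple; split.
    by apply: sub_finite_set (finite_set1 (0 : k)) => _ [s _ <-].
  move=> c; have [->|c0] := eqVneq c 0.
    rewrite (_ : _ `&` _ = [set` I])//.
    by apply/seteqP; split => s //= [].
  rewrite (_ : _ `&` _ = set0)//.
  apply/seteqP; split => s //= [_ e].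
  by move: c0; rewrite -e eqxx.
split => //; rewrite (eq_integral (fun=> 0)%E) ?integral0 ?ltry// => s _.
by rewrite sqnormE hn0 expr0n.
Qed.

Section Past.
Variables (k : hilbertType R) (t : R).
Hypothesis t0 : 0 <= t.

Lemma L2_past (f : R -> k) : L2 `[0, +oo[ f -> L2 `[0, t[ f.
Proof. by apply: L2_sub; exact: past_sub. Qed.

Lemma L2_future (f : R -> k) : L2 `[0, +oo[ f -> L2 `[t, +oo[ f.
Proof. by apply: L2_sub; exact: future_sub. Qed.

Lemma L2_spliceT (f g : R -> k) : L2 `[0, +oo[ f -> L2 `[0, +oo[ g ->
  L2 `[0, +oo[ (splice t f g).
Proof. by move=> Lf Lg; apply: L2_splice => //; [exact: L2_past|exact: L2_future]. Qed.

Lemma L2inner_splice (f g f' g' : R -> k) :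
  L2 `[0, +oo[ f -> L2 `[0, +oo[ f' -> L2 `[0, +oo[ g -> L2 `[0, +oo[ g' ->
  L2inner `[0, +oo[ (splice t f f') (splice t g g') =
  L2inner `[0, t[ f g + L2inner `[t, +oo[ f' g'.
Proof.
move=> Lf Lf' Lg Lg'; rewrite (L2inner_split t0 (L2_spliceT Lf Lf') (L2_spliceT Lg Lg')).
congr (_ + _).
  by apply: eq_L2inner => s si; rewrite splice_past.
by apply: eq_L2inner => s si; rewrite splice_future.
Qed.

End Past.

(** * Translation invariance *)

Section Shift.
Variable t : R.

Let sh : measurableTypeR R -> measurableTypeR R := fun s => s - t.

Let measurable_sh : measurable_fun setT sh.
Proof. by apply: measurable_funD => //; exact: measurable_cst. Qed.

Lemma shift_itv_preim :
  (fun s => s - t) @^-1` [set` `[0, +oo[] = [set` `[t, +oo[].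
Proof. by apply/seteqP; split => s /=; rewrite !in_itv/= !andbT subr_ge0. Qed.

Lemma lebesgue_measure_shift (A : set R) : measurable A ->
  mu A = mu ((fun s => s - t) @^-1` A).
Proof.
move=> mA.
apply: (@lebesgue_measure_unique R (pushforward mu sh)) => // X.
move=> /ocitvP[->|[[a b] /= ab ->]]; first by rewrite measure0.
rewrite /pushforward.
have -> : sh @^-1` `]a, b]%classic = `]a + t, b + t]%classic.
  by apply/seteqP; split => s /=; rewrite !in_itv/= /sh ltrBrDr lerBlDr.
by rewrite !lebesgue_measure_itv/= !lte_fin ltrD2r -!EFinB opprD addrACA subrr addr0.
Qed.

Lemma ge0_integral_shift (f : R -> \bar R) :
  measurable_fun ([set` `[0%R, +oo[] : set R) f -> (forall s, 0 <= f s)%E ->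
  (\int[mu]_(s in [set` `[t, +oo[]) f (s - t)%R = \int[mu]_(s in [set` `[0%R, +oo[]) f s)%E.
Proof.
move=> mf f0.
transitivity (\int[pushforward mu sh]_(s in [set` `[0%R, +oo[]) f s)%E.
  have mD : measurable ([set` `[0%R, +oo[] : set (measurableTypeR R)) by exact: measurable_itv.
  have := ge0_integral_pushforward measurable_sh mu mD mf (fun s _ => f0 s).
  by rewrite shift_itv_preim => <-.
apply: eq_measure_integral => A mA _; exact: (esym (lebesgue_measure_shift mA)).
Qed.

Lemma Rintegral_shift (f : R -> R) : measurable_fun ([set` `[0%R, +oo[] : set R) f ->
  \int[mu]_(s in [set` `[t, +oo[]) f (s - t) = \int[mu]_(s in [set` `[0%R, +oo[]) f s.
Proof.
move=> /measurable_EFinP mf; rewrite /Rintegral; congr fine.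
have hp := ge0_integral_shift (measurable_funepos mf) (@funepos_ge0 _ _ (EFin \o f)).
have hn := ge0_integral_shift (measurable_funeneg mf) (@funeneg_ge0 _ _ (EFin \o f)).
rewrite integralE [RHS]integralE; congr (_ - _)%E.
  by rewrite -[RHS]hp; apply: eq_integral => s _; rewrite !funeposE.
by rewrite -[RHS]hn; apply: eq_integral => s _; rewrite !funenegE.
Qed.

Lemma strongly_measurable_shift k (D : set R) (f : R -> k) :
  strongly_measurable D f ->
  strongly_measurable ((fun s => s - t) @^-1` D) (fun s => f (s - t)).
Proof.
move=> [u [su lu]]; exists (fun n s => u n (s - t)); split; last by move=> s; exact: lu.
move=> n; have [fu mu_] := su n; split.
  by apply: sub_finite_set fu => _ [s Ds <-]; exists (s - t).
move=> c; rewrite (_ : _ `&` _ = setT `&` sh @^-1` (D `&` u n @^-1` [set c])).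
  by apply: measurable_sh => //; exact: mu_.
by rewrite setTI.
Qed.

Lemma L2_shift k (f : R -> k) :
  L2 `[0, +oo[ f -> L2 `[t, +oo[ (fun s => f (s - t)).
Proof.
move=> [mf ff]; split.
  by rewrite -shift_itv_preim; exact: strongly_measurable_shift.
rewrite (@ge0_integral_shift (fun s => (sqnorm f s)%:E))//.
  exact: emeasurable_sqnorm.
by move=> s; rewrite lee_fin sqnormE sqr_ge0.
Qed.

Lemma L2inner_shift k (f g : R -> k) : L2 `[0, +oo[ f -> L2 `[0, +oo[ g ->
  L2inner `[t, +oo[ (fun s => f (s - t)) (fun s => g (s - t)) = L2inner `[0, +oo[ f g.
Proof.
move=> [mf _] [mg _]; rewrite /L2inner /Cintegral; congr Complex.
  apply: (@Rintegral_shift (fun s => complex.Re (inner (f s) (g s)))).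
  exact: measurable_Re_inner.
apply: (@Rintegral_shift (fun s => complex.Im (inner (f s) (g s)))).
exact: measurable_Im_inner.
Qed.

End Shift.

Lemma L2_unshift k s (f : R -> k) : 0 <= s ->
  L2 `[0, +oo[ f -> L2 `[0, +oo[ (fun r => f (r + s)).
Proof.
move=> s0 /(L2_shift (- s)) L; apply: L2_sub (L2_eq _ L).
  by move=> r /=; rewrite !in_itv/= !andbT; apply: le_trans; rewrite oppr_le0.
by move=> r _; rewrite opprK.
Qed.

Lemma L2inner_unshift k s t (f g : R -> k) : 0 <= s -> 0 <= t ->
  L2 `[0, +oo[ f -> L2 `[0, +oo[ g ->
  L2inner `[t, +oo[ (fun r => f (r + s)) (fun r => g (r + s)) =
  L2inner `[s + t, +oo[ f g.
Proof.
move=> s0 t0 Lf Lg; have L0 := L2_zero k `[0, +oo[.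
have st0 : 0 <= s + t by rewrite addr_ge0.
pose z : R -> k := fun=> 0.
have Lf' := L2_unshift s0 Lf; have Lg' := L2_unshift s0 Lg.
transitivity (L2inner `[0, +oo[ (splice t z (fun r => f (r + s))) (splice t z (fun r => g (r + s)))).
  by rewrite L2inner_splice// L2inner0l add0r.
rewrite -(L2inner_shift s); [|exact: L2_spliceT|exact: L2_spliceT].
transitivity (L2inner `[0, +oo[ (splice (s + t) z f) (splice (s + t) z g)); last first.
  by rewrite L2inner_splice// L2inner0l add0r.
have spliceE (u : R -> k) r : splice t z (fun r => u (r + s)) (r - s) = splice (s + t) z u r.
  by rewrite /splice subrK ltrBlDr (addrC t).
rewrite [RHS](L2inner_split s0); [|exact: L2_spliceT|exact: L2_spliceT].
rewrite [X in _ = X + _](_ : _ = 0) ?add0r.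
  by apply: eq_L2inner => r _; exact: spliceE.
rewrite -(L2inner0l `[0, s[ z); apply: eq_L2inner => r; rewrite in_itv/= => /andP[_ rs];
  by rewrite /splice (lt_le_trans rs)// lerDl.
Qed.

End L2facts.

(** * Exponential vectors *)

Section Cexp.
Variable R : realType.
Local Notation C := R[i].

Lemma cexp0 : cexp (0 : C) = 1.
Proof. by rewrite /cexp /= expR0 cos0 sin0 mul1r. Qed.

Lemma cexpD (z w : C) : cexp (z + w) = cexp z * cexp w.
Proof.
rewrite /cexp ReD ImD expRD cosD sinD rmorphM/= mulrACA; congr (_ * _).
apply/eqP; rewrite eq_complex/= eqxx/=; apply/eqP.
by rewrite addrC [X in _ + X]mulrC [X in X + _]mulrC [X in X + _]mulrC.
Qed.

Lemma hn_cexp (z : C) : hn (cexp z) = expR (complex.Re z).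
Proof.
rewrite /cexp hnM hn_real ?expR_ge0// /hn normc_def/= cos2Dsin2 sqrtr1.
by rewrite mulr1.
Qed.

End Cexp.

Section Exponential.
Variables (R : realType) (k : hilbertType R) (I : interval R) (F : fock_space k I).
Local Notation C := R[i].

Definition expv_scale (f : R -> k) : C :=
  (expR (- (complex.Re (L2inner I f f) / 2)))%:C%C.

Lemma expv_scale_neq0 f : expv_scale f != 0.
Proof. by rewrite /expv_scale eq_complex/= gt_eqF ?expR_gt0. Qed.

Lemma nexpvE f : nexpv F f = expv_scale f *: expv F f.
Proof. by []. Qed.

Lemma expvE f : expv F f = (expv_scale f)^-1 *: nexpv F f.
Proof. by rewrite nexpvE scalerA mulVf ?scale1r ?expv_scale_neq0. Qed.

Lemma nexpv_inner f g : L2 I f -> L2 I g ->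
  inner (nexpv F f) (nexpv F g) = expv_scale f * expv_scale g * cexp (L2inner I f g).
Proof.
by move=> Lf Lg; rewrite !nexpvE innerZl innerZr expv_inner// conj_realC mulrA.
Qed.

Lemma hn_sq_expvB f g : L2 I f -> L2 I g ->
  hn (expv F f - expv F g) ^+ 2 = complex.Re (cexp (L2inner I f f))
    - 2 * complex.Re (cexp (L2inner I f g)) + complex.Re (cexp (L2inner I g g)).
Proof. by move=> Lf Lg; rewrite hn_sqB !hn_sq !expv_inner. Qed.

Lemma expv_eq f g : L2 I f -> (forall s, s \in I -> f s = g s) ->
  expv F f = expv F g.
Proof.
move=> Lf fg; have Lg := L2_eq fg Lf.
apply/eqP; rewrite -subr_eq0; apply/eqP/hn0_eq0/eqP; rewrite -sqrf_eq0.
have gf s : s \in I -> g s = f s by move=> /fg.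
rewrite hn_sq_expvB// (eq_L2inner (I := I) gf gf).
rewrite (eq_L2inner (I := I) (f' := f) (g' := f) _ gf)//.
by apply/eqP; ring.
Qed.

Lemma hn_expv f : L2 I f -> hn (expv F f) ^+ 2 = expR (complex.Re (L2inner I f f)).
Proof.
by move=> Lf; rewrite hn_sq expv_inner// /cexp L2inner_Im cos0 sin0 ReZ mulr1.
Qed.

Lemma expv_clspan x : clspan (expv F @` [set f | L2 I f]) x.
Proof. exact: (total_clspan x (@expv_total _ _ _ F)). Qed.

End Exponential.

Lemma expv_scale_split (R : realType) (k : hilbertType R) (t : R) (f : R -> k) :
  0 <= t -> L2 `[0, +oo[ f ->
  expv_scale `[0, +oo[ f = expv_scale `[0, t[ f * expv_scale `[t, +oo[ f.
Proof.
move=> t0 Lf; rewrite /expv_scale (L2inner_split t0 Lf Lf) ReD.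
by rewrite mulrDl opprD expRD rmorphM.
Qed.

(** Scalar bookkeeping shared by the factorisations of exponential vectors. *)
Section Rearrange.
Variables (A : comPzRingType) (x a b c d e f : A).

Let split_pastE : x * (a * b * e) * (c * d * f) = x * ((a * c) * (b * d) * (e * f)).
Proof. by ring. Qed.

Let split_futureE : a * b * e * (x * (c * d * f)) = x * ((a * c) * (b * d) * (e * f)).
Proof. by ring. Qed.

Definition scale_rearrange := (split_pastE, split_futureE).

End Rearrange.

Lemma scale_cancel (A : fieldType) (a b : A) : a != 0 -> b != 0 ->
  ((a * b)^-1 * (b * a) = 1) * ((a * b)^-1 * (a * b) = 1).
Proof. by move=> a0 b0; rewrite (mulrC b) mulVf// mulf_neq0. Qed.

Section Structure.
Variables (R : realType) (S : realization R).
Local Notation C := R[i].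
Local Notation "H ⊗ K" := (tensor_space (tensor S H K))
  (at level 40, left associativity).
Local Notation "u ⊠ v" := (tens (tensor S _ _) u v)
  (at level 40, left associativity).
Local Notation "'ε' f" := (expv (fock S _ _) f) (at level 10, f at level 9).
Local Notation "'ϖ' f" := (nexpv (fock S _ _) f) (at level 10, f at level 9).
Local Notation L2p := (L2 `[0%R, +oo[).

Lemma tens_expv_clspan (h k : hilbertType R) (I : interval R) (z : h ⊗ fock S k I) :
  clspan [set x | exists w f, L2 I f /\ x = w ⊠ ε f] z.
Proof.
apply: clspan_tens_total => u v.
apply: (clspan_tensr _ (expv_clspan v)) => _ [f Lf <-].
by apply: sub_clspan; exists u, f.
Qed.

Lemma total_tens_nexpv (h k : hilbertType R) (I : interval R) :
  Defs.total ((fun p : h * (R -> k) => p.1 ⊠ ϖ p.2 : h ⊗ fock S k I)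
     @` [set p : h * (R -> k) | L2 I p.2]).
Proof.
apply: clspan_total => z; move: (tens_expv_clspan z); apply.
  exact: clspan_subspace.
move=> _ [w [f [Lf ->]]]; rewrite expvE tensZr.
apply: (closed_subspaceZ _ (clspan_subspace _)).
by apply: sub_clspan; exists (w, f).
Qed.

Section OneNoise.
Variables h k : hilbertType R.
Local Notation HF := (h ⊗ Fock S k).

(** The normalising factors multiply over adjacent intervals, so unnormalised exponential
vectors factorise like the normalised ones. *)
Lemma split_past_spec (t : R) : 0 <= t ->
  isometric (@split_past R S h k t) /\
  forall u f, L2p f -> @split_past R S h k t (u ⊠ ε f) = u ⊠ ε f ⊠ ε f.
Proof.
move=> t0.
have [|[u f] [v g] Lf Lg|iS hS] := @isometric_extension R (h * (R -> k))%type
   HF ((h ⊗ Fock_past S k t) ⊗ Fock_future S k t)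
   [set p : h * (R -> k) | L2p p.2]
   (fun p => p.1 ⊠ ϖ p.2) (fun p => p.1 ⊠ ϖ p.2 ⊠ ϖ p.2).
- exact: total_tens_nexpv.
- rewrite /= !tens_inner (nexpv_inner _ Lf Lg).
  rewrite (nexpv_inner _ (L2_past t Lf) (L2_past t Lg)).
  rewrite (nexpv_inner _ (L2_future t0 Lf) (L2_future t0 Lg)).
  rewrite (expv_scale_split t0 Lf) (expv_scale_split t0 Lg).
  by rewrite (L2inner_split t0 Lf Lg) cexpD scale_rearrange.
- split=> // u f Lf; have lS : linear (@split_past R S h k t).
    by have [/bounded_opP[]] := iS.
  rewrite expvE tensZr (opZ lS).
  rewrite [X in _ *: X](hS (u, f) Lf) /= !nexpvE !tensZr !tensZl !scalerA.
  by rewrite (expv_scale_split t0 Lf) !scale_cancel ?scale1r ?expv_scale_neq0.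
Qed.

Lemma split_future_spec (t : R) : 0 <= t ->
  isometric (@split_future R S h k t) /\
  forall u f, L2p f -> @split_future R S h k t (u ⊠ ε f) = ε f ⊠ (u ⊠ ε f).
Proof.
move=> t0.
have [|[u f] [v g] Lf Lg|iS hS] := @isometric_extension R (h * (R -> k))%type
   HF (Fock_past S k t ⊗ (h ⊗ Fock_future S k t))
   [set p : h * (R -> k) | L2p p.2]
   (fun p => p.1 ⊠ ϖ p.2) (fun p => ϖ p.2 ⊠ (p.1 ⊠ ϖ p.2)).
- exact: total_tens_nexpv.
- rewrite /= !tens_inner (nexpv_inner _ Lf Lg).
  rewrite (nexpv_inner _ (L2_past t Lf) (L2_past t Lg)).
  rewrite (nexpv_inner _ (L2_future t0 Lf) (L2_future t0 Lg)).
  rewrite (expv_scale_split t0 Lf) (expv_scale_split t0 Lg).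
  by rewrite (L2inner_split t0 Lf Lg) cexpD scale_rearrange.
- split=> // u f Lf; have lS : linear (@split_future R S h k t).
    by have [/bounded_opP[]] := iS.
  rewrite expvE tensZr (opZ lS).
  rewrite [X in _ *: X](hS (u, f) Lf) /= !nexpvE !tensZr !tensZl !scalerA.
  by rewrite (expv_scale_split t0 Lf) !scale_cancel ?scale1r ?expv_scale_neq0.
Qed.

Lemma shift_op_spec (t : R) :
  isometric (@shift_op R S k t) /\
  forall f, L2p f -> @shift_op R S k t (ε f) = ε (fun s => f (s - t)).
Proof.
have [|f g Lf Lg|iS hS] := @isometric_extension R (R -> k)
   (Fock S k) (Fock_future S k t) L2p (fun f => ϖ f) (fun f => ϖ (fun s => f (s - t))).
- apply: clspan_total => z; move: (expv_clspan z); apply.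
    exact: clspan_subspace.
  move=> _ [f Lf <-]; rewrite expvE.
  apply: (closed_subspaceZ _ (clspan_subspace _)).
  by apply: sub_clspan; exists f.
- rewrite /= !nexpv_inner//=; try exact: L2_shift.
  by rewrite /expv_scale !L2inner_shift.
- split=> // f Lf; have lS : linear (@shift_op R S k t).
    by have [/bounded_opP[]] := iS.
  rewrite expvE (opZ lS) [X in _ *: X](hS f Lf) nexpvE.
  rewrite /expv_scale L2inner_shift//.
  by rewrite scalerA mulVf ?scale1r//; exact: (expv_scale_neq0 `[0, +oo[ f).
Qed.

(** The operator [E_f^* X E_g] on the initial space, where [E_g v = v ⊠ ε g]. All
processes are compared through these matrix elements. *)
Definition mel (X : HF -> HF) (f g : R -> k) (v : h) : h :=
  slice (ε f) (X (v ⊠ ε g)).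

Lemma inner_mel X f g u v :
  inner u (mel X f g v) = inner (u ⊠ ε f) (X (v ⊠ ε g)).
Proof. exact: inner_slice. Qed.

Lemma bounded_mel X f g : bounded_op X -> bounded_op (mel X f g).
Proof.
move=> bX; apply: (bounded_op_comp (A := slice (ε f)) (B := fun v => X (v ⊠ ε g))).
  exact: bounded_slice.
by apply: bounded_op_comp bX _; exact: bounded_tensl.
Qed.

Lemma mel_eq X f g f' g' v : L2p f -> L2p g ->
  (forall s, 0 <= s -> f s = f' s) -> (forall s, 0 <= s -> g s = g' s) ->
  mel X f g v = mel X f' g' v.
Proof.
move=> Lf Lg ff gg; rewrite /mel (expv_eq (fock S k _) (g := f') Lf); last first.
  by move=> s; rewrite in_itv/= andbT; exact: ff.
rewrite (expv_eq (fock S k _) (g := g') Lg)// => s.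
by rewrite in_itv/= andbT; exact: gg.
Qed.

(** Adaptedness at [t] read on matrix elements: what the test functions do after [t]
enters only through their overlap there. *)
Definition mel_adapted (t : R) (X : HF -> HF) : Prop :=
  forall f g v, L2p f -> L2p g ->
  mel X f g v = cexp (L2inner `[t, +oo[ f g) *:
    mel X (splice t f (fun=> 0)) (splice t g (fun=> 0)) v.

Lemma adapted_mel_adapted (t : R) X : 0 <= t -> adapted t X -> mel_adapted t X.
Proof.
move=> t0 [Y bY ->] f g v Lf Lg.
have [[bS iS] hS] := split_past_spec t0.
have [bT hT] := tensor_op_idr S (Fock_future S k t) bY.
have melE f' g' v' u : L2p f' -> L2p g' -> inner u (mel (adj (@split_past R S h k t)
      \o tensor_op Y id \o @split_past R S h k t) f' g' v') =
      inner (u ⊠ ε f') (Y (v' ⊠ ε g')) * cexp (L2inner `[t, +oo[ f' g').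
  move=> Lf' Lg'; rewrite inner_mel /= inner_adjr// !hS// hT tens_inner.
  by rewrite expv_inner//; exact: L2_future.
have L0 := L2_zero k `[0, +oo[.
apply: inner_ext => u; rewrite innerZr !melE//; try exact: L2_spliceT.
rewrite [L2inner _ (splice _ _ _) _](_ : _ = 0); last first.
  rewrite -(L2inner0l `[t, +oo[ (fun=> 0 : k)).
  by apply: eq_L2inner => s /splice_future ->.
rewrite cexp0 mulr1 mulrC; congr (_ * _).
have Lf' : L2 `[0, t[ f by exact: L2_past.
have Lg' : L2 `[0, t[ g by exact: L2_past.
rewrite -(@expv_eq _ _ _ (fock S k _) f (splice t f _) Lf').
  rewrite -(@expv_eq _ _ _ (fock S k _) g (splice t g _) Lg')// => s.
  by move/splice_past->.
by move=> s /splice_past->.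
Qed.

(** Operators acting only after time [s]: the part of the test function before [s] is
left alone. Stated on the vectors produced, it is stable under composition without
exhibiting a factor on the future Fock space. *)
Definition future (s : R) (Z : HF -> HF) : Prop :=
  forall v g, L2p g ->
  clspan [set x | exists w q, L2p q /\ x = w ⊠ ε (splice s g q)] (Z (v ⊠ ε g)).

(** An adapted factor sees the past of the test functions and a future factor what
comes after. The overlap after [t] produced by adaptedness is the one that slicing
the future factor produces, and is thus counted once. *)
Lemma mel_mul (t : R) (X Z : HF -> HF) f g v :
  0 <= t -> bounded_op X -> mel_adapted t X -> future t Z -> L2p f -> L2p g ->
  mel (X \o Z) f g v =
  mel X (splice t f (fun=> 0)) (splice t g (fun=> 0)) (mel Z (splice t (fun=> 0) f) g v).
Proof.
move=> t0 bX aX fZ Lf Lg; have L0 := L2_zero k `[0, +oo[.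
have bl : bounded_op (fun z : HF => slice (ε f) (X z)).
  by apply: bounded_op_comp bX; exact: bounded_slice.
have br : bounded_op (fun z : HF => mel X (splice t f (fun=> 0)) (splice t g (fun=> 0))
    (slice (ε (splice t (fun=> 0) f)) z)).
  exact: (bounded_op_comp (bounded_mel (splice t f (fun=> 0)) (splice t g (fun=> 0)) bX)
    (bounded_slice (tensor S h (Fock S k)) (ε (splice t (fun=> 0) f)))).
rewrite /mel /=; apply: (fZ v g Lg _ (closed_subspace_eq bl br)).
move=> _ [w [q [Lq ->]]] /=.
rewrite -[LHS]/(mel X f (splice t g q) w) aX//; last exact: L2_spliceT.
have -> : splice t (splice t g q) (fun=> 0) = splice t g (fun=> 0).
  by apply/funext => s; rewrite /splice; case: (_ < _).
rewrite slice_tens expv_inner; [|exact: L2_spliceT|exact: L2_spliceT].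
have /bounded_opP[lm _] := bounded_mel (splice t f (fun=> 0)) (splice t g (fun=> 0)) bX.
rewrite (opZ lm) L2inner_splice// L2inner0l add0r; congr (cexp _ *: _).
by apply: eq_L2inner => s si //; rewrite splice_future.
Qed.

Lemma future_comp s (Z1 Z2 : HF -> HF) :
  0 <= s -> bounded_op Z1 -> future s Z1 -> future s Z2 -> future s (Z1 \o Z2).
Proof.
move=> s0 bZ f1 f2 v g Lg /=; apply: clspan_map bZ _ (f2 v g Lg).
move=> _ [w [q [Lq ->]]].
have Lc : L2p (splice s g q) by exact: L2_spliceT.
move: (f1 w _ Lc); apply; first exact: clspan_subspace.
move=> _ [w' [q' [Lq' ->]]]; apply: sub_clspan; exists w', q'; split => //.
by congr (_ ⊠ ε _); apply/funext => r; rewrite /splice; case: (_ < _).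
Qed.

Lemma future_mono s s' (Z : HF -> HF) : 0 <= s -> s <= s' -> future s' Z -> future s Z.
Proof.
move=> s0 ss fZ v g Lg; move: (fZ v g Lg); apply; first exact: clspan_subspace.
move=> _ [w [q [Lq ->]]]; apply: sub_clspan; exists w, (splice s' g q); split.
  by apply: L2_spliceT => //; exact: le_trans ss.
congr (_ ⊠ ε _); apply/funext => r; rewrite /splice.
by case: (ltP r s) => // rs; rewrite (lt_le_trans rs ss).
Qed.

Definition unshift (s : R) (f : R -> k) : R -> k := fun r => f (r + s).

Section TimeShift.
Variables (s : R) (W : HF -> HF).
Hypotheses (s0 : 0 <= s) (bW : bounded_op W).

Local Notation G := (tensor_op id (@shift_op R S k s) : HF -> h ⊗ Fock_future S k s).
Local Notation Sf := (@split_future R S h k s).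
Local Notation TW := (tensor_op id (G \o W \o adj G) :
  Fock_past S k s ⊗ (h ⊗ Fock_future S k s) -> _).

Lemma isometric_ampl_shift : isometric G.
Proof. by apply: isometric_ampliationr; exact: (shift_op_spec s).1. Qed.

Lemma adj_ampl_shift u f : L2p f -> adj G (u ⊠ ε f) = u ⊠ ε (unshift s f).
Proof.
move=> Lf; rewrite -[RHS](isometric_adjK _ isometric_ampl_shift).
have [_ ->] := tensor_op_idl S h (shift_op_spec s).1.1.
rewrite (shift_op_spec s).2; last exact: L2_unshift.
congr (adj _ (_ ⊠ ε _)); apply/funext => r.
by rewrite /unshift subrK.
Qed.

Lemma bounded_conj_shift : bounded_op (G \o W \o adj G).
Proof.
apply: bounded_op_comp; last by apply: bounded_adj; exact: isometric_ampl_shift.1.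
by apply: bounded_op_comp => //; exact: isometric_ampl_shift.1.
Qed.

Lemma bounded_time_shift : bounded_op (time_shift s W).
Proof.
apply: bounded_op_comp; last exact: (split_future_spec s0).1.1.
apply: bounded_op_comp; first by apply: bounded_adj; exact: (split_future_spec s0).1.1.
exact: (tensor_op_idl S _ bounded_conj_shift).1.
Qed.

Lemma contractive_time_shift : contractive W -> contractive (time_shift s W).
Proof.
move=> cW; have cS := isometric_contractive (split_future_spec s0).1.
have cG := isometric_contractive isometric_ampl_shift.
apply: (contractive_comp _ cS); apply: contractive_comp; first exact: contractive_adj cS.
apply: contractive_ampliationr; apply: contractive_comp (contractive_adj cG).
exact: contractive_comp.
Qed.

(** The untouched past legs contribute their overlap, the shifted legs the matrix
element of [W]. *)
Lemma mel_time_shift f g v : L2p f -> L2p g ->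
  mel (time_shift s W) f g v =
  cexp (L2inner `[0, s[ f g) *: mel W (unshift s f) (unshift s g) v.
Proof.
move=> Lf Lg; apply: inner_ext => u; rewrite innerZr !inner_mel.
have [[bS iS] hS] := split_future_spec s0.
have [bT hT] := tensor_op_idl S (Fock_past S k s) bounded_conj_shift.
rewrite /time_shift /= inner_adjr// !hS// hT tens_inner expv_inner; try exact: L2_past.
congr (_ * _) => /=; rewrite -inner_adjl; last exact: isometric_ampl_shift.1.
by rewrite !adj_ampl_shift.
Qed.

Lemma future_time_shift : future s (time_shift s W).
Proof.
move=> v g Lg; have [[bS iS] hS] := split_future_spec s0.
have [bT hT] := tensor_op_idl S (Fock_past S k s) bounded_conj_shift.
rewrite /time_shift /= hS// hT.
set b := (_ \o _) _; apply: (clspan_map (A := fun b => adj Sf (ε g ⊠ b)) _ _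
  (tens_expv_clspan b)).
  by apply: bounded_op_comp (bounded_adj bS) _; exact: bounded_tensr.
move=> _ [w [q [Lq ->]]]; apply: sub_clspan.
have L0 := L2_zero k `[0, s[.
exists w, (splice s (fun=> 0) q); split; first exact: L2_splice.
have Lc : L2p (splice s g q) by apply: L2_splice => //; exact: L2_past.
have -> : splice s g (splice s (fun=> 0) q) = splice s g q.
  by apply/funext => r; rewrite /splice; case: (_ < _).
rewrite -[RHS](isometric_adjK _ (split_future_spec s0).1) hS//; congr (adj _ _).
have Lc' : L2 `[0, s[ g by exact: L2_past.
rewrite (@expv_eq _ _ _ (fock S k _) g (splice s g q) Lc'); last by move=> r /splice_past->.
rewrite (@expv_eq _ _ _ (fock S k _) q (splice s g q) Lq)//.
by move=> r /splice_future->.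
Qed.

Lemma mel_adapted_time_shift t : 0 <= t -> mel_adapted t W -> mel_adapted (s + t) (time_shift s W).
Proof.
move=> t0 aW f g v Lf Lg; have L0 := L2_zero k `[0, +oo[.
have st0 : 0 <= s + t by rewrite addr_ge0.
rewrite !mel_time_shift//; try exact: L2_spliceT.
rewrite aW; try exact: L2_unshift.
rewrite !scalerA mulrC.
rewrite (@mel_eq W (unshift s (splice (s + t) f (fun=> 0))) (unshift s (splice (s + t) g (fun=> 0)))
  (splice t (unshift s f) (fun=> 0)) (splice t (unshift s g) (fun=> 0))); last first.
- by move=> r _; rewrite /unshift /splice addrC ltrD2l.
- by move=> r _; rewrite /unshift /splice addrC ltrD2l.
- by apply: L2_unshift => //; exact: L2_spliceT.
- by apply: L2_unshift => //; exact: L2_spliceT.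
rewrite -!cexpD L2inner_unshift//; congr (cexp (_ + _) *: _).
by apply: eq_L2inner => r; rewrite in_itv/= => /andP[_ rs];
  rewrite /splice (lt_le_trans rs)// lerDl.
Qed.

End TimeShift.

End OneNoise.
End Structure.

(** * Two noises *)

Section PairL2.
Variables (R : realType) (k1 k2 : hilbertType R).
Local Notation mu := (@lebesgue_measure R).
Local Notation k12 := (hsum k1 k2).

Lemma hn_sq_hsum (x : k12) : hn x ^+ 2 = hn x.1 ^+ 2 + hn x.2 ^+ 2.
Proof. by rewrite !hn_sq -ReD. Qed.

Lemma cvg_fst_hsum (u : nat -> k12) (a : k12) :
  u @ \oo --> a -> (fun n => (u n).1) @ \oo --> a.1.
Proof.
move=> /cvg_hnP ua; apply/cvg_hnP => e /ua[N hN]; exists N => n /hN.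
apply: le_lt_trans; have := hsum_norm_fst (u n - a).
by rewrite !hnE lecR.
Qed.

Lemma cvg_snd_hsum (u : nat -> k12) (a : k12) :
  u @ \oo --> a -> (fun n => (u n).2) @ \oo --> a.2.
Proof.
move=> /cvg_hnP ua; apply/cvg_hnP => e /ua[N hN]; exists N => n /hN.
apply: le_lt_trans; have := hsum_norm_snd (u n - a).
by rewrite !hnE lecR.
Qed.

Lemma L2_fst (I : interval R) (f : R -> k12) : L2 I f -> L2 I (fun s => (f s).1).
Proof.
move=> /L2P[mf jf]; apply: (L2_le _ jf).
  apply: (strongly_measurable_op (op := fun a _ : k12 => a.1) _ mf mf).
  by move=> u v a b ua _; exact: cvg_fst_hsum.
by move=> s _; rewrite sqnormE hn_sq_hsum lerDl sqr_ge0.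
Qed.

Lemma L2_snd (I : interval R) (f : R -> k12) : L2 I f -> L2 I (fun s => (f s).2).
Proof.
move=> /L2P[mf jf]; apply: (L2_le _ jf).
  apply: (strongly_measurable_op (op := fun a _ : k12 => a.2) _ mf mf).
  by move=> u v a b ua _; exact: cvg_snd_hsum.
by move=> s _; rewrite sqnormE hn_sq_hsum lerDr sqr_ge0.
Qed.

Lemma L2_pair (I : interval R) (f1 : R -> k1) (f2 : R -> k2) : L2 I f1 -> L2 I f2 ->
  L2 I (fun s => (f1 s, f2 s) : k12).
Proof.
move=> /L2P[m1 j1] /L2P[m2 j2].
apply: (L2_le (phi := fun s => sqnorm f1 s + sqnorm f2 s)).
- apply: (strongly_measurable_op (op := fun a b => (a, b) : k12) _ m1 m2).
  exact: cvg_hsum.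
- exact: integrable_realD.
- by move=> s _; rewrite hn_sq_hsum !sqnormE.
Qed.

Lemma L2inner_hsum (I : interval R) (f g : R -> k12) : L2 I f -> L2 I g ->
  L2inner I f g = L2inner I (fun s => (f s).1) (fun s => (g s).1) +
                  L2inner I (fun s => (f s).2) (fun s => (g s).2).
Proof.
move=> Lf Lg; rewrite /L2inner /Cintegral.
rewrite (_ : forall a b c d : R, (a +i* b)%C + (c +i* d)%C = ((a + c) +i* (b + d))%C)//.
rewrite -!RintegralD//.
- by congr Complex; apply: eq_Rintegral => s _; rewrite -?ReD -?ImD.
- by apply: integrable_Im_inner; exact: L2_fst.
- by apply: integrable_Im_inner; exact: L2_snd.
- by apply: integrable_Re_inner; exact: L2_fst.
- by apply: integrable_Re_inner; exact: L2_snd.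
Qed.

Lemma expv_scale_hsum (I : interval R) (f : R -> k12) : L2 I f ->
  expv_scale I f =
  expv_scale I (fun s => (f s).1) * expv_scale I (fun s => (f s).2).
Proof.
move=> Lf; rewrite /expv_scale (L2inner_hsum Lf Lf) ReD.
by rewrite mulrDl opprD expRD rmorphM.
Qed.

End PairL2.

Section TwoNoises.
Variables (R : realType) (S : realization R) (h k1 k2 : hilbertType R).
Local Notation C := R[i].
Local Notation "H ⊗ K" := (tensor_space (tensor S H K))
  (at level 40, left associativity).
Local Notation "u ⊠ v" := (tens (tensor S _ _) u v)
  (at level 40, left associativity).
Local Notation "'ε' f" := (expv (fock S _ _) f) (at level 10, f at level 9).
Local Notation "'ϖ' f" := (nexpv (fock S _ _) f) (at level 10, f at level 9).
Local Notation L2p := (L2 `[0%R, +oo[).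
Local Notation k12 := (hsum k1 k2).
Local Notation Sn := (@split_noise R S h k1 k2).
Local Notation Fl := (@flip_op R S h k1 k2).

(** Inner products of pairs add up, so their exponentials factorise over the noises. *)
Lemma split_noise_spec :
  isometric Sn /\ forall u (f : R -> k12), L2p f ->
  Sn (u ⊠ ε f) = u ⊠ ε (fun s => (f s).1) ⊠ ε (fun s => (f s).2).
Proof.
pose a (p : h * ((R -> k1) * (R -> k2))) : h ⊗ Fock S k12 :=
  p.1 ⊠ ϖ (fun s => (p.2.1 s, p.2.2 s) : k12).
pose b (p : h * ((R -> k1) * (R -> k2))) : h ⊗ Fock S k1 ⊗ Fock S k2 :=
  p.1 ⊠ ϖ p.2.1 ⊠ ϖ p.2.2.
pose D : set (h * ((R -> k1) * (R -> k2))) := [set p | L2p p.2.1 /\ L2p p.2.2].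
have [|[u [f1 f2]] [v [g1 g2]] [Lf1 Lf2] [Lg1 Lg2]|iS hS] :=
    @isometric_extension R _ _ _ D a b.
- apply: clspan_total => z; move: (total_clspan z (@total_tens_nexpv _ S h k12 `[0, +oo[)).
  apply; first exact: clspan_subspace.
  move=> _ [[w f] Lf <-]; apply: sub_clspan.
  exists (w, ((fun s => (f s).1), (fun s => (f s).2))).
    by split; [exact: L2_fst|exact: L2_snd].
  by rewrite /a /=; congr (_ ⊠ ϖ _); apply/funext => s; case: (f s).
- rewrite /a /b /= !tens_inner.
  have Lf := L2_pair Lf1 Lf2; have Lg := L2_pair Lg1 Lg2.
  rewrite (nexpv_inner _ Lf Lg) (nexpv_inner _ Lf1 Lg1) (nexpv_inner _ Lf2 Lg2).
  by rewrite !expv_scale_hsum// L2inner_hsum// cexpD scale_rearrange.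
- split=> // u f Lf; have lS : linear Sn by have [/bounded_opP[]] := iS.
  have := hS (u, ((fun s => (f s).1), (fun s => (f s).2)))
     (conj (L2_fst Lf) (L2_snd Lf)).
  rewrite /a /b /= => e.
  rewrite expvE tensZr (opZ lS).
  rewrite (_ : u ⊠ ϖ f = u ⊠ ϖ (fun s => ((f s).1, (f s).2) : k12)); last first.
    by congr (_ ⊠ ϖ _); apply/funext => s; case: (f s).
  rewrite [X in _ *: X]e !nexpvE !tensZr !tensZl !scalerA.
  by rewrite (expv_scale_hsum Lf) !scale_cancel ?scale1r ?expv_scale_neq0.
Qed.

Lemma flip_spec :
  isometric Fl /\ forall u x y, Fl (u ⊠ y ⊠ x) = u ⊠ x ⊠ y.
Proof.
have [|[[u x] y] [[u' x'] y'] _ _|iS hS] := @isometric_extension R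
   (h * Fock S k1 * Fock S k2)%type (h ⊗ Fock S k2 ⊗ Fock S k1)
   (h ⊗ Fock S k1 ⊗ Fock S k2) setT
   (fun p => p.1.1 ⊠ p.2 ⊠ p.1.2) (fun p => p.1.1 ⊠ p.1.2 ⊠ p.2).
- apply: clspan_total => z; apply: clspan_tens_total => w x.
  apply: (clspan_tensl (T := tensor S (h ⊗ Fock S k2) (Fock S k1)) (S := setT)).
    move=> w' _; apply: (clspan_map (A := fun w => w ⊠ x) _ _
      (total_clspan w' (@tens_total _ _ _ (tensor S h (Fock S k2))))).
      exact: bounded_tensl.
    by move=> _ [[u y] _ <-]; apply: sub_clspan; exists (u, x, y).
  exact: sub_clspan.
- by rewrite /= !tens_inner mulrAC.
- by split => // u x y; exact: (hS (u, x, y)).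
Qed.

Lemma adj_flip u x y : adj Fl (u ⊠ x ⊠ y) = u ⊠ y ⊠ x.
Proof. by rewrite -flip_spec.2 isometric_adjK//; exact: flip_spec.1. Qed.

Section Product.
Variables (A1 : h ⊗ Fock S k1 -> h ⊗ Fock S k1) (A2 : h ⊗ Fock S k2 -> h ⊗ Fock S k2).

(** [product_process] at a fixed time, for arbitrary operators on the two noises. *)
Definition noise_product : h ⊗ Fock S k12 -> h ⊗ Fock S k12 :=
  adj Sn \o (tensor_op A1 id \o tensor_flip (tensor_op A2 id)) \o Sn.

Lemma contractive_noise_product : contractive A1 -> contractive A2 ->
  contractive noise_product.
Proof.
move=> c1 c2; have cS := isometric_contractive split_noise_spec.1.
have cF := isometric_contractive flip_spec.1.
apply: (contractive_comp _ cS); apply: (contractive_comp (contractive_adj cS)).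
apply: contractive_comp; first exact: contractive_ampliation.
apply: (contractive_comp _ (contractive_adj cF)); apply: (contractive_comp cF).
exact: contractive_ampliation.
Qed.

(** Each factor only sees its own noise, so the matrix elements multiply. *)
Lemma mel_noise_product f g v : bounded_op A1 -> bounded_op A2 ->
  L2p f -> L2p g ->
  mel noise_product f g v =
  mel A1 (fun s => (f s).1) (fun s => (g s).1)
    (mel A2 (fun s => (f s).2) (fun s => (g s).2) v).
Proof.
move=> b1 b2 Lf Lg; have [iS hS] := split_noise_spec.
have [bT1 hT1] := tensor_op_idr S (Fock S k2) b1.
have [bT2 hT2] := tensor_op_idr S (Fock S k1) b2.
set f1 := (fun s => (f s).1); set f2 := (fun s => (f s).2).
set g1 := (fun s => (g s).1); set g2 := (fun s => (g s).2).
apply: inner_ext => u; rewrite !inner_mel /noise_product /tensor_flip /=.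
rewrite inner_adjr; last exact: iS.1.
rewrite !hS// adj_flip hT2 -!inner_slice.
have key (z : h ⊗ Fock S k2) :
    slice (ε f2) ((tensor_op A1 id : h ⊗ Fock S k1 ⊗ Fock S k2 -> _) (Fl (z ⊠ ε g1))) =
    A1 (slice (ε f2) z ⊠ ε g1).
  apply: (total_eq_op (A := fun z => slice (ε f2)
      ((tensor_op A1 id : h ⊗ Fock S k1 ⊗ Fock S k2 -> _) (Fl (z ⊠ ε g1))))
    (B := fun z => A1 (slice (ε f2) z ⊠ ε g1))
    _ _ (@tens_total _ _ _ (tensor S h (Fock S k2)))).
  - apply: (bounded_op_comp (bounded_slice _ _)).
    apply: (bounded_op_comp bT1); apply: (bounded_op_comp flip_spec.1.1).
    exact: bounded_tensl.
  - apply: (bounded_op_comp b1 _ (B := fun z => slice (ε f2) z ⊠ ε g1)).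
    apply: (bounded_op_comp (bounded_tensl _ _) (bounded_slice _ _)).
  - move=> _ [[w y] _ <-] /=.
    rewrite flip_spec.2 hT1 !slice_tens tensZl.
    by have /bounded_opP[l1 _] := b1; rewrite (opZ l1).
by rewrite key.
Qed.

Lemma mel_adapted_noise_product t : 0 <= t -> bounded_op A1 -> bounded_op A2 ->
  mel_adapted t A1 -> mel_adapted t A2 -> mel_adapted t noise_product.
Proof.
move=> t0 b1 b2 a1 a2 f g v Lf Lg; have L0 := L2_zero k12 `[0, +oo[.
rewrite !mel_noise_product//; try exact: L2_spliceT.
have Lf1 := L2_fst Lf; have Lg1 := L2_fst Lg.
have Lf2 := L2_snd Lf; have Lg2 := L2_snd Lg.
have spl1 (q : R -> k12) : (fun s => (splice t q (fun=> 0) s).1) =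
    splice t (fun s => (q s).1) (fun=> 0).
  by apply/funext => s; rewrite /splice; case: (_ < _).
have spl2 (q : R -> k12) : (fun s => (splice t q (fun=> 0) s).2) =
    splice t (fun s => (q s).2) (fun=> 0).
  by apply/funext => s; rewrite /splice; case: (_ < _).
rewrite !spl1 !spl2 (a2 _ _ _ Lf2 Lg2) (a1 _ _ _ Lf1 Lg1).
have /bounded_opP[lm _] := bounded_mel (splice t (fun s => (f s).1) (fun=> 0))
  (splice t (fun s => (g s).1) (fun=> 0)) b1.
rewrite (opZ lm) scalerA -cexpD L2inner_hsum//; exact: L2_future.
Qed.

End Product.
End TwoNoises.

(** * Density of dyadic step functions *)

Section Dyadic.
Variable R : realType.
Local Notation mu := (@lebesgue_measure R).
Local Notation L2p := (L2 `[0%R, +oo[).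
Local Notation D0 := ([set` `[0, +oo[%R] : set R).

(** The left endpoint of the dyadic interval of length [2^-m] around [s]. *)
Definition dyadic_floor (m : nat) (s : R) : R := (Num.truncn (2 ^+ m * s))%:R / 2 ^+ m.

Lemma pow2_gt0 (m : nat) : 0 < 2 ^+ m :> R.
Proof. by rewrite exprn_gt0. Qed.

Lemma dyadic_floor_ge0 m s : 0 <= dyadic_floor m s.
Proof. by rewrite divr_ge0// ltW// pow2_gt0. Qed.

Lemma dyadic_floor_le m s : 0 <= s -> dyadic_floor m s <= s.
Proof.
move=> s0; rewrite ler_pdivrMr ?pow2_gt0// mulrC truncn_le.
by rewrite mulr_ge0// ltW// pow2_gt0.
Qed.

Lemma lt_dyadic_floor m s : 0 <= s -> s < dyadic_floor m s + (2 ^+ m)^-1.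
Proof.
move=> s0; rewrite -[X in _ + X]mul1r -mulrDl ltr_pdivlMr ?pow2_gt0// natr1 mulrC.
have ms0 : 0 <= 2 ^+ m * s by rewrite mulr_ge0// ltW// pow2_gt0.
by have /andP[] := truncn_itv ms0.
Qed.

Lemma dyadic_floor_eq m s (j : nat) :
  j%:R / 2 ^+ m <= s < j.+1%:R / 2 ^+ m -> dyadic_floor m s = j%:R / 2 ^+ m.
Proof.
rewrite ler_pdivrMr ?pow2_gt0// ltr_pdivlMr ?pow2_gt0// mulrC => js.
by rewrite /dyadic_floor (truncn_def js).
Qed.

(** Dyadic intervals of different lengths are nested or disjoint. *)
Lemma dyadic_floor_coarse m n s : (m <= n)%N -> 0 <= s ->
  dyadic_floor m (dyadic_floor n s) = dyadic_floor m s.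
Proof.
move=> mn s0; have m0 := pow2_gt0 m; have n0 := pow2_gt0 n.
rewrite {1}/dyadic_floor; congr (_ / _); congr (_%:R).
apply: truncn_def; apply/andP; split; last first.
  have ms0 : 0 <= 2 ^+ m * s by rewrite mulr_ge0// ltW.
  have /andP[_] := truncn_itv ms0.
  by apply: le_lt_trans; rewrite ler_pM2l// dyadic_floor_le.
set j := Num.truncn (2 ^+ m * s).
have -> : j%:R = 2 ^+ m * ((j * 2 ^ (n - m))%:R / 2 ^+ n) :> R.
  rewrite natrM natrX -{2}(subnK mn) exprD; field.
  by rewrite !expf_neq0.
rewrite ler_pM2l// ler_pM2r ?invr_gt0// ler_nat truncn_ge_nat; last first.
  by rewrite mulr_ge0// ltW.
rewrite natrM natrX -{2}(subnK mn) exprD -mulrA mulrC ler_pM2l ?pow2_gt0//.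
by rewrite truncn_le mulr_ge0// ltW.
Qed.

Lemma dyadic_floor_ltn m s (N : nat) : 0 <= s ->
  (dyadic_floor m s < N%:R) = (s < N%:R).
Proof.
move=> s0; apply/idP/idP => [|sN]; last exact: le_lt_trans (dyadic_floor_le _ s0) sN.
have ms0 : 0 <= 2 ^+ m * s by rewrite mulr_ge0// ltW// pow2_gt0.
have -> : (dyadic_floor m s < N%:R) = (Num.truncn (2 ^+ m * s) < N * 2 ^ m)%N.
  by rewrite ltr_pdivrMr ?pow2_gt0// -(ltr_nat R) natrM natrX.
rewrite truncn_lt_nat//; by rewrite natrM natrX [2 ^+ m * s]mulrC ltr_pM2r ?pow2_gt0.
Qed.

Section StepFunctions.
Variable k : hilbertType R.

(** Step functions on the half-line with breakpoints in [2^-m Z]. *)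
Definition dyadic_at (m : nat) (g : R -> k) : Prop :=
  (exists N : nat, forall s, N%:R <= s -> g s = 0) /\
  forall s, 0 <= s -> g (dyadic_floor m s) = g s.

Lemma dyadic_at_mono m n g : (m <= n)%N -> dyadic_at m g -> dyadic_at n g.
Proof.
move=> mn [g0 gm]; split => // s s0.
by rewrite -gm ?dyadic_floor_ge0// dyadic_floor_coarse// gm.
Qed.

Lemma dyadic_at_add m g h : dyadic_at m g -> dyadic_at m h ->
  dyadic_at m (fun s => g s + h s).
Proof.
move=> [[N g0] gm] [[N' h0] hm]; split; last by move=> s s0; rewrite gm// hm.
exists (N + N')%N => s; rewrite natrD => Ns.
rewrite g0 ?h0 ?addr0// (le_trans _ Ns)// ?lerDl ?lerDr ?ler0n//.
Qed.

Lemma dyadic_at_values m g : dyadic_at m g -> exists J : nat,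
  forall s, 0 <= s -> exists2 j, (j < J)%N & g s = g (j%:R / 2 ^+ m) \/ g s = 0.
Proof.
move=> [[N g0] gm]; exists (N * 2 ^ m).+1%N => s s0.
have [Ns|sN] := leP N%:R s; first by exists 0%N => //; right; exact: g0.
exists (Num.truncn (2 ^+ m * s)); last by left; rewrite -(gm _ s0).
have ms0 : 0 <= 2 ^+ m * s by rewrite mulr_ge0// ltW// pow2_gt0.
rewrite ltnW// ltnS truncn_lt_nat// natrM natrX [2 ^+ m * s]mulrC.
by rewrite ltr_pM2r ?pow2_gt0.
Qed.

Lemma dyadic_at_bounded m g : dyadic_at m g ->
  exists2 M : R, 0 <= M & forall s, 0 <= s -> hn (g s) <= M.
Proof.
move=> /dyadic_at_values[J hJ].
exists (\sum_(j < J) hn (g (j%:R / 2 ^+ m))).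
  by apply: sumr_ge0 => j _; exact: hn_ge0.
move=> s s0; have [j jJ [->|->]] := hJ s s0; last first.
  by rewrite hn0; apply: sumr_ge0 => i _; exact: hn_ge0.
rewrite (bigD1 (Ordinal jJ))//= lerDl.
by apply: sumr_ge0 => i _; exact: hn_ge0.
Qed.

Lemma dyadic_at_finitely_valued m g : dyadic_at m g -> finitely_valued D0 g.
Proof.
move=> dg; have [J hJ] := dyadic_at_values dg; have [_ gm] := dg; split.
  apply: (@sub_finite_set _ _ ([set 0] `|` [set g (j%:R / 2 ^+ m) | j in `I_J])).
    move=> _ [s /= + <-]; rewrite in_itv/= andbT => s0.
    have [j jJ [->|->]] := hJ s s0; last by left.
    by right; exists j.
  rewrite finite_setU; split; first exact: finite_set1.
  by apply: finite_image; exact: finite_II.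
move=> c.
rewrite (_ : _ `&` _ = \bigcup_(j in [set j : nat | g (j%:R / 2 ^+ m) = c])
    [set` `[j%:R / 2 ^+ m, j.+1%:R / 2 ^+ m[]).
  by apply: bigcup_measurable => j _; exact: measurable_itv.
apply/seteqP; split => s /=.
  rewrite in_itv/= andbT => -[s0 gs].
  exists (Num.truncn (2 ^+ m * s)); first by rewrite /= -gs -(gm s s0).
  rewrite /= in_itv/= dyadic_floor_le//= (lt_le_trans (lt_dyadic_floor m s0))//.
  by rewrite -[X in _ + X]mul1r -mulrDl natr1.
move=> [j /= gj]; rewrite !in_itv/= andbT => js; have /andP[s1 _] := js.
have s0 : 0 <= s by rewrite (le_trans _ s1)// divr_ge0// ltW// pow2_gt0.
by split => //; rewrite -(gm s s0) (dyadic_floor_eq js).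
Qed.

Lemma integrable_box (N M : R) :
  mu.-integrable D0 (EFin \o (fun s => M * \1_([set` `[0, N[]) s)).
Proof.
pose A : set R := [set` `[0, N[].
have j1 : mu.-integrable D0 (EFin \o \1_A).
  by apply: integrableS (integrable_indic_itv 0 N true true) => //; exact: measurable_itv.
exact: integrable_realZ.
Qed.

Lemma L2_bounded (f : R -> k) (N M : R) : strongly_measurable D0 f ->
  (forall s, 0 <= s -> hn (f s) <= M) -> (forall s, N <= s -> f s = 0) -> L2p f.
Proof.
move=> mf fM f0; apply: (L2_le mf (integrable_box N (M ^+ 2))) => s.
rewrite in_itv/= andbT => s0; have M0 : 0 <= M by exact: le_trans (hn_ge0 _) (fM s s0).
have [Ns|sN] := leP N s; first by rewrite f0// hn0 expr0n mulr_ge0 ?sqr_ge0.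
rewrite indicE mem_set ?mulr1; first by rewrite ler_sqr ?nnegrE ?hn_ge0// fM.
by rewrite /= in_itv/= s0.
Qed.

Lemma L2_dyadic m g : dyadic_at m g -> L2p g.
Proof.
move=> dg; have [[N g0] _] := dg; have [M M0 gM] := dyadic_at_bounded dg.
apply: L2_bounded gM g0.
by apply: strongly_measurable_simple; exact: dyadic_at_finitely_valued dg.
Qed.

End StepFunctions.
End Dyadic.

Section Approximation.
Variables (R : realType) (k : hilbertType R).
Local Notation mu := (@lebesgue_measure R).
Local Notation L2p := (L2 `[0%R, +oo[).
Local Notation D0 := ([set` `[0, +oo[%R] : set R).
Local Notation SM := (strongly_measurable D0).
Implicit Types f g h : R -> k.

(** The squared distance in [L^2] of the half-line. *)
Definition sqdist f g : \bar R := \int[mu]_(s in D0) (sqnorm (fun s => f s - g s) s)%:E.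

Definition dyadic_limit f : Prop :=
  SM f /\ forall e : R, 0 < e -> exists g, (exists m, dyadic_at m g) /\ (sqdist f g < e%:E)%E.

Let D0E s : D0 s -> 0 <= s.
Proof. by rewrite /= in_itv/= andbT. Qed.

Lemma strongly_measurableB f g : SM f -> SM g -> SM (fun s => f s - g s).
Proof.
move=> mf mg; apply: (strongly_measurable_op (op := fun a b => a - b) _ mf mg).
by move=> u v a b; exact: cvgB.
Qed.

Lemma strongly_measurableD f g : SM f -> SM g -> SM (fun s => f s + g s).
Proof.
move=> mf mg; apply: (strongly_measurable_op (op := fun a b => a + b) _ mf mg).
by move=> u v a b; exact: cvgD.
Qed.

Lemma strongly_measurable_dyadic m g : dyadic_at m g -> SM g.
Proof. by move=> dg; apply: strongly_measurable_simple; exact: dyadic_at_finitely_valued dg. Qed.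

Lemma hn_sq_add (a b : k) : hn (a + b) ^+ 2 <= 2 * hn a ^+ 2 + 2 * hn b ^+ 2.
Proof.
rewrite (@le_trans _ _ ((hn a + hn b) ^+ 2))//.
  by rewrite ler_sqr ?nnegrE ?addr_ge0 ?hn_ge0// hnD.
by have := sqr_ge0 (hn a - hn b); nra.
Qed.

Lemma sqdistD_le (f1 f2 g1 g2 f g : R -> k) :
  SM f1 -> SM f2 -> SM g1 -> SM g2 -> SM f -> SM g ->
  (forall s, 0 <= s -> f s - g s = (f1 s - g1 s) + (f2 s - g2 s)) ->
  (sqdist f g <= 2%:E * sqdist f1 g1 + 2%:E * sqdist f2 g2)%E.
Proof.
move=> mf1 mf2 mg1 mg2 mf mg e.
have m1 := emeasurable_sqnorm (strongly_measurableB mf1 mg1).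
have m2 := emeasurable_sqnorm (strongly_measurableB mf2 mg2).
have p (u : R -> k) s : (0 <= (sqnorm u s)%:E)%E by rewrite lee_fin sqnorm_ge0.
rewrite -!ge0_integralZl//; try by move=> s _; exact: p.
rewrite -ge0_integralD//; last 4 first.
- by move=> s _; rewrite mule_ge0.
- exact: measurable_funeM.
- by move=> s _; rewrite mule_ge0.
- exact: measurable_funeM.
apply: ge0_le_integral => //.
- by apply: emeasurable_sqnorm; exact: strongly_measurableB.
- by apply: emeasurable_funD; exact: measurable_funeM.
move=> s /D0E s0; by rewrite -!EFinM -EFinD lee_fin !sqnormE e// hn_sq_add.
Qed.

Lemma dyadic_limit_closed f : SM f ->
  (forall e : R, 0 < e -> exists2 h, dyadic_limit h & (sqdist f h < e%:E)%E) ->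
  dyadic_limit f.
Proof.
move=> mf hf; split => // e e0.
have e4 : 0 < e / 4 by rewrite divr_gt0.
have [h [mh hh] fh] := hf _ e4; have [g [[m dg] hg]] := hh _ e4.
exists g; split; first by exists m.
have mg := strongly_measurable_dyadic dg.
apply: (@le_lt_trans _ _ (2%:E * sqdist f h + 2%:E * sqdist h g)%E).
  by apply: sqdistD_le => // s _; rewrite addrA subrK.
rewrite (_ : e%:E = 2%:E * (e / 4)%:E + 2%:E * (e / 4)%:E)%E; last first.
  by rewrite -!EFinM -EFinD; congr EFin; field.
by apply: lteD; rewrite lte_pmul2l.
Qed.

Lemma dyadic_limit_add f h : dyadic_limit f -> dyadic_limit h ->
  dyadic_limit (fun s => f s + h s).
Proof.
move=> [mf hf] [mh hh]; have mfh := strongly_measurableD mf mh; split => // e e0.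
have e4 : 0 < e / 4 by rewrite divr_gt0.
have [g [[m dg] fg]] := hf _ e4; have [g' [[m' dg'] hg]] := hh _ e4.
have mg := strongly_measurable_dyadic dg; have mg' := strongly_measurable_dyadic dg'.
exists (fun s => g s + g' s); split.
  exists (maxn m m'); apply: dyadic_at_add.
    exact: dyadic_at_mono (leq_maxl _ _) dg.
  exact: dyadic_at_mono (leq_maxr _ _) dg'.
have mgg := strongly_measurableD mg mg'.
apply: (@le_lt_trans _ _ (2%:E * sqdist f g + 2%:E * sqdist h g')%E).
  by apply: sqdistD_le => // s _; rewrite opprD addrACA.
rewrite (_ : e%:E = 2%:E * (e / 4)%:E + 2%:E * (e / 4)%:E)%E; last first.
  by rewrite -!EFinM -EFinD; congr EFin; field.
by apply: lteD; rewrite lte_pmul2l.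
Qed.

Lemma eq_sqdist f g f' g' : (forall s, 0 <= s -> f s = f' s) ->
  (forall s, 0 <= s -> g s = g' s) -> sqdist f g = sqdist f' g'.
Proof.
move=> ff gg; apply: eq_integral => s /set_mem /=; rewrite in_itv/= andbT => s0.
by rewrite !sqnormE ff// gg.
Qed.

Lemma dyadic_limit_eq f g : (forall s, 0 <= s -> f s = g s) ->
  dyadic_limit f -> dyadic_limit g.
Proof.
move=> fg [mf hf]; split.
  by apply: strongly_measurable_eq mf => s /=; rewrite in_itv/= andbT; exact: fg.
move=> e /hf[u [du hu]]; exists u; split => //.
by rewrite -(@eq_sqdist f u g u).
Qed.

(** Dominated convergence for the squared distances. *)
Lemma dyadic_limit_dominated f (g : nat -> R -> k) (phi : R -> R) :
  SM f -> (forall n, dyadic_limit (g n)) -> mu.-integrable D0 (EFin \o phi) ->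
  (forall n s, 0 <= s -> hn (f s - g n s) ^+ 2 <= phi s) ->
  (forall s, 0 <= s -> (fun n => g n s) @ \oo --> f s) ->
  dyadic_limit f.
Proof.
move=> mf dg jphi bg cg; apply: dyadic_limit_closed => // e e0.
have mg n : SM (g n) by have [] := dg n.
have [] := @dominated_convergence _ _ R mu D0 (measurable_itv _)
  (fun n s => (sqnorm (fun s => f s - g n s) s)%:E) (cst 0%E) (EFin \o phi).
- by move=> n; apply: emeasurable_sqnorm; exact: strongly_measurableB.
- exact: measurable_cst.
- apply: aeW => s /D0E s0; apply: cvg_EFin; first by near=> n.
  apply/cvgrPdist_lt => d d0.
  have d1 : 0 < Num.min 1 d by rewrite lt_min ltr01.
  move/cvg_hnP : (cg s s0) => /(_ _ d1)[N hN]; exists N => // n Nn.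
  rewrite /= sub0r normrN ger0_norm ?sqnorm_ge0// sqnormE hnB.
  have := hN n Nn; rewrite lt_min => /andP[h1 h2].
  have := hn_ge0 (g n s - f s); by nra.
- exact: jphi.
- apply: aeW => s n /D0E s0; rewrite /= lee_fin ger0_norm ?sqnorm_ge0// sqnormE.
  exact: bg.
move=> _ _; rewrite integral_cst ?mul0e//.
move=> /fine_cvgP[[N1 _ fin1] /cvgrPdist_lt/(_ _ e0)[N2 _ h2]].
pose n := maxn N1 N2; exists (g n) => //.
have := h2 n (leq_maxr _ _); have := fin1 n (leq_maxl _ _).
rewrite /= -/(sqdist f (g n)) => fin /=.
rewrite sub0r normrN => lt_e; rewrite -(fineK fin) lte_fin.
exact: le_lt_trans (ler_norm _) lt_e.
Unshelve. all: by end_near. Qed.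

Let in_box (N s : R) : 0 <= s -> s < N -> [set` `[0, N[] s.
Proof. by move=> s0 sN; rewrite /= in_itv/=; apply/andP. Qed.

Let in_ray (N s : R) : s < N -> [set` `]-oo, N[] s.
Proof. by move=> sN; rewrite /= in_itv. Qed.

Lemma dyadic_limit_dyadic m g : dyadic_at m g -> dyadic_limit g.
Proof.
move=> dg; split; first exact: strongly_measurable_dyadic dg.
move=> e e0; exists g; split; first by exists m.
rewrite (_ : sqdist g g = 0)%E ?lte_fin// /sqdist.
by apply: integral0_eq => s _; rewrite sqnormE subrr hn0 expr0n.
Qed.

Definition box (c : k) (B : set R) : R -> k := fun s => if s \in B then c else 0.

Lemma strongly_measurable_box c B : measurable B -> SM (box c B).
Proof.
move=> mB; apply: strongly_measurable_simple.
have fB := finitely_valued_mem (measurable_itv `[0, +oo[) mB.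
exact: (finitely_valued_op (fun b _ : bool => if b then c else 0) fB fB).
Qed.

(** An open set is the increasing union of the dyadic intervals it contains. *)
Lemma dyadic_limit_open c (U : set R) (N : nat) : open U ->
  dyadic_limit (box c (U `&` [set` `]-oo, N%:R[])).
Proof.
move=> oU.
have mU : measurable (U `&` [set` `]-oo, N%:R[]).
  by apply: measurableI; [exact: open_measurable|exact: measurable_itv].
pose I m s : set R := [set` `[dyadic_floor m s, dyadic_floor m s + (2 ^+ m)^-1[].
have Is m s : 0 <= s -> I m s s.
  by move=> s0; rewrite /I /= in_itv/= dyadic_floor_le// lt_dyadic_floor.
pose g m s := if `[< I m s `<=` U >] && (s < N%:R) then c else 0.
apply: (@dyadic_limit_dominated _ g (fun s => hn c ^+ 2 * \1_([set` `[0, N%:R[]) s)).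
- exact: strongly_measurable_box.
- move=> m; apply: (@dyadic_limit_dyadic m); split.
    by exists N => s Ns; rewrite /g ltNge Ns andbF.
  move=> s s0; rewrite /g dyadic_floor_ltn//.
  by rewrite /I dyadic_floor_coarse.
- exact: integrable_box.
- move=> m s s0; rewrite /box /g.
  have [sN|Ns] := ltP s N%:R; last first.
    rewrite andbF memNset; last by move=> [_ /=]; rewrite in_itv/= ltNge Ns.
    by rewrite subrr hn0 expr0n mulr_ge0 ?sqr_ge0.
  rewrite andbT (_ : \1__ s = 1) ?mulr1; last by rewrite indicE mem_set//; exact: in_box.
  by case: ifP => _; case: ifP => _; rewrite ?subrr ?subr0 ?sub0r ?hnN ?hn0 ?expr0n ?sqr_ge0.
- move=> s s0; rewrite /box /g.
  have [sN|Ns] := ltP s N%:R; last first.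
    rewrite memNset; last by move=> [_ /=]; rewrite in_itv/= ltNge Ns.
    by under eq_fun do rewrite andbF; exact: cvg_cst.
  under eq_fun do rewrite andbT.
  have [Us|nUs] := pselect (U s); last first.
    rewrite memNset; last by case.
    apply: (@cvg_trans _ ((fun=> 0 : k) @ \oo)); last exact: cvg_cst.
    apply: near_eq_cvg; near=> m; case: asboolP => // h.
    by case: nUs; apply: h; exact: Is.
  rewrite mem_set; last by split => //; exact: in_ray.
  have [r /= r0 rU] : exists2 r : R, 0 < r & ball s r `<=` U.
    by have /nbhs_ballP[r /= r0 rU] := open_nbhs_nbhs (conj oU Us); exists r.
  apply/cvg_hnP => e e0.
  have [M hM] := harmonic_small r0; exists M => m Mm.
  case: asboolP => [_|[]]; first by rewrite subrr hn0.
  move=> x; rewrite /I /= in_itv/= => /andP[x1 x2]; apply: rU.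
  have h1 := dyadic_floor_le m s0; have h2 := lt_dyadic_floor m s0.
  have h3 : (2 ^+ m)^-1 < r.
    apply: le_lt_trans (hM m Mm); rewrite lef_pV2 ?posrE ?pow2_gt0//.
    by rewrite -natrX ler_nat ltn_expl.
  by rewrite /ball/= ltr_norml; apply/andP; split; lra.
Unshelve. all: by end_near. Qed.

(** Outer regularity: up to small measure, a set of finite measure is open. *)
Lemma dyadic_limit_measurable c (A : set R) (N : nat) : measurable A ->
  dyadic_limit (box c (A `&` [set` `]-oo, N%:R[])).
Proof.
move=> mA; pose J : set R := [set` `]-oo, N%:R[].
have mJ : measurable J by exact: measurable_itv.
have mAJ : measurable (A `&` J) by exact: measurableI.
apply: dyadic_limit_closed; first exact: strongly_measurable_box.
move=> e e0.
pose A' : set R := A `&` [set` `[0, N%:R[].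
have mA' : measurable A' by apply: measurableI => //; exact: measurable_itv.
have fA' : (mu A' < +oo)%E.
  apply: (@le_lt_trans _ _ (mu [set` `[0, N%:R[])).
    apply: le_measure; [exact: mem_set| |exact: subIsetr].
    by apply: mem_set; exact: measurable_itv.
  by rewrite lebesgue_measure_itv/=; case: ifP; rewrite ?ltry// -EFinB ltry.
have P0 : 0 < hn c ^+ 2 + 1 by rewrite ltr_wpDl ?sqr_ge0.
have d0 : 0 < e / (hn c ^+ 2 + 1) by rewrite divr_gt0.
have [U [oU A'U UA']] := lebesgue_regularity_outer mA' fA' d0.
have mU : measurable U by exact: open_measurable.
exists (box c (U `&` J)); first exact: dyadic_limit_open.
have mD : measurable (U `\` A') by exact: measurableD.
pose ind : R -> \bar R := EFin \o \1_(U `\` A').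
have mind : measurable_fun D0 ind.
  by apply/measurable_EFinP; exact: measurable_indic.
have ind0 s : (0 <= ind s)%E by rewrite lee_fin.
have : (sqdist (box c (A `&` J)) (box c (U `&` J)) <=
        \int[mu]_(s in D0) ((hn c ^+ 2)%:E * ind s))%E.
  apply: ge0_le_integral => //.
  - by move=> s _; rewrite lee_fin sqnorm_ge0.
  - by apply: emeasurable_sqnorm; apply: strongly_measurableB; apply: strongly_measurable_box => //; exact: measurableI.
  - exact: measurable_funeM.
  move=> s /D0E s0; rewrite /ind /= -EFinM lee_fin sqnormE /box.
  have [sJ|nJ] := pselect (J s); last first.
    rewrite !memNset; [|by case|by case].
    by rewrite subrr hn0 expr0n mulr_ge0 ?sqr_ge0.
  have A'E : A s <-> A' s.
    by split=> [As|[]//]; split => //; apply: in_box => //; move: sJ; rewrite /J/= in_itv.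
  have [As|nAs] := pselect (A s).
    have Us : U s by apply: A'U; exact/A'E.
    by rewrite !mem_set// subrr hn0 expr0n mulr_ge0 ?sqr_ge0.
  rewrite [s \in A `&` J]memNset; last by case.
  have [Us|nUs] := pselect (U s); last first.
    rewrite memNset; last by case.
    by rewrite subrr hn0 expr0n mulr_ge0 ?sqr_ge0.
  rewrite indicE !mem_set//; first by rewrite sub0r hnN mulr1.
  by split => // /A'E.
rewrite ge0_integralZl//; last by rewrite lee_fin sqr_ge0.
rewrite /ind integral_indic//; move/le_lt_trans; apply.
have mle : (mu ((U `\` A') `&` D0) <= (e / (hn c ^+ 2 + 1))%:E)%E.
  apply: le_trans (ltW UA'); apply: le_measure; [|exact: mem_set|exact: subIsetl].
  by apply: mem_set; apply: measurableI => //; exact: measurable_itv.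
apply: (@le_lt_trans _ _ ((hn c ^+ 2)%:E * (e / (hn c ^+ 2 + 1))%:E)%E).
  by apply: lee_wpmul2l => //; rewrite lee_fin sqr_ge0.
rewrite -EFinM lte_fin mulrA ltr_pdivrMr// mulrC ltr_pM2l//.
by rewrite ltrDl.
Qed.

(** Splitting off one value at a time. *)
Lemma dyadic_limit_simple (l : seq k) f (N : nat) : finitely_valued D0 f ->
  (forall s, 0 <= s -> f s = 0 \/ f s \in l) -> (forall s, N%:R <= s -> f s = 0) ->
  dyadic_limit f.
Proof.
elim: l f => [|c l IH] f ff fl fN.
  apply: (@dyadic_limit_eq (fun=> 0)).
    by move=> s s0; case: (fl s s0) => [->|].
  by apply: (@dyadic_limit_dyadic 0); split => //; exists 0%N.
pose f' s := if f s == c then 0 else f s.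
have mA : measurable (D0 `&` f @^-1` [set c]) by case: ff.
have d1 := dyadic_limit_measurable c N mA.
have d2 : dyadic_limit f'.
  apply: IH.
  - exact: (finitely_valued_op (fun a _ : k => if a == c then 0 else a) ff ff).
  - move=> s s0; rewrite /f'; case: eqP => [|ne]; first by left.
    by case: (fl s s0) => [|]; [left|rewrite inE => /orP[/eqP//|]; right].
  - by move=> s /fN; rewrite /f' => ->; case: eqP.
apply: dyadic_limit_eq (dyadic_limit_add d1 d2) => s s0.
rewrite /box /f'; have [Ns|sN] := leP N%:R s.
  rewrite fN// memNset; last by move=> [_ /=]; rewrite in_itv/= ltNge Ns.
  by rewrite add0r; case: eqP.
case: eqP => [fc|nfc].
  rewrite mem_set ?addr0//; split; last exact: in_ray.
  by split => //=; rewrite in_itv/= andbT.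
by rewrite memNset ?add0r// => -[[]].
Qed.

(** A pointwise approximation of [f] by simple functions becomes dominated by [9 |f|^2]
once it is set to zero where it exceeds [2 |f|] and beyond time [n]. *)
Lemma dyadic_limit_L2 f : L2p f -> dyadic_limit f.
Proof.
move=> /L2P[mf jf]; have [g [sg cg]] := mf.
pose B n : set R := D0 `&` [set s | sqnorm (g n) s <= 4 * sqnorm f s].
pose J n : set R := [set` `]-oo, n%:R[].
have mB n : measurable (B n).
  apply: measurable_fun_le; first exact: measurable_itv.
    by apply: measurable_sqnorm; apply: strongly_measurable_simple; exact: sg.
  by apply: measurable_funM => //; exact: measurable_sqnorm.
have mBJ n : measurable (B n `&` J n).
  by apply: measurableI => //; exact: measurable_itv.
pose g' n s := if s \in B n `&` J n then g n s else 0.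
apply: (@dyadic_limit_dominated _ g' (fun s => 9 * sqnorm f s) mf).
- move=> n.
  have fv : finitely_valued D0 (g' n).
    have fB := finitely_valued_mem (measurable_itv `[0, +oo[) (mBJ n).
    exact: (finitely_valued_op (fun (b : bool) a => if b then a else 0) fB (sg n)).
  have [/finite_seqP[l hl] _] := fv.
  apply: (dyadic_limit_simple (l := l) (N := n) fv).
    move=> s s0; right; have : (g' n @` D0) (g' n s) by exists s => //=; rewrite in_itv/= s0.
    by rewrite hl.
  move=> s ns; rewrite /g' memNset//; move=> [_].
  by rewrite /J /= in_itv/= ltNge ns.
- exact: integrable_realZ.
- move=> n s s0; rewrite /g'; have [|_] := boolP (_ \in _); last first.
    by rewrite subr0 sqnormE ler_peMl ?sqr_ge0// ler1n.
  rewrite in_setE => -[[_ /=]]; rewrite !sqnormE => gf _.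
  rewrite (_ : 4 * hn (f s) ^+ 2 = (2 * hn (f s)) ^+ 2) in gf; last by ring.
  rewrite ler_sqr ?nnegrE ?mulr_ge0 ?hn_ge0// in gf.
  rewrite (_ : 9 * hn (f s) ^+ 2 = (3 * hn (f s)) ^+ 2); last by ring.
  rewrite ler_sqr ?nnegrE ?mulr_ge0 ?hn_ge0//.
  by have := hnD (f s) (- g n s); rewrite hnN; lra.
- move=> s s0; have Ds : D0 s by rewrite /= in_itv/= s0.
  have [f0|fn0] := eqVneq (f s) 0.
    rewrite f0 (_ : (fun n => g' n s) = fun=> 0); first exact: cvg_cst.
    apply/funext => n; rewrite /g'; have [|//] := boolP (_ \in _).
    rewrite in_setE => -[[_ /=]]; rewrite !sqnormE f0 hn0 expr0n mulr0 => g0 _.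
    apply: hn0_eq0; apply/eqP; rewrite -sqrf_eq0 eq_le g0; exact: sqr_ge0.
  have fp : 0 < hn (f s).
    rewrite lt_def hn_ge0 andbT; apply: contra_neq fn0; exact: hn0_eq0.
  have /cvg_hnP gs := cg s Ds.
  apply/cvg_hnP => e e0; have [N1 h1] := gs _ e0; have [N2 h2] := gs _ fp.
  exists (maxn (maxn N1 N2) (Num.truncn s).+1) => n.
  rewrite !geq_max => /andP[/andP[n1 n2] n3].
  rewrite /g' mem_set; first exact: h1.
  split; last first.
    rewrite /J /= in_itv/=; have /andP[_ sn] := truncn_itv s0.
    by rewrite (lt_le_trans sn)// ler_nat.
  split => //=; rewrite !sqnormE.
  rewrite (_ : 4 * hn (f s) ^+ 2 = (2 * hn (f s)) ^+ 2); last by ring.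
  rewrite ler_sqr ?nnegrE ?mulr_ge0 ?hn_ge0//.
  by have := h2 n n2; have := hnD (g n s - f s) (f s); rewrite subrK; lra.
Qed.

End Approximation.

Lemma Re_cexp (R : realType) (z : R[i]) :
  complex.Re (cexp z) = expR (complex.Re z) * cos (complex.Im z).
Proof. by rewrite /cexp ReZ. Qed.

Section ExpvDensity.
Variables (R : realType) (k : hilbertType R).
Local Notation mu := (@lebesgue_measure R).
Local Notation L2p := (L2 `[0%R, +oo[).
Local Notation D0 := ([set` `[0, +oo[%R] : set R).

(** The Cauchy-Schwarz inequality with a free parameter: choosing [eta] as the size of
[h] gives a bound of that size. *)
Lemma Rintegral_inner_le (f h : R -> k) (phi : R -> R) (eta : R) : 0 < eta ->
  L2p f -> L2p h -> mu.-integrable D0 (EFin \o phi) ->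
  (forall s, `|phi s| <= hn (f s) * hn (h s)) ->
  `|\int[mu]_(s in D0) phi s| <=
    eta * \int[mu]_(s in D0) sqnorm f s + eta^-1 * \int[mu]_(s in D0) sqnorm h s.
Proof.
move=> eta0 /L2P[mf jf] /L2P[mh jh] jphi le.
have i1 := integrable_realZ eta jf; have i2 := integrable_realZ eta^-1 jh.
apply: (le_trans (le_normr_Rintegral _ jphi)) => //.
rewrite -!RintegralZl// -RintegralD//.
apply: le_Rintegral => //.
- by have := integrable_norm jphi; apply: eq_integrable.
- exact: integrable_realD.
move=> s _; apply: (le_trans (le s)); rewrite !sqnormE.
have e1 : 0 < eta^-1 by rewrite invr_gt0.
have ee : eta * eta^-1 = 1 by rewrite divff// gt_eqF.
have : 0 <= eta^-1 * (eta * hn (f s) - hn (h s)) ^+ 2.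
  by rewrite mulr_ge0 ?sqr_ge0// ltW.
rewrite (_ : eta^-1 * _ = eta * eta^-1 * (eta * hn (f s) ^+ 2) -
   2 * (eta * eta^-1) * (hn (f s) * hn (h s)) + eta^-1 * hn (h s) ^+ 2); last by ring.
rewrite ee; have := mulr_ge0 (hn_ge0 (f s)) (hn_ge0 (h s)).
by lra.
Qed.

(** With [d = g n - f], the squared distance of the exponential vectors is a continuous
function of the scalars [<f,d>] and [<d,d>], which tend to 0. *)
Lemma expv_cvg (F : fock_space k `[0, +oo[) (f : R -> k) (g : nat -> R -> k) :
  L2p f -> (forall n, L2p (g n)) ->
  (forall n, (sqdist f (g n) < (n.+1%:R^-1 ^+ 2)%:E)%E) ->
  forall e : R, 0 < e -> exists n, hn (expv F (g n) - expv F f) < e.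
Proof.
move=> Lf Lg fg e e0.
have [mf jf] := (L2P _ _).1 Lf.
have jg n := ((L2P _ _).1 (Lg n)).2.
pose d n s := g n s - f s.
have Ld n : L2p (d n).
  apply: (L2_le (phi := fun s => 2 * sqnorm (g n) s + 2 * sqnorm f s)).
  - by apply: strongly_measurableB => //; have [] := Lg n.
  - by apply: integrable_realD; apply: integrable_realZ.
  - by move=> s _; rewrite !sqnormE -[hn (f s)]hnN; exact: hn_sq_add.
pose A : R := complex.Re (L2inner `[0, +oo[ f f).
pose B n : R := complex.Re (L2inner `[0, +oo[ (d n) (d n)).
pose p n : R := \int[mu]_(s in D0) complex.Re (inner (f s) (d n s)).
pose y n : R := complex.Im (L2inner `[0, +oo[ f (g n)).
pose eta (n : nat) : R := n.+1%:R^-1.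
have eta0 n : 0 < eta n by rewrite invr_gt0.
have A0 : 0 <= A by apply: Rintegral_ge0 => s _; exact: sqnorm_ge0.
have Bge n : 0 <= B n by apply: Rintegral_ge0 => s _; exact: sqnorm_ge0.
have Ble n : B n <= eta n ^+ 2.
  have /L2P[_ jd] := Ld n.
  rewrite -lee_fin; apply: le_trans (ltW (fg n)).
  rewrite /B /L2inner /= /Rintegral fineK; last exact: integrable_fin_num.
  rewrite le_eqVlt; apply/orP; left; apply/eqP; apply: eq_integral => s _.
  by rewrite sqnormE hnB -hn_sq.
have bnd n (phi : R -> R) : mu.-integrable D0 (EFin \o phi) ->
    (forall s, `|phi s| <= hn (f s) * hn (d n s)) ->
    `|\int[mu]_(s in D0) phi s| <= (A + 1) * eta n.
  move=> jphi le; apply: le_trans (Rintegral_inner_le (eta0 n) Lf (Ld n) jphi le) _.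
  rewrite -/(B n) -/A -[X in _ * X + _]/A -[X in _ + _ * X]/(B n).
  have h1 : (eta n)^-1 * B n <= (eta n)^-1 * eta n ^+ 2.
    by rewrite ler_wpM2l// ltW// invr_gt0.
  rewrite expr2 mulKf ?gt_eqF// in h1.
  by rewrite mulrDl mul1r [A * _]mulrC lerD2l.
have ple n : `|p n| <= (A + 1) * eta n.
  apply: bnd; first exact: integrable_Re_inner.
  by move=> s; rewrite (le_trans (Re_le_hn _))// cauchy_schwarz.
have yle n : `|y n| <= (A + 1) * eta n.
  rewrite /y /L2inner /=.
  have -> : \int[mu]_(s in D0) complex.Im (inner (f s) (g n s)) =
      \int[mu]_(s in D0) complex.Im (inner (f s) (d n s)).
    apply: eq_Rintegral => s _; rewrite /d innerBr innerxx.
    by case: (inner (f s) (g n s)) => a b /=; rewrite subr0.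
  apply: bnd; first exact: integrable_Im_inner.
  by move=> s; rewrite (le_trans (Im_le_hn _))// cauchy_schwarz.
have Refg n : complex.Re (L2inner `[0, +oo[ f (g n)) = A + p n.
  rewrite /A /p /L2inner /= -RintegralD//; last exact: integrable_Re_inner Lf (Ld n).
  by apply: eq_Rintegral => s _; rewrite -ReD -innerDr /d addrC subrK.
have Regg n : complex.Re (L2inner `[0, +oo[ (g n) (g n)) = A + 2 * p n + B n.
  have /L2P[_ jd] := Ld n; have jr := integrable_Re_inner Lf (Ld n).
  rewrite /A /p /B /L2inner /= -RintegralZl// -RintegralD//; last first.
    exact: integrable_realZ.
  rewrite -RintegralD//; last first.
    by apply: integrable_realD => //; exact: integrable_realZ.
  apply: eq_Rintegral => s _.
  have -> : g n s = f s + d n s by rewrite /d addrC subrK.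
  by rewrite -!hn_sq hn_sqD.
have eta_cvg : eta @ \oo --> (0 : R) by exact: cvg_harmonic.
have sq0 (u : nat -> R) : (forall n, `|u n| <= (A + 1) * eta n) -> u @ \oo --> (0 : R).
  move=> hu; apply/cvgr0Pnorm_lt => d0 dp.
  have A1 : 0 < A + 1 by rewrite ltr_wpDl.
  have [|N hN] := @harmonic_small R (d0 / (A + 1)); first by rewrite divr_gt0.
  exists N => // n Nn; apply: le_lt_trans (hu n) _.
  by rewrite mulrC -ltr_pdivlMr//; exact: hN.
have p0 := sq0 _ ple; have y0 := sq0 _ yle.
have B0 : B @ \oo --> (0 : R).
  apply: sq0 => n; rewrite ger0_norm//; apply: (le_trans (Ble n)).
  have e1 : eta n <= 1 by rewrite invf_le1// ler1n.
  by have := eta0 n; nra.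
pose G n := expR A - 2 * (expR (A + p n) * cos (y n)) + expR (A + 2 * p n + B n).
have G0 : G @ \oo --> (0 : R).
  rewrite [X in _ --> X](_ : (0 : R) = expR A - 2 * (expR (A + 0) * cos 0) + expR (A + 2 * 0 + 0)).
    apply: cvgD.
      apply: cvgB; first exact: cvg_cst.
      apply: cvgM; first exact: cvg_cst.
      apply: cvgM.
        apply: continuous_cvg; first exact: continuous_expR.
        by apply: cvgD => //; exact: cvg_cst.
      by apply: continuous_cvg => //; exact: continuous_cos.
    apply: continuous_cvg; first exact: continuous_expR.
    apply: cvgD => //; apply: cvgD; first exact: cvg_cst.
    by apply: cvgM => //; exact: cvg_cst.
  by rewrite cos0 mulr0 !addr0 mulr1; ring.
have e20 : 0 < e ^+ 2 by rewrite exprn_gt0.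
move/cvgr0Pnorm_lt : G0 => /(_ _ e20)[N _ hN]; exists N.
rewrite -ltr_sqr ?nnegrE ?hn_ge0// ?ltW//.
rewrite hnB hn_sq_expvB//; apply: le_lt_trans (hN N (leqnn N)).
rewrite !Re_cexp !L2inner_Im cos0 !mulr1 Refg Regg.
exact: ler_norm.
Qed.

End ExpvDensity.

Section DyadicTotal.
Variables (R : realType) (S : realization R) (h k : hilbertType R).
Local Notation "H ⊗ K" := (tensor_space (tensor S H K))
  (at level 40, left associativity).
Local Notation "u ⊠ v" := (tens (tensor S _ _) u v)
  (at level 40, left associativity).
Local Notation "'ε' f" := (expv (fock S _ _) f) (at level 10, f at level 9).

(** Approximate [f] in [L^2] and pass to exponential vectors. *)
Lemma expv_dyadic_clspan (f : R -> k) : L2 `[0, +oo[ f ->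
  clspan [set x : Fock S k | exists m g, dyadic_at m g /\ x = ε g] (ε f).
Proof.
move=> Lf V [/closed_hnP cV _ _] SV; apply: cV => e e0.
have [_ df] := dyadic_limit_L2 Lf.
have /choice[g hg] : forall n : nat, exists g, (exists m, dyadic_at m g) /\
    (sqdist f g < (n.+1%:R^-1 ^+ 2)%:E)%E.
  by move=> n; apply: df; rewrite exprn_gt0// invr_gt0.
have Lg n : L2 `[0, +oo[ (g n) by have [[m /L2_dyadic]] := hg n.
have [n hn_lt] := expv_cvg (fock S k `[0, +oo[) Lf Lg (fun n => (hg n).2) e0.
exists (ε (g n)) => //; apply: SV; have [[m dg] _] := hg n.
by exists m, (g n).
Qed.

Lemma dyadic_clspan (z : h ⊗ Fock S k) :
  clspan [set x | exists w m g, dyadic_at m g /\ x = w ⊠ ε g] z.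
Proof.
move: (tens_expv_clspan z); apply; first exact: clspan_subspace.
move=> _ [w [f [Lf ->]]]; apply: (clspan_tensr _ (expv_dyadic_clspan Lf)).
by move=> _ [m [g [dg ->]]]; apply: sub_clspan; exists w, m, g.
Qed.

End DyadicTotal.

(** * Short-time behaviour of solutions of quantum stochastic differential equations *)

Section CintegralBound.
Variable R : realType.
Local Notation C := R[i].
Local Notation mu := (@lebesgue_measure R).

Lemma fine_mu_itv0 (t : R) : 0 <= t -> fine (mu [set` `[0, t]]) = t.
Proof.
move=> t0; rewrite lebesgue_measure_itv/= lte_fin.
have [tp|] := ltP 0 t; first by rewrite -EFinB subr0.
by move=> tn; apply/eqP; rewrite eq_le t0 tn.
Qed.

Lemma Rintegral_near_cst (t : R) (phi : R -> R) (a B : R) : 0 <= t ->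
  mu.-integrable [set` `[0, t]] (EFin \o phi) ->
  (forall s, 0 <= s -> s <= t -> `|phi s - a| <= B) ->
  `|\int[mu]_(s in [set` `[0, t]]) phi s - t * a| <= t * B.
Proof.
move=> t0 jphi hB.
have mt : (mu [set` `[0%R, t]] < +oo)%E.
  by rewrite lebesgue_measure_itv/=; case: ifP; rewrite ?ltry// -EFinB ltry.
have jc (r : R) : mu.-integrable [set` `[0, t]] (EFin \o (fun=> r)).
  apply: measurable_bounded_integrable => //.
  by exists `|r|; split => // M rM x _ /=; rewrite ltW.
have le1 : \int[mu]_(s in [set` `[0, t]]) phi s <= \int[mu]_(s in [set` `[0, t]]) (a + B).
  apply: le_Rintegral => // s; rewrite /= in_itv/= => /andP[s0 st].
  by have := hB s s0 st; rewrite ler_norml => /andP[]; lra.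
have le2 : \int[mu]_(s in [set` `[0, t]]) (a - B) <= \int[mu]_(s in [set` `[0, t]]) phi s.
  apply: le_Rintegral => // s; rewrite /= in_itv/= => /andP[s0 st].
  by have := hB s s0 st; rewrite ler_norml => /andP[]; lra.
rewrite !Rintegral_cst// fine_mu_itv0// in le1 le2.
move: (\int[mu]_(s in _) phi s) le1 le2 => r le1 le2.
by rewrite ler_norml; apply/andP; split; clear -le1 le2; lra.
Qed.

Lemma Cintegral_near_cst (t : R) (phi : R -> C) (a : C) (B : R) : 0 <= t ->
  mu.-integrable [set` `[0, t]] (EFin \o (fun s => complex.Re (phi s))) ->
  mu.-integrable [set` `[0, t]] (EFin \o (fun s => complex.Im (phi s))) ->
  (forall s, 0 <= s -> s <= t -> hn (phi s - a) <= B) ->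
  hn (Cintegral [set` `[0, t]] phi - t%:C%C * a) <= 2 * (t * B).
Proof.
move=> t0 jR jI hB.
have ImB (x y : C) : complex.Im (x - y) = complex.Im x - complex.Im y.
  by case: x y => ? ? [].
apply: (le_trans (hn_le_ReIm _)); rewrite (_ : 2 * _ = t * B + t * B); last by ring.
rewrite ReB ImB ReZ (_ : complex.Im (t%:C%C * a) = t * complex.Im a); last first.
  by case: a {hB} => x y /=; rewrite mul0r addr0.
apply: lerD; apply: Rintegral_near_cst => // s s0 st.
  by rewrite -ReB (le_trans (Re_le_hn _))// hB.
by rewrite -ImB (le_trans (Im_le_hn _))// hB.
Qed.

End CintegralBound.

Section Estimate.
Variables (R : realType) (S : realization R) (h k : hilbertType R).
Local Notation C := R[i].
Local Notation mu := (@lebesgue_measure R).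
Local Notation "H ⊗ K" := (tensor_space (tensor S H K))
  (at level 40, left associativity).
Local Notation "u ⊠ v" := (tens (tensor S _ _) u v)
  (at level 40, left associativity).
Local Notation "'ε' f" := (expv (fock S _ _) f) (at level 10, f at level 9).
Local Notation L2p := (L2 `[0%R, +oo[).
Local Notation HF := (h ⊗ Fock S k).

Lemma bounded_E_op (c : k) : bounded_op (@E_op R S h k c).
Proof.
apply/bounded_opP; split.
  move=> a x y; rewrite /E_op tens_linear_l.
  by rewrite [RHS]surjective_pairing.
exists (1 + hn c); first by rewrite addr_ge0 ?hn_ge0.
move=> x; have := hsum_norm_le (E_op S c x).
rewrite !hnE -rmorphD/= lecR => /le_trans; apply.
by rewrite hn_tens mulrDl mul1r [hn c * _]mulrC.
Qed.

(** The rate at which matrix elements change while the test functions have values [c]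
and [d]. *)
Definition coefficient (F : hsum h (h ⊗ k) -> hsum h (h ⊗ k)) (c d : k) : h -> h :=
  adj (@E_op R S h k c) \o F \o @E_op R S h k d.

Lemma bounded_coefficient F c d : bounded_op F -> bounded_op (coefficient F c d).
Proof.
move=> bF; apply: bounded_op_comp; last exact: bounded_E_op.
by apply: bounded_op_comp => //; apply: bounded_adj; exact: bounded_E_op.
Qed.

Lemma inner_coefficient F c d u v :
  inner u (coefficient F c d v) = inner (E_op S c u) (F (E_op S d v)).
Proof. by rewrite /coefficient /= inner_adjr//; exact: bounded_E_op. Qed.

Lemma hn_mel (X : HF -> HF) f g v : contractive X ->
  hn (mel X f g v) <= hn (ε f : Fock S k) * hn (ε g : Fock S k) * hn v.
Proof.
move=> [_ cX]; apply: (le_trans (hn_slice _ _)); rewrite -mulrA.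
apply: ler_wpM2l; first exact: hn_ge0.
by rewrite mulrC -(hn_tens (tensor S h (Fock S k))); exact: cX.
Qed.

(** Solutions are characterised on step functions over the whole half-line. One step
function per value serves all times up to 1; its end at 2 leaves room for the closed
interval [0, 1]. *)
Definition plateau (c : k) : R -> k := fun s => if (0 <= s < 2) then c else 0.

Lemma step_plateau c : step_function (plateau c).
Proof. by exists [:: (0, 2, c)] => t; rewrite big_seq1. Qed.

Lemma L2_plateau c : L2p (plateau c).
Proof.
apply: (@L2_dyadic _ _ 0); split.
  by exists 2%N => s s2; rewrite /plateau ltNge s2 andbF.
by move=> s s0; rewrite /plateau dyadic_floor_ge0 s0 (dyadic_floor_ltn _ 2)//.
Qed.

Lemma L2inner_cst (t : R) (f g : R -> k) (c d : k) : 0 <= t ->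
  (forall s, 0 <= s -> s < t -> f s = c) -> (forall s, 0 <= s -> s < t -> g s = d) ->
  L2inner `[0, t[ f g = t%:C%C * inner c d.
Proof.
move=> t0 fc gd; rewrite /L2inner.
rewrite (@eq_Cintegral _ _ _ (fun=> inner c d)); last first.
  by move=> s /=; rewrite in_itv/= => /andP[s0 st]; rewrite fc// gd.
have mt : fine (mu [set` `[0, t[]) = t.
  rewrite lebesgue_measure_itv/= lte_fin.
  have [tp|] := ltP 0 t; first by rewrite -EFinB subr0.
  by move=> tn; apply/eqP; rewrite eq_le t0 tn.
rewrite /Cintegral !Rintegral_cst// mt.
case: (inner c d) => x y /=.
by congr Complex; rewrite mulrC mul0r ?subr0 ?addr0.
Qed.

Section Solution.
Variables (F : hsum h (h ⊗ k) -> hsum h (h ⊗ k)) (U : R -> HF -> HF).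
Hypotheses (bF : bounded_op F) (qU : qsde F U)
  (cU : forall t, 0 <= t -> contractive (U t)) (aU : forall t, 0 <= t -> mel_adapted t (U t)).

(** Strong continuity makes the integrand measurable and contractivity bounds it. *)
Lemma integrable_qsde (t : R) (x y : HF) : 0 <= t ->
  mu.-integrable [set` `[0, t]] (EFin \o (fun s => complex.Re (inner x (U s y)))) /\
  mu.-integrable [set` `[0, t]] (EFin \o (fun s => complex.Im (inner x (U s y)))).
Proof.
move=> t0; have [_ sc _] := qU.
have mt : (mu [set` `[0%R, t]] < +oo)%E.
  by rewrite lebesgue_measure_itv/=; case: ifP; rewrite ?ltry// -EFinB ltry.
have sub : [set` `[0, t]] `<=` ([set` `[0, +oo[] : set R).
  by move=> s /=; rewrite !in_itv/= => /andP[->].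
have key (phi : C -> R) : (forall z w, `|phi z - phi w| <= hn (z - w)) ->
    (forall z, `|phi z| <= hn z) ->
    mu.-integrable [set` `[0, t]] (EFin \o (fun s => phi (inner x (U s y)))).
  move=> lip ble.
  apply: measurable_bounded_integrable => //.
    apply: subspace_continuous_measurable_fun; first exact: measurable_itv.
    have cy := continuous_subspaceW sub (sc y).
    move=> s; apply/cvgrPdist_lt => e e0.
    have x1 : 0 < hn x + 1 by rewrite ltr_wpDl ?hn_ge0.
    have ex : 0 < (e / (hn x + 1))%:C%C :> C by rewrite ltcR divr_gt0.
    have /cvgrPdist_lt/(_ _ ex) := cy s.
    apply: filterS => r; rewrite hnE ltcR ltr_pdivlMr// => hr.
    apply: le_lt_trans (lip _ _) _; rewrite -innerBr.
    apply: le_lt_trans (cauchy_schwarz _ _) _.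
    have := hn_ge0 x; have := hn_ge0 (U s y - U r y); by nra.
  exists (hn x * hn y); split; first exact: num_real.
  move=> M hM s /=; rewrite in_itv/= => /andP[s0 _].
  apply: le_trans (ltW hM); apply: (le_trans (ble _)).
  apply: (le_trans (cauchy_schwarz _ _)); apply: ler_wpM2l; first exact: hn_ge0.
  by have [_] := cU s0; apply.
split; apply: key.
- by move=> z w; rewrite -ReB Re_le_hn.
- exact: Re_le_hn.
- move=> z w; rewrite (_ : _ - _ = complex.Im (z - w)) ?Im_le_hn//.
  by case: z w => ? ? [].
- exact: Im_le_hn.
Qed.

Section Constants.
Variables c d : k.
Local Notation f0 := (plateau c).
Local Notation g0 := (plateau d).
Local Notation A := (coefficient F c d).
Local Notation K := (hn (ε f0 : Fock S k) * hn (ε g0 : Fock S k)).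
Local Notation e0 := (cexp (L2inner `[0, +oo[ f0 g0)).

Lemma qsde_plateau (t : R) (u v : h) : 0 <= t -> t <= 1 ->
  inner u (mel (U t) f0 g0 v - e0 *: v) =
  Cintegral [set` `[0, t]] (fun s => inner u (mel (U s) f0 g0 (A v))).
Proof.
move=> t0 t1; have [_ _ /(_ t t0 u v f0 g0 (step_plateau c) (step_plateau d)) e] := qU.
have eE := expv_inner (fock S k `[0, +oo[) (L2_plateau c) (L2_plateau d).
rewrite innerBr tens_inner eE in e.
rewrite innerBr innerZr inner_mel [e0 * _]mulrC e; apply: eq_Cintegral => s /=.
rewrite in_itv/= => /andP[s0 st]; rewrite inner_mel.
have s2 : s < 2 by rewrite (le_lt_trans st)// (le_lt_trans t1)// ltr1n.
by rewrite /plateau s0 s2.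
Qed.

(** Testing the equation against the difference itself turns a bound on matrix elements
into a bound on vectors. *)
Lemma qsde_near_cst (t B : R) (v w : h) : 0 <= t -> t <= 1 ->
  (forall s, 0 <= s -> s <= t -> hn (mel (U s) f0 g0 (A v) - w) <= B) ->
  hn (mel (U t) f0 g0 v - e0 *: v - t%:C%C *: w) <= 2 * (t * B).
Proof.
move=> t0 t1 hB; set x := _ - t%:C%C *: w.
have [x0|xn0] := eqVneq (hn x) 0.
  by rewrite x0 !mulr_ge0// (le_trans (hn_ge0 _) (hB 0 (lexx _) t0)).
have xp : 0 < hn x by rewrite lt_def xn0 hn_ge0.
rewrite -(ler_pM2l xp) -expr2 hn_sq {2}/x innerBr qsde_plateau// innerZr.
apply: (le_trans (ler_norm _)); apply: (le_trans (Re_le_hn _)).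
rewrite (_ : hn x * _ = 2 * (t * (hn x * B))); last by ring.
have [jR jI] := integrable_qsde (x ⊠ ε f0) (A v ⊠ ε g0) t0.
apply: Cintegral_near_cst => //.
- by apply: eq_integrable jR => // s _ /=; rewrite inner_mel.
- by apply: eq_integrable jI => // s _ /=; rewrite inner_mel.
move=> s s0 st; rewrite -innerBr; apply: (le_trans (cauchy_schwarz _ _)).
by apply: ler_wpM2l; [exact: hn_ge0|exact: hB].
Qed.

(** Two Picard iterations: a bounded integrand gives an increment of order [t], and then
the integrand is within order [t] of its initial value. *)
Lemma qsde_plateau_estimate : exists2 B : R, 0 <= B &
  forall t v, 0 <= t -> t <= 1 ->
  hn (mel (U t) f0 g0 v - e0 *: (v + t%:C%C *: A v)) <= B * t ^+ 2 * hn v.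
Proof.
have /bounded_opP[lA [M M0 hM]] := bounded_coefficient c d bF.
have K0 : 0 <= K by rewrite mulr_ge0 ?hn_ge0.
have step1 s v : 0 <= s -> s <= 1 ->
    hn (mel (U s) f0 g0 v - e0 *: v) <= 2 * (s * (K * M * hn v)).
  move=> s0 s1; have := @qsde_near_cst s (K * M * hn v) v 0 s0 s1.
  rewrite scaler0 subr0; apply=> r r0 rs; rewrite subr0.
  apply: (le_trans (hn_mel _ _ _ (cU r0))); rewrite -[leRHS]mulrA; exact: ler_wpM2l.
exists (4 * K * M ^+ 2); first by rewrite !mulr_ge0 ?hn_ge0 ?sqr_ge0.
move=> t v t0 t1.
have := @qsde_near_cst t (2 * (t * (K * M * (M * hn v)))) v (e0 *: A v) t0 t1.
move=> h1; rewrite scalerDr !scalerA (mulrC e0) opprD addrA -[(_ * e0) *: A v]scalerA.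
apply: le_trans (h1 _) _; last by rewrite le_eqVlt; apply/orP; left; apply/eqP; ring.
move=> s s0 st; apply: (le_trans (step1 s (A v) s0 (le_trans st t1))).
apply: ler_wpM2l => //; apply: ler_pM => //.
- by rewrite !mulr_ge0 ?hn_ge0.
- by apply: ler_wpM2l; [rewrite mulr_ge0|exact: hM].
Qed.

(** Adaptedness lets the plateaus be cut off at [t], at the price of dividing by their
overlap after [t], which is bounded below for [t <= 1]. *)
Lemma qsde_estimate : exists2 B : R, 0 <= B &
  forall (t : R) f g v, 0 <= t -> t <= 1 -> L2p f -> L2p g ->
  (forall s, 0 <= s -> s < t -> f s = c) -> (forall s, 0 <= s -> s < t -> g s = d) ->
  hn (mel (U t) (splice t f (fun=> 0)) (splice t g (fun=> 0)) v -
      cexp (t%:C%C * inner c d) *: (v + t%:C%C *: A v)) <= B * t ^+ 2 * hn v.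
Proof.
have [B B0 hB] := qsde_plateau_estimate.
have L0 := L2_zero k `[0, +oo[.
pose b := expR (`|complex.Re (inner c d)|) / hn e0.
have e0p : 0 < hn e0 by rewrite hn_cexp expR_gt0.
have b0 : 0 <= b by rewrite divr_ge0 ?expR_ge0 ?hn_ge0.
exists (b * B); first exact: mulr_ge0.
move=> t f g v t0 t1 Lf Lg fc gd.
have lt2 s : s < t -> s < 2 by move=> st; rewrite (lt_le_trans st)// (le_trans t1)// ler1n.
have pl (q : R -> k) a s : (forall s, 0 <= s -> s < t -> q s = a) -> 0 <= s ->
    splice t q (fun=> 0) s = splice t (plateau a) (fun=> 0) s.
  move=> qa s0; rewrite /splice /plateau s0; case: (ltP s t) => // st.
  by rewrite lt2// qa.
rewrite (@mel_eq _ _ _ _ (U t) _ _ (splice t f0 (fun=> 0)) (splice t g0 (fun=> 0)));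
  [|exact: L2_spliceT|exact: L2_spliceT|by move=> s; exact: pl|by move=> s; exact: pl].
have Lc := L2_plateau c; have Ld := L2_plateau d.
set E := cexp (L2inner `[t, +oo[ f0 g0).
have cdE : cexp (t%:C%C * inner c d) = cexp (L2inner `[0, t[ f0 g0).
  by rewrite (@L2inner_cst t f0 g0 c d)// => s s0 st; rewrite /plateau s0 lt2.
have e0E : e0 = cexp (t%:C%C * inner c d) * E.
  by rewrite (L2inner_split t0 Lc Ld) cexpD cdE.
have := hB t v t0 t1; rewrite (aU t0 v Lc Ld) -/E e0E [_ * E]mulrC -[(E * _) *: _]scalerA -scalerBr hnZ => hE.
have Ep : 0 < hn E by rewrite hn_cexp expR_gt0.
rewrite -(ler_pM2l Ep); apply: le_trans hE _.
have bE : 1 <= hn E * b.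
  rewrite /b mulrCA -[X in _ <= X]mulrC e0E hnM.
  have cp : 0 < hn (cexp (t%:C%C * inner c d)) by rewrite hn_cexp expR_gt0.
  rewrite invfM mulrA mulrAC divff ?gt_eqF// mul1r mulrC ler_pdivlMr// mul1r.
  rewrite hn_cexp ler_expR ReZ (le_trans (ler_norm _))// normrM ger0_norm//.
  by rewrite ler_piMl.
rewrite (_ : hn E * _ = (hn E * b) * (B * t ^+ 2 * hn v)); last by ring.
by apply: ler_peMl => //; rewrite !mulr_ge0 ?sqr_ge0 ?hn_ge0.
Qed.

End Constants.
End Solution.
End Estimate.

(** * Generators of the product *)

Section SumOperators.
Variable R : realType.
Local Notation C := R[i].
Implicit Types H K : hilbertType R.

Lemma inner_hsum H K (x y : hsum H K) : inner x y = inner x.1 y.1 + inner x.2 y.2.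
Proof. by []. Qed.

Lemma bounded_fst H K : bounded_op (fun x : hsum H K => x.1).
Proof.
apply/bounded_opP; split => //; exists 1 => // x; rewrite mul1r.
by have := hsum_norm_fst x; rewrite !hnE lecR.
Qed.

Lemma bounded_snd H K : bounded_op (fun x : hsum H K => x.2).
Proof.
apply/bounded_opP; split => //; exists 1 => // x; rewrite mul1r.
by have := hsum_norm_snd x; rewrite !hnE lecR.
Qed.

Lemma bounded_pair H K1 K2 (A : H -> K1) (B : H -> K2) :
  bounded_op A -> bounded_op B -> bounded_op (fun x => (A x, B x) : hsum K1 K2).
Proof.
move=> /bounded_opP[lA [M M0 hM]] /bounded_opP[lB [N N0 hN]].
apply/bounded_opP; split; first by move=> a x y; rewrite lA lB.
exists (M + N); first exact: addr_ge0.
move=> x; have := hsum_norm_le ((A x, B x) : hsum K1 K2).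
rewrite !hnE -rmorphD/= lecR => /le_trans; apply.
by rewrite mulrDl lerD.
Qed.

Lemma bounded_row H K1 K2 (A : K1 -> H) (B : K2 -> H) :
  bounded_op A -> bounded_op B -> bounded_op (row_op A B).
Proof.
move=> bA bB.
exact: (bounded_opD (bounded_op_comp bA (@bounded_fst K1 K2))
                    (bounded_op_comp bB (@bounded_snd K1 K2))).
Qed.

Lemma bounded_block H K (A : H -> H) (B : K -> H) (C : H -> K) (D : K -> K) :
  bounded_op A -> bounded_op B -> bounded_op C -> bounded_op D ->
  bounded_op (block_op A B C D).
Proof.
move=> bA bB bC bD.
exact: (bounded_pair (bounded_row bA bB) (bounded_row bC bD)).
Qed.

Lemma bounded_dsum H K H' K' (A : H -> H') (B : K -> K') :
  bounded_op A -> bounded_op B -> bounded_op (dsum_op A B).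
Proof.
move=> bA bB.
exact: (bounded_pair (bounded_op_comp bA (@bounded_fst H K))
                     (bounded_op_comp bB (@bounded_snd H K))).
Qed.

Lemma bounded_subid H (W : H -> H) : bounded_op W -> bounded_op (W \- id).
Proof.
by move=> bW; apply: bounded_opD bW (bounded_opN (bounded_op_id H)).
Qed.

End SumOperators.

Section Generators.
Variables (R : realType) (S : realization R).
Local Notation C := R[i].
Local Notation "H ⊗ K" := (tensor_space (tensor S H K))
  (at level 40, left associativity).
Local Notation "u ⊠ v" := (tens (tensor S _ _) u v)
  (at level 40, left associativity).

Lemma unitarity_bounded (h k : hilbertType R)
    (K : h -> h) (M : h ⊗ k -> h) (L : h -> h ⊗ k) (W : h ⊗ k -> h ⊗ k) :
  unitarity_relations K M L W ->
  [/\ bounded_op K, bounded_op M, bounded_op L & bounded_op W].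
Proof.
move=> [bL [bW _ _] ME [H [bH _] KE]].
have bL' := bounded_adj bL; split => //.
- have -> : K = (fun v => 'i%C *: H v) \+ (fun v => - (2^-1 *: adj L (L v))).
    by apply/funext => v; rewrite KE.
  apply: bounded_opD; first exact: bounded_opZ.
  apply: bounded_opN; apply: bounded_opZ.
  exact: (bounded_op_comp bL' bL).
- have -> : M = (fun x => - (adj L \o W) x) by apply/funext => x; rewrite ME.
  by apply: bounded_opN; exact: bounded_op_comp.
Qed.

Section TwoNoises.
Variables h k1 k2 : hilbertType R.
Local Notation k12 := (hsum k1 k2).
Local Notation Dop := (@distr_op R S h k1 k2).

Lemma distr_spec : isometric Dop /\
  forall v c, Dop (v ⊠ c) = ((v ⊠ c.1, v ⊠ c.2) : hsum (h ⊗ k1) (h ⊗ k2)).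
Proof.
have [|[u c] [v d] _ _|iT hT] := @isometric_extension R (h * k12)%type (h ⊗ k12)
  (hsum (h ⊗ k1) (h ⊗ k2)) setT (fun p => p.1 ⊠ p.2)
  (fun p => (p.1 ⊠ p.2.1, p.1 ⊠ p.2.2) : hsum (h ⊗ k1) (h ⊗ k2)).
- exact: tens_total.
- by rewrite /= inner_hsum /= !tens_inner -mulrDr.
- by split => // v c; exact: (hT (v, c)).
Qed.

Variables (K1 : h -> h) (M1 : h ⊗ k1 -> h) (L1 : h -> h ⊗ k1) (W1 : h ⊗ k1 -> h ⊗ k1).
Variables (K2 : h -> h) (M2 : h ⊗ k2 -> h) (L2 : h -> h ⊗ k2) (W2 : h ⊗ k2 -> h ⊗ k2).
Local Notation F1 := (block_op K1 M1 L1 W1).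
Local Notation F2 := (block_op K2 M2 L2 W2).
Local Notation F := (undistr (block_op (K1 \+ K2) (row_op M1 M2) (col_op L1 L2)
                            (dsum_op W1 W2))).

Lemma bounded_undistr (G : hsum h (hsum (h ⊗ k1) (h ⊗ k2)) ->
    hsum h (hsum (h ⊗ k1) (h ⊗ k2))) : bounded_op G -> bounded_op (undistr G).
Proof.
move=> bG; have bD : bounded_op (dsum_op (@id h) Dop).
  by apply: bounded_dsum; [exact: bounded_op_id|exact: distr_spec.1.1].
exact: (bounded_op_comp (bounded_op_comp (bounded_adj bD) bG) bD).
Qed.

(** The block matrix has no entries scattering one noise into the other, so [E_c^* F E_d]
is a sum over the noises. *)
Lemma coefficient_undistr (c d : k12) v :
  coefficient F c d v = coefficient F1 c.1 d.1 v + coefficient F2 c.2 d.2 v.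
Proof.
have bD : bounded_op (dsum_op (@id h) Dop).
  by apply: bounded_dsum; [exact: bounded_op_id|exact: distr_spec.1.1].
apply: inner_ext => u; rewrite innerDr !inner_coefficient.
rewrite /undistr /= inner_adjr// /dsum_op /E_op /= !distr_spec.2.
rewrite /block_op /row_op /col_op /dsum_op /= !inner_hsum /=.
by rewrite !innerDr; ring.
Qed.

End TwoNoises.
End Generators.

(** Second-order agreement of a product of two first-order expansions with a
single expansion whose generator is the sum. *)
Section ProductExpansion.
Variables (R : realType) (H : hilbertType R).
Local Notation C := R[i].
Variables (F1 F2 : H -> H) (M1 M2 A1 A2 B1 B2 B3 : R).
Hypothesis l1 : linear F1.
Hypotheses (M10 : 0 <= M1) (M20 : 0 <= M2).
Hypotheses (F1le : forall x, hn (F1 x) <= M1 * hn x) (F2le : forall x, hn (F2 x) <= M2 * hn x).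
Hypotheses (B10 : 0 <= B1) (B20 : 0 <= B2).
Variables (P1 P2 P : H -> H) (a1 a2 : C) (t : R).
Hypotheses (t0 : 0 <= t) (t1 : t <= 1) (a1le : hn a1 <= A1) (a2le : hn a2 <= A2).
Hypothesis P1le : forall v, hn (P1 v - a1 *: (v + t%:C%C *: F1 v)) <= B1 * t ^+ 2 * hn v.
Hypothesis P2le : forall v, hn (P2 v - a2 *: (v + t%:C%C *: F2 v)) <= B2 * t ^+ 2 * hn v.
Hypothesis Ple : forall v,
  hn (P v - (a1 * a2) *: (v + t%:C%C *: (F1 v + F2 v))) <= B3 * t ^+ 2 * hn v.

Let hn_shift (G : H -> H) (M : R) x : 0 <= M -> hn (G x) <= M * hn x ->
  hn (x + t%:C%C *: G x) <= (1 + M) * hn x.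
Proof.
move=> M0 Gx; apply: (le_trans (hnD _ _)); rewrite hnZ hn_real// mulrDl mul1r lerD2l.
apply: le_trans Gx; apply: ler_piMl => //; exact: hn_ge0.
Qed.

Lemma product_expansion v : hn (P1 (P2 v) - P v) <=
  (B1 * (A2 * (1 + M2) + B2) + A1 * ((1 + M1) * B2) + A1 * A2 * (M1 * M2) + B3)
  * t ^+ 2 * hn v.
Proof.
pose T (G : H -> H) x := x + t%:C%C *: G x.
pose w := P2 v; pose v' := a2 *: T F2 v.
have hv := hn_ge0 v.
have t20 : 0 <= t ^+ 2 by exact: sqr_ge0.
have t21 : t ^+ 2 <= 1 by rewrite exprn_ile1.
have TB (x y : H) : T F1 x - T F1 y = T F1 (x - y).
  by rewrite /T (opB l1) scalerBr opprD addrACA.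
have w_le : hn w <= (A2 * (1 + M2) + B2) * hn v.
  have h1 := P2le v; rewrite -/(T F2 v) -/v' -/w in h1.
  have h2 : hn v' <= A2 * ((1 + M2) * hn v).
    by rewrite hnZ ler_pM ?hn_ge0// hn_shift.
  have h3 := hnD (w - v') v'; rewrite subrK in h3.
  have h4 : B2 * t ^+ 2 * hn v <= B2 * hn v.
    by rewrite ler_wpM2r// ler_piMr.
  by rewrite mulrDl -mulrA; lra.
have e1 : hn (P1 w - a1 *: T F1 w) <= B1 * (A2 * (1 + M2) + B2) * t ^+ 2 * hn v.
  apply: (le_trans (P1le w)).
  rewrite (_ : B1 * _ * _ * _ = B1 * t ^+ 2 * ((A2 * (1 + M2) + B2) * hn v)); last by ring.
  by apply: ler_wpM2l => //; exact: mulr_ge0.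
have e2 : hn (a1 *: T F1 w - a1 *: T F1 v') <= A1 * ((1 + M1) * B2) * t ^+ 2 * hn v.
  rewrite -scalerBr hnZ TB.
  have h1 := P2le v; rewrite -/(T F2 v) -/v' -/w in h1.
  rewrite (_ : A1 * _ * _ * _ = A1 * ((1 + M1) * (B2 * t ^+ 2 * hn v))); last by ring.
  apply: ler_pM; rewrite ?hn_ge0//.
  apply: (le_trans (hn_shift M10 (F1le _))); apply: ler_wpM2l => //.
  by rewrite addr_ge0.
have e3 : hn (a1 *: T F1 v' - (a1 * a2) *: (v + t%:C%C *: (F1 v + F2 v))) <=
    A1 * A2 * (M1 * M2) * t ^+ 2 * hn v.
  have -> : a1 *: T F1 v' - (a1 * a2) *: (v + t%:C%C *: (F1 v + F2 v)) =
      (a1 * a2) *: ((t%:C%C * t%:C%C) *: F1 (F2 v)).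
    have TZ x : T F1 (a2 *: x) = a2 *: T F1 x.
      by rewrite /T (opZ l1) scalerA (mulrC _ a2) -scalerA -scalerDr.
    rewrite /v' TZ scalerA -scalerBr; congr (_ *: _).
    rewrite /T (opD l1) (opZ l1).
    rewrite !scalerDr scalerA; move: (_ *: F1 (F2 v)) (_ *: F1 v) (_ *: F2 v) => x y z.
    apply: (addIr (v + (y + z))); rewrite subrK [RHS]addrC -!addrA.
    by congr (_ + _); rewrite addrCA.
  rewrite !hnZ !hnM hn_real//.
  rewrite (_ : A1 * A2 * _ * _ * _ = (A1 * A2) * (t * t * (M1 * (M2 * hn v)))); last by ring.
  apply: ler_pM; rewrite ?mulr_ge0 ?hn_ge0//; first by rewrite ler_pM ?hn_ge0.
  apply: ler_wpM2l; first exact: mulr_ge0.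
  by apply: (le_trans (F1le _)); rewrite ler_wpM2l.
have e4 := Ple v; rewrite hnB in e4.
pose b := a1 *: T F1 w; pose c := a1 *: T F1 v'.
pose d := (a1 * a2) *: (v + t%:C%C *: (F1 v + F2 v)).
have h1 := hn_dist (P1 w) b (P v); have h2 := hn_dist b c (P v).
have h3 := hn_dist c d (P v).
rewrite !mulrDl; move: e1 e2 e3 e4 h1 h2 h3; rewrite -/b -/c -/d -/w.
rewrite !mulrDl; by lra.
Qed.

End ProductExpansion.

(** * Weak convergence of contractions to an isometry *)

Section WeakToStrong.
Variables (R : realType) (H : hilbertType R).

(** For contractions, [|T x - A x|^2 <= 2 |x|^2 - 2 Re <A x, T x>], which tends to 0 as
soon as [T x] converges weakly to [A x]. *)
Lemma weak_to_strong (T : nat -> H -> H) (A : H -> H) (Q : set H) :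
  (forall n, contractive (T n)) -> isometric A -> (forall x, clspan Q x) ->
  (forall x y, Q x -> Q y -> forall e : R, 0 < e ->
     exists N, forall n, (N <= n)%N -> hn (inner y (T n x) - inner y (A x)) < e) ->
  forall x, (fun n => T n x) @ \oo --> A x.
Proof.
move=> cT iA gQ hQ.
have lT n : linear (T n) by have [/bounded_opP[]] := cT n.
have lA : linear A by have [/bounded_opP[]] := iA.
have weak x : Q x -> forall y, forall e : R, 0 < e ->
    exists N, forall n, (N <= n)%N -> hn (inner y (T n x) - inner y (A x)) < e.
  move=> Qx y; apply: (gQ y [set y | forall e : R, 0 < e ->
    exists N, forall n, (N <= n)%N -> hn (inner y (T n x) - inner y (A x)) < e]);
    last by move=> z Qz; exact: hQ.
  split.
  - apply/closed_hnP => z hz e e0 /=.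
    have P0 : 0 < 2 * hn x + 1 by rewrite ltr_wpDl// mulr_ge0 ?hn_ge0.
    have d0 : 0 < e / 2 / (2 * hn x + 1) by rewrite !divr_gt0.
    have [z' hz' zz] := hz _ d0; have e20 : 0 < e / 2 by rewrite divr_gt0.
    have [N hN] := hz' _ e20; exists N => n /hN h1.
    rewrite -!innerBr in h1 *.
    have h2 := cauchy_schwarz (z' - z) (T n x - A x).
    have h3 : hn (T n x - A x) <= 2 * hn x.
      apply: (le_trans (hnD _ _)); rewrite hnN (isometric_hn _ iA) mulrDl !mul1r lerD2r.
      exact: (cT n).2.
    have h4 := hnD (inner z' (T n x - A x)) (- inner (z' - z) (T n x - A x)).
    rewrite hnN -innerBl opprB addrCA subrr addr0 in h4.
    move: zz; rewrite ltr_pdivlMr// => zz.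
    have p := hn_ge0 (z' - z); have p' := hn_ge0 (T n x - A x).
    have h5 : hn (z' - z) * hn (T n x - A x) <= hn (z' - z) * (2 * hn x).
      by rewrite ler_wpM2l.
    by clear -h1 h2 h4 h5 zz p; nra.
  - by move=> e e0; exists 0%N => n _; rewrite !inner0l subrr hn0.
  - move=> a u v hu hv e e0.
    have a0 : 0 < hn a + 1 by rewrite ltr_wpDl ?hn_ge0.
    have d0 : 0 < e / 2 / (hn a + 1) by rewrite !divr_gt0.
    have e20 : 0 < e / 2 by rewrite divr_gt0.
    have [N1 h1] := hu _ d0; have [N2 h2] := hv _ e20.
    exists (maxn N1 N2) => n; rewrite geq_max => /andP[/h1 n1 /h2 n2].
    rewrite -!innerBr in n1 n2 *; rewrite innerDl innerZl.
    apply: le_lt_trans (hnD _ _) _; rewrite hnM hn_conj.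
    move: n1; rewrite ltr_pdivlMr//; have := hn_ge0 (inner u (T n x - A x)).
    by have := hn_ge0 a; move: n2; clear; nra.
have strong x : Q x -> (fun n => T n x) @ \oo --> A x.
  move=> Qx; apply/cvg_hnP => e e0.
  have e20 : 0 < e ^+ 2 / 2 by rewrite divr_gt0// exprn_gt0.
  have [N hN] := weak x Qx (A x) _ e20; exists N => n /hN h1.
  rewrite -ltr_sqr ?nnegrE ?hn_ge0// ?ltW// hn_sqB.
  rewrite -innerBr in h1.
  have h2 := Re_le_hn (inner (A x) (T n x - A x)); rewrite ler_norml in h2.
  move/andP: h2 => [h2 _]; rewrite innerBr ReB -hn_sq Re_inner_sym in h2.
  have h3 := (cT n).2 x; rewrite (isometric_hn _ iA) in h2 *.
  have h4 : hn (T n x) ^+ 2 <= hn x ^+ 2 by rewrite ler_sqr ?nnegrE ?hn_ge0.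
  rewrite innerBr in h1.
  by move: h1 h2 h4; rewrite -innerBr; clear; lra.
move=> x; apply: (gQ x [set x | (fun n => T n x) @ \oo --> A x]) => //.
split.
- apply/closed_hnP => z hz /=; apply/cvg_hnP => e e0.
  have e30 : 0 < e / 3 by rewrite divr_gt0.
  have [z' /cvg_hnP/(_ _ e30)[N hN] zz] := hz _ e30.
  exists N => n /hN h1.
  have h2 := hn_dist (T n z) (T n z') (A z); have h3 := hn_dist (T n z') (A z') (A z).
  have h4 : hn (T n z - T n z') <= hn (z' - z).
    by rewrite hnB -(opB (lT n)); exact: (cT n).2.
  have h5 : hn (A z' - A z) <= hn (z' - z) by rewrite -(opB lA) (isometric_hn _ iA).
  by move: h1 h2 h3 h4 h5 zz; clear; lra.
- rewrite /= (op0 lA); under eq_fun do rewrite (op0 (lT _)); exact: cvg_cst.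
- move=> a u v hu hv /=; rewrite lA; under eq_fun do rewrite lT.
  by apply: cvgD => //; apply: cvgZr.
Qed.

End WeakToStrong.

(** * Time evolution of matrix elements *)

Section Cocycles.
Variables (R : realType) (S : realization R) (h k : hilbertType R).
Local Notation C := R[i].
Local Notation "H ⊗ K" := (tensor_space (tensor S H K))
  (at level 40, left associativity).
Local Notation "u ⊠ v" := (tens (tensor S _ _) u v)
  (at level 40, left associativity).
Local Notation "'ε' f" := (expv (fock S _ _) f) (at level 10, f at level 9).
Local Notation L2p := (L2 `[0%R, +oo[).
Local Notation HF := (h ⊗ Fock S k).
Local Notation z0 := (fun=> 0 : k).

Lemma cocycle_isometric (U : R -> HF -> HF) t :
  unitary_cocycle U -> 0 <= t -> isometric (U t).
Proof. by move=> [[_ uU] _ _] t0; apply: unitary_isometric; exact: uU. Qed.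

Lemma cocycle_contractive (U : R -> HF -> HF) t :
  unitary_cocycle U -> 0 <= t -> contractive (U t).
Proof. by move=> hU t0; apply: isometric_contractive; exact: cocycle_isometric. Qed.

Lemma mel_adapted_cocycle (U : R -> HF -> HF) t : unitary_cocycle U -> 0 <= t -> mel_adapted t (U t).
Proof. by move=> [[bU _] _ _] t0; apply: adapted_mel_adapted => //; have [] := bU t t0. Qed.

(** The matrix elements of a cocycle form a two-parameter evolution. *)
Lemma mel_cocycle (U : R -> HF -> HF) s r f g v : unitary_cocycle U ->
  0 <= s -> 0 <= r -> L2p f -> L2p g ->
  mel (U (s + r)) f g v =
  mel (U s) (splice s f z0) (splice s g z0) (mel (U r) (unshift s f) (unshift s g) v).
Proof.
move=> hU s0 r0 Lf Lg; have L0 := L2_zero k `[0, +oo[.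
have [bs _] := cocycle_contractive hU s0; have [br _] := cocycle_contractive hU r0.
have [_ _ ->//] := hU.
rewrite (mel_mul _ s0 bs (mel_adapted_cocycle hU s0) (future_time_shift s0 br) Lf Lg).
congr (mel _ _ _ _); rewrite mel_time_shift//; last exact: L2_spliceT.
rewrite (_ : L2inner _ _ _ = 0) ?cexp0 ?scale1r; last first.
  rewrite -(L2inner0l `[0, s[ g); apply: eq_L2inner => // q; exact: splice_past.
apply: mel_eq.
- by apply: L2_unshift => //; exact: L2_spliceT.
- exact: L2_unshift.
- by move=> q q0; rewrite /unshift /splice ltNge lerDr q0.
- by [].
Qed.

Lemma hn_expv_le (f f' : R -> k) : L2p f -> L2p f' ->
  (forall s, 0 <= s -> hn (f' s) <= hn (f s)) ->
  hn (ε f' : Fock S k) <= hn (ε f : Fock S k).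
Proof.
move=> Lf Lf' le; rewrite -ler_sqr ?nnegrE ?hn_ge0// !hn_expv// ler_expR.
have /L2P[_ jf] := Lf; have /L2P[_ jf'] := Lf'.
apply: le_Rintegral => // s; rewrite /= in_itv/= andbT => s0.
by rewrite -!hn_sq ler_sqr ?nnegrE ?hn_ge0// le.
Qed.

Lemma hn_expv_past t f : 0 <= t -> L2p f ->
  hn (ε (splice t f z0) : Fock S k) <= hn (ε f : Fock S k).
Proof.
move=> t0 Lf; have L0 := L2_zero k `[0, +oo[; apply: hn_expv_le => //.
  exact: L2_spliceT.
by move=> s _; rewrite /splice; case: ifP => // _; rewrite hn0 hn_ge0.
Qed.

Lemma hn_expv_future t f : 0 <= t -> L2p f ->
  hn (ε (splice t z0 f) : Fock S k) <= hn (ε f : Fock S k).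
Proof.
move=> t0 Lf; have L0 := L2_zero k `[0, +oo[; apply: hn_expv_le => //.
  exact: L2_spliceT.
by move=> s _; rewrite /splice; case: ifP => // _; rewrite hn0 hn_ge0.
Qed.

Lemma hn_expv_unshift t f : 0 <= t -> L2p f ->
  hn (ε (unshift t f) : Fock S k) <= hn (ε f : Fock S k).
Proof.
move=> t0 Lf; have L0 := L2_zero k `[0, +oo[.
apply: le_trans (hn_expv_future t0 Lf).
rewrite -ler_sqr ?nnegrE ?hn_ge0// !hn_expv; [|exact: L2_spliceT|exact: L2_unshift].
rewrite ler_expR L2inner_splice// L2inner0l add0r.
by rewrite [X in complex.Re X <= _]L2inner_unshift// addr0.
Qed.

(** The overlap after [t] is itself an inner product of exponential vectors. *)
Lemma hn_cexp_future t f g : 0 <= t -> L2p f -> L2p g ->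
  hn (cexp (L2inner `[t, +oo[ f g)) <= hn (ε f : Fock S k) * hn (ε g : Fock S k).
Proof.
move=> t0 Lf Lg; have L0 := L2_zero k `[0, +oo[.
have <- : inner (ε (splice t z0 f)) (ε (splice t z0 g) : Fock S k) =
    cexp (L2inner `[t, +oo[ f g).
  rewrite expv_inner; [|exact: L2_spliceT|exact: L2_spliceT].
  by rewrite L2inner_splice// L2inner0l add0r.
apply: (le_trans (cauchy_schwarz _ _)); apply: ler_pM; rewrite ?hn_ge0//.
  exact: hn_expv_future.
exact: hn_expv_future.
Qed.

End Cocycles.

(** * Telescoping along the mesh *)

Section Trotter.
Variables (R : realType) (S : realization R) (h k1 k2 : hilbertType R).
Local Notation C := R[i].
Local Notation "H ⊗ K" := (tensor_space (tensor S H K))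
  (at level 40, left associativity).
Local Notation "u ⊠ v" := (tens (tensor S _ _) u v)
  (at level 40, left associativity).
Local Notation "'ε' f" := (expv (fock S _ _) f) (at level 10, f at level 9).
Local Notation L2p := (L2 `[0%R, +oo[).
Local Notation k12 := (hsum k1 k2).
Local Notation HF := (h ⊗ Fock S k12).
Local Notation z0 := (fun=> 0 : k12).
Variables (U1 : R -> h ⊗ Fock S k1 -> h ⊗ Fock S k1)
          (U2 : R -> h ⊗ Fock S k2 -> h ⊗ Fock S k2) (U : R -> HF -> HF).
Hypotheses (hU1 : unitary_cocycle U1) (hU2 : unitary_cocycle U2) (hU : unitary_cocycle U).

Local Notation V := (product_process U1 U2).

Lemma contractive_product t : 0 <= t -> contractive (V t).
Proof.
by move=> t0; apply: contractive_noise_product; exact: cocycle_contractive.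
Qed.

Lemma mel_adapted_product t : 0 <= t -> mel_adapted t (V t).
Proof.
move=> t0; have [b1 _] := cocycle_contractive hU1 t0.
have [b2 _] := cocycle_contractive hU2 t0.
by apply: mel_adapted_noise_product => //; exact: mel_adapted_cocycle.
Qed.

(** Restricting to [t <= 1] makes the error quadratic in [t] with a constant that depends
only on the two values of the test functions. *)
Definition local_agreement (c d : k12) (B : R) : Prop :=
  0 <= B /\ forall (t : R) (f g : R -> k12) v, 0 <= t -> t <= 1 -> L2p f -> L2p g ->
  (forall s, 0 <= s -> s < t -> f s = c) -> (forall s, 0 <= s -> s < t -> g s = d) ->
  hn (mel (V t) (splice t f z0) (splice t g z0) v -
      mel (U t) (splice t f z0) (splice t g z0) v) <= B * t ^+ 2 * hn v.

Section OneMesh.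
Variables (n : nat) (t : R) (f g : R -> k12) (B : R).
Hypotheses (t0 : 0 <= t) (df : dyadic_at n f) (dg : dyadic_at n g).
Hypothesis hB : forall s, 0 <= s -> local_agreement (f s) (g s) B.

Local Notation d j := (j%:R / 2 ^+ n : R).
Let N := Num.truncn (2 ^+ n * t).
Let delta : R := (2 ^+ n)^-1.
Let Lf := L2_dyadic df.
Let Lg := L2_dyadic dg.
Let L0 := L2_zero k12 `[0, +oo[.
Let K : R := hn (ε f : Fock S k12) * hn (ε g : Fock S k12).

Let K0 : 0 <= K.
Proof. by rewrite mulr_ge0 ?hn_ge0. Qed.

Let n0 : 0 < 2 ^+ n :> R := pow2_gt0 R n.

Let d_ge0 j : 0 <= d j.
Proof. by rewrite divr_ge0// ltW. Qed.

Let dS j : d j.+1 = d j + delta.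
Proof. by rewrite -[X in _ + X]mul1r -mulrDl natr1. Qed.

Let delta_gt0 : 0 < delta.
Proof. by rewrite invr_gt0. Qed.

Let delta_le1 : delta <= 1.
Proof. by rewrite invf_le1// exprn_ege1// ler1n. Qed.

Let dN_le : d N <= t.
Proof. by rewrite ler_pdivrMr// mulrC truncn_le mulr_ge0// ltW. Qed.

Let t_lt : t < d N + delta.
Proof.
rewrite -dS ltr_pdivlMr// mulrC.
have nt0 : 0 <= 2 ^+ n * t by rewrite mulr_ge0// ltW.
by have /andP[] := truncn_itv nt0.
Qed.

Let mesh_cst (q : R -> k12) j s : dyadic_at n q -> 0 <= s -> s < delta ->
  unshift (d j) q s = q (d j).
Proof.
move=> [_ qn] s0 sd; rewrite /unshift.
have sj : 0 <= s + d j by rewrite addr_ge0.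
rewrite -(qn _ sj); congr q; apply: dyadic_floor_eq.
by rewrite lerDr s0 dS addrC ltrD2l.
Qed.

Local Notation evol j := (product_evolution U1 U2 (d j) (d j.+1)).

Definition trotter_tail j : HF -> HF :=
  (\big[(fun A B => A \o B)/id]_(j <= i < N) evol i) \o product_evolution U1 U2 (d N) t.

Let evolE j : evol j = time_shift (d j) (V delta).
Proof. by rewrite /product_evolution dS addrC addKr. Qed.

Lemma trotter_tail_step j : (j < N)%N -> trotter_tail j = evol j \o trotter_tail j.+1.
Proof. by move=> jN; rewrite /trotter_tail big_ltn. Qed.

Lemma trotter_tail_last : trotter_tail N = time_shift (d N) (V (t - d N)).
Proof. by rewrite /trotter_tail big_geq. Qed.

Let dj_le i j : (i <= j)%N -> d i <= d j.
Proof. by move=> ij; rewrite ler_pM2r ?invr_gt0// ler_nat. Qed.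

Let cV : contractive (V delta).
Proof. by apply: contractive_product; exact: ltW. Qed.

Let r0 : 0 <= t - d N.
Proof. by rewrite subr_ge0. Qed.

(** Downward induction: composing with one more step keeps contractivity and only
uses times after [d j]. *)
Lemma trotter_tail_spec j : (j <= N)%N ->
  contractive (trotter_tail j) /\ future (d j) (trotter_tail j).
Proof.
move=> jN; rewrite -(subKn jN); elim: (N - j)%N (leq_subr j N) => [|i IH] iN.
  rewrite subn0 trotter_tail_last.
  have cr := contractive_product r0; split; first exact: contractive_time_shift.
  by apply: future_time_shift => //; case: cr.
have [c1 f1] := IH (ltnW iN).
have lt1 : (N - i.+1 < N)%N by rewrite ltn_subrL (leq_ltn_trans _ iN).
have eS : (N - i.+1).+1 = (N - i)%N by rewrite subnSK.
rewrite (trotter_tail_step lt1) evolE eS; split.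
  by apply: contractive_comp => //; exact: contractive_time_shift.
apply: future_comp => //.
- by apply: bounded_time_shift => //; case: cV.
- by apply: future_time_shift => //; case: cV.
- by apply: future_mono f1 => //; rewrite -eS dj_le.
Qed.

(** The matrix element of the product whose first [j] steps are replaced by the target
cocycle: it interpolates between the Trotter product and the cocycle. *)
Let hybrid j v := mel (U (d j)) (splice (d j) f z0) (splice (d j) g z0)
  (mel (trotter_tail j) (splice (d j) z0 f) g v).

Let hn_pref s w : 0 <= s ->
  hn (mel (U s) (splice s f z0) (splice s g z0) w) <= K * hn w.
Proof.
move=> s0; apply: (le_trans (hn_mel _ _ _ (cocycle_contractive hU s0))).
apply: ler_wpM2r; first exact: hn_ge0.
by apply: ler_pM; rewrite ?hn_ge0//; exact: hn_expv_past.
Qed.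

Let lin_pref s : 0 <= s -> linear (mel (U s) (splice s f z0) (splice s g z0)).
Proof.
move=> s0; have [bs _] := cocycle_contractive hU s0.
by have /bounded_opP[] := bounded_mel (splice s f z0) (splice s g z0) bs.
Qed.

Let splice_unshift (q : R -> k12) j s :
  unshift (d j) (splice (d j.+1) q z0) s = splice delta (unshift (d j) q) z0 s.
Proof. by rewrite /unshift /splice dS addrC ltrD2l [d j + s]addrC. Qed.

(** Neighbouring hybrids differ in a single step; the factors around it are bounded by
the norms of the exponential vectors. *)
Let hybrid_step j v : (j < N)%N ->
  hn (hybrid j v - hybrid j.+1 v) <= K * (B * delta ^+ 2 * (K * hn v)).
Proof.
move=> jN; set w := mel (trotter_tail j.+1) (splice (d j.+1) z0 f) g v.
have dle : d j <= d j.+1 by exact: dj_le.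
have [ct ft] := trotter_tail_spec jN.
have d0 := d_ge0 j; have d1 := d_ge0 j.+1; have del0 : 0 <= delta by exact: ltW.
have [bV _] := cV.
have Lfut : L2p (splice (d j) z0 f) by exact: L2_spliceT.
set sf := splice delta (unshift (d j) f) z0; set sg := splice delta (unshift (d j) g) z0.
have tailE : mel (trotter_tail j) (splice (d j) z0 f) g v = mel (V delta) sf sg w.
  rewrite (trotter_tail_step jN) evolE.
  have aE : mel_adapted (d j.+1) (time_shift (d j) (V delta)).
    by rewrite dS; apply: mel_adapted_time_shift => //; exact: mel_adapted_product.
  rewrite (mel_mul _ d1 (bounded_time_shift d0 bV) aE ft Lfut Lg).
  have -> : splice (d j.+1) z0 (splice (d j) z0 f) = splice (d j.+1) z0 f.
    apply/funext => s; rewrite /splice; case: ltP => // ds.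
    by rewrite ltNge (le_trans dle ds).
  rewrite -/w mel_time_shift//; try exact: L2_spliceT.
  rewrite (_ : L2inner _ _ _ = 0) ?cexp0 ?scale1r; last first.
    rewrite -(L2inner0l `[0, d j[ (splice (d j.+1) g z0)); apply: eq_L2inner => // s.
    rewrite in_itv/= => /andP[s0 sd]; rewrite /splice sd.
    by rewrite (lt_le_trans sd dle).
  apply: mel_eq; try by apply: L2_unshift => //; exact: L2_spliceT.
    move=> s s0; rewrite splice_unshift /sf /splice; case: ifP => // _.
    by rewrite /unshift ltNge lerDr s0.
  by move=> s _; exact: splice_unshift.
have prefE : mel (U (d j.+1)) (splice (d j.+1) f z0) (splice (d j.+1) g z0) w =
    mel (U (d j)) (splice (d j) f z0) (splice (d j) g z0) (mel (U delta) sf sg w).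
  rewrite {1}dS mel_cocycle//; try exact: L2_spliceT.
  have ss (q : R -> k12) : splice (d j) (splice (d j.+1) q z0) z0 = splice (d j) q z0.
    apply/funext => s; rewrite /splice; case: ifP => // sd.
    by rewrite (lt_le_trans sd dle).
  rewrite !ss; congr (mel _ _ _ _).
  apply: mel_eq; try by apply: L2_unshift => //; exact: L2_spliceT.
    by move=> s _; exact: splice_unshift.
  by move=> s _; exact: splice_unshift.
rewrite /hybrid -/w tailE prefE -(opB (lin_pref d0)).
apply: (le_trans (hn_pref _ d0)); apply: ler_wpM2l => //.
have [_ hBj] := hB d0.
apply: le_trans (hBj delta (unshift (d j) f) (unshift (d j) g) w _ _ _ _ _ _) _ => //.
- exact: L2_unshift.
- exact: L2_unshift.
- by move=> s s0 sd; exact: mesh_cst.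
- by move=> s s0 sd; exact: mesh_cst.
apply: ler_wpM2l; first by have [B0 _] := hB d0; rewrite mulr_ge0 ?sqr_ge0.
apply: (le_trans (hn_mel _ _ _ ct)); apply: ler_wpM2r; first exact: hn_ge0.
by apply: ler_wpM2r; [exact: hn_ge0|exact: hn_expv_future].
Qed.

(** The last step is shorter than [delta] and ends at [t]. *)
Let hybrid_last v :
  hn (hybrid N v - mel (U t) f g v) <= K * (K * (B * delta ^+ 2 * hn v)).
Proof.
have d0 := d_ge0 N; have [bV _] := contractive_product r0.
have tE : t = d N + (t - d N) by rewrite addrC subrK.
have rd : t - d N <= delta by rewrite lerBlDl ltW.
have r1 : t - d N <= 1 by exact: le_trans rd delta_le1.
have Lfu : L2p (unshift (d N) f) by exact: L2_unshift.
have Lgu : L2p (unshift (d N) g) by exact: L2_unshift.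
rewrite [X in mel (U X) f g v]tE mel_cocycle// /hybrid trotter_tail_last.
rewrite -(opB (lin_pref d0)).
apply: (le_trans (hn_pref _ d0)); apply: ler_wpM2l => //.
rewrite mel_time_shift//; last exact: L2_spliceT.
rewrite (_ : L2inner _ _ _ = 0) ?cexp0 ?scale1r; last first.
  rewrite -(L2inner0l `[0, d N[ g); apply: eq_L2inner => // s; exact: splice_past.
rewrite (@mel_eq _ _ _ _ (V (t - d N)) _ _ (unshift (d N) f) (unshift (d N) g)) //; last 2 first.
- by apply: L2_unshift => //; exact: L2_spliceT.
- by move=> s s0; rewrite /unshift /splice ltNge lerDr s0.
rewrite (mel_adapted_product r0)// (mel_adapted_cocycle hU r0)// -scalerBr hnZ.
apply: ler_pM; rewrite ?hn_ge0//.
  apply: (le_trans (hn_cexp_future S _ _ _)) => //.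
  by apply: ler_pM; rewrite ?hn_ge0//; exact: hn_expv_unshift.
have [B0 hBj] := hB d0.
apply: le_trans (hBj (t - d N) _ _ v _ _ _ _ _ _) _ => //.
- by move=> s s0 sd; apply: mesh_cst => //; exact: lt_le_trans sd rd.
- by move=> s s0 sd; apply: mesh_cst => //; exact: lt_le_trans sd rd.
apply: ler_wpM2r; first exact: hn_ge0.
apply: ler_wpM2l => //; rewrite ler_sqr ?nnegrE//; exact: ltW.
Qed.

Let hybrid0 v : hybrid 0 v = mel (trotter_product U1 U2 n t) f g v.
Proof.
have -> : trotter_product U1 U2 n t = trotter_tail 0 by [].
have U0 : U (d 0%N) = id by have [_ <- _] := hU; rewrite mul0r.
rewrite /hybrid U0 {1}/mel slice_tens expv_inner; [|exact: L2_spliceT|exact: L2_spliceT].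
have -> : L2inner `[0, +oo[ (splice (d 0%N) f z0) (splice (d 0%N) g z0) = 0.
  rewrite -(L2inner0l `[0, +oo[ (splice (d 0%N) g z0)); apply: eq_L2inner => // s.
  by rewrite in_itv/= andbT => s0; rewrite /splice mul0r ltNge s0.
rewrite cexp0 scale1r; apply: mel_eq => //; first exact: L2_spliceT.
by move=> s s0; rewrite /splice mul0r ltNge s0.
Qed.

(** About [2^n t] steps, each with an error of order [4^-n]. *)
Lemma trotter_error v : hn (mel (trotter_product U1 U2 n t) f g v - mel (U t) f g v) <=
  (t + 1) * (K ^+ 2 * B * hn v) * delta.
Proof.
have [B0 _] := hB t0.
have tele j : (j <= N)%N ->
    hn (hybrid 0 v - hybrid j v) <= j%:R * (K ^+ 2 * B * hn v * delta ^+ 2).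
  elim: j => [|j IH] jN; first by rewrite subrr hn0 mul0r.
  apply: (le_trans (hn_dist _ (hybrid j v) _)).
  have h1 := IH (ltnW jN); have h2 := hybrid_step v jN.
  rewrite -natr1 mulrDl mul1r; apply: lerD => //.
  by apply: (le_trans h2); rewrite le_eqVlt; apply/orP; left; apply/eqP; ring.
rewrite -hybrid0; apply: (le_trans (hn_dist _ (hybrid N v) _)).
apply: (le_trans (lerD (tele N (leqnn N)) (hybrid_last v))).
have X0 : 0 <= K ^+ 2 * B * hn v by rewrite !mulr_ge0 ?sqr_ge0 ?hn_ge0.
rewrite (_ : _ + _ = (N%:R * delta + delta) * (K ^+ 2 * B * hn v) * delta); last by ring.
apply: ler_wpM2r; first exact: ltW.
by apply: ler_wpM2r => //; apply: lerD.
Qed.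

Lemma contractive_trotter : contractive (trotter_product U1 U2 n t).
Proof. by have [] := @trotter_tail_spec 0. Qed.

End OneMesh.

End Trotter.

(** * Convergence of the Trotter products *)

Section LocalAgreement.
Variables (R : realType) (S : realization R) (h k1 k2 : hilbertType R).
Local Notation C := R[i].
Local Notation "H ⊗ K" := (tensor_space (tensor S H K))
  (at level 40, left associativity).
Local Notation k12 := (hsum k1 k2).
Local Notation HF := (h ⊗ Fock S k12).
Variables (K1 : h -> h) (M1 : h ⊗ k1 -> h) (L1 : h -> h ⊗ k1) (W1 : h ⊗ k1 -> h ⊗ k1).
Variables (K2 : h -> h) (M2 : h ⊗ k2 -> h) (L2 : h -> h ⊗ k2) (W2 : h ⊗ k2 -> h ⊗ k2).
Local Notation F1 := (block_op K1 M1 L1 W1).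
Local Notation F2 := (block_op K2 M2 L2 W2).
Local Notation F := (undistr (block_op (K1 \+ K2) (row_op M1 M2) (col_op L1 L2)
                            (dsum_op W1 W2))).
Variables (U1 : R -> h ⊗ Fock S k1 -> h ⊗ Fock S k1)
          (U2 : R -> h ⊗ Fock S k2 -> h ⊗ Fock S k2) (U : R -> HF -> HF).
Hypotheses (bF1 : bounded_op F1) (bF2 : bounded_op F2) (bF : bounded_op F).
Hypotheses (hU1 : unitary_cocycle U1) (hU2 : unitary_cocycle U2) (hU : unitary_cocycle U).
Hypotheses (hdU1 : qsde F1 U1) (hdU2 : qsde F2 U2) (hdU : qsde F U).

Lemma hn_cexp_scaled (t : R) (z : C) : 0 <= t -> t <= 1 ->
  hn (cexp (t%:C%C * z)) <= expR `|complex.Re z|.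
Proof.
move=> t0 t1; rewrite hn_cexp ler_expR ReZ (le_trans (ler_norm _))//.
by rewrite normrM ger0_norm// ler_piMl.
Qed.

(** Both sides have the expansion [e^(t<c,d>) (1 + t E_c^* F E_d)] up to second order:
the exponents add up over the noises, and so do the generators. *)
Lemma local_agreement_exists (c d : k12) : exists B, local_agreement U1 U2 U c d B.
Proof.
have c1 t : 0 <= t -> contractive (U1 t) by exact: cocycle_contractive.
have c2 t : 0 <= t -> contractive (U2 t) by exact: cocycle_contractive.
have c3 t : 0 <= t -> contractive (U t) by exact: cocycle_contractive.
have a1 t : 0 <= t -> mel_adapted t (U1 t) by exact: mel_adapted_cocycle.
have a2 t : 0 <= t -> mel_adapted t (U2 t) by exact: mel_adapted_cocycle.
have a3 t : 0 <= t -> mel_adapted t (U t) by exact: mel_adapted_cocycle.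
have [B1 B10 est1] := qsde_estimate bF1 hdU1 c1 a1 c.1 d.1.
have [B2 B20 est2] := qsde_estimate bF2 hdU2 c2 a2 c.2 d.2.
have [B3 B30 est3] := qsde_estimate bF hdU c3 a3 c d.
have /bounded_opP[l1 [N1 N10 hN1]] := bounded_coefficient c.1 d.1 bF1.
have /bounded_opP[l2 [N2 N20 hN2]] := bounded_coefficient c.2 d.2 bF2.
pose A1 : R := expR `|complex.Re (inner c.1 d.1)|.
pose A2 : R := expR `|complex.Re (inner c.2 d.2)|.
exists (B1 * (A2 * (1 + N2) + B2) + A1 * ((1 + N1) * B2) + A1 * A2 * (N1 * N2) + B3).
split; first by rewrite !addr_ge0 ?mulr_ge0 ?addr_ge0 ?mulr_ge0 ?addr_ge0 ?expR_ge0.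
move=> t f g v t0 t1 Lf Lg fc gd.
have L0 := L2_zero k12 `[0, +oo[.
have [b1 _] := c1 t t0; have [b2 _] := c2 t t0.
have spl1 (q : R -> k12) : (fun s => (splice t q (fun=> 0) s).1) =
    splice t (fun s => (q s).1) (fun=> 0).
  by apply/funext => s; rewrite /splice; case: (_ < _).
have spl2 (q : R -> k12) : (fun s => (splice t q (fun=> 0) s).2) =
    splice t (fun s => (q s).2) (fun=> 0).
  by apply/funext => s; rewrite /splice; case: (_ < _).
rewrite (mel_noise_product _ b1 b2 (L2_spliceT t0 Lf L0) (L2_spliceT t0 Lg L0)) !spl1 !spl2.
have Lf1 := L2_fst Lf; have Lg1 := L2_fst Lg.
have Lf2 := L2_snd Lf; have Lg2 := L2_snd Lg.
apply: (product_expansion l1 N10 N20 hN1 hN2 B10 B20 t0 t1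
  (hn_cexp_scaled (inner c.1 d.1) t0 t1) (hn_cexp_scaled (inner c.2 d.2) t0 t1)).
- by move=> w; apply: est1 => // s s0 st; rewrite ?fc ?gd.
- by move=> w; apply: est2 => // s s0 st; rewrite ?fc ?gd.
- move=> w; rewrite -cexpD -mulrDr -inner_hsum -coefficient_undistr; exact: est3.
Qed.

(** A pair of step functions takes finitely many values, hence one constant serves
all mesh intervals. *)
Lemma local_agreement_uniform m (f g : R -> k12) : dyadic_at m f -> dyadic_at m g ->
  exists B, forall s, 0 <= s -> local_agreement U1 U2 U (f s) (g s) B.
Proof.
move=> df dg.
have /choice[Bf hBf] : forall p : k12 * k12, exists B, local_agreement U1 U2 U p.1 p.2 B.
  by move=> p; exact: local_agreement_exists.
have [/finite_seqP[r hr] _] := finitely_valued_op (fun a b => Bf (a, b))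
  (dyadic_at_finitely_valued df) (dyadic_at_finitely_valued dg).
exists (\sum_(b <- r) `|b|) => s s0.
have [B0 hB] := hBf (f s, g s).
have le : Bf (f s, g s) <= \sum_(b <- r) `|b|.
  have br : Bf (f s, g s) \in r.
    suff : [set` r] (Bf (f s, g s)) by [].
    by rewrite -hr; exists s => //=; rewrite in_itv/= s0.
  rewrite (perm_big _ (perm_to_rem br)) big_cons /=.
  by rewrite (le_trans (ler_norm _))// lerDl sumr_ge0.
split; first exact: le_trans le.
move=> t f' g' v t0 t1 Lf Lg fc gd; apply: (le_trans (hB t f' g' v t0 t1 Lf Lg fc gd)).
by apply: ler_wpM2r; [exact: hn_ge0|apply: ler_wpM2r => //; exact: sqr_ge0].
Qed.

Lemma trotter_weak (t : R) (m m' : nat) (f g : R -> k12) u v :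
  0 <= t -> dyadic_at m f -> dyadic_at m' g -> forall e : R, 0 < e ->
  exists N, forall n, (N <= n)%N ->
    hn (inner u (mel (trotter_product U1 U2 n t) f g v) - inner u (mel (U t) f g v)) < e.
Proof.
move=> t0 df dg e e0.
have [B hB] := local_agreement_uniform
  (dyadic_at_mono (leq_maxl m m') df) (dyadic_at_mono (leq_maxr m m') dg).
have [B0 _] := hB 0 (lexx 0).
set K := hn (expv (fock S k12 `[0, +oo[) f) * hn (expv (fock S k12 `[0, +oo[) g).
pose X := hn u * ((t + 1) * (K ^+ 2 * B * hn v)).
have X0 : 0 <= X by rewrite !mulr_ge0 ?addr_ge0 ?hn_ge0 ?sqr_ge0.
have X1 : 0 < X + 1 by rewrite ltr_wpDl.
have [|N hN] := @harmonic_small R (e / (X + 1)); first by rewrite divr_gt0.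
exists (maxn N (maxn m m')) => n; rewrite geq_max => /andP[Nn mn].
have err := trotter_error hU1 hU2 hU t0 (dyadic_at_mono (leq_trans (leq_maxl _ _) mn) df)
  (dyadic_at_mono (leq_trans (leq_maxr _ _) mn) dg) hB v.
rewrite -innerBr; apply: le_lt_trans (cauchy_schwarz _ _) _.
apply: le_lt_trans (ler_wpM2l (hn_ge0 u) err) _; rewrite (mulrA (hn u)) -/K -/X.
have := hN n Nn; rewrite ltr_pdivlMr// => hn1.
apply: le_lt_trans hn1; rewrite [X * _]mulrC.
apply: ler_pM; rewrite ?invr_ge0 ?exprn_ge0//; last by rewrite lerDl.
rewrite lef_pV2 ?posrE ?pow2_gt0// -natrX ler_nat; exact: ltn_expl.
Qed.

End LocalAgreement.

Theorem theorem2p2 (R : realType) (S : realization R) (h k1 k2 : hilbertType R)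
    (J1 : countType) (e1 : J1 -> k1) (he1 : orthonormal_basis e1)
    (J2 : countType) (e2 : J2 -> k2) (he2 : orthonormal_basis e2)
    (K1 : h -> h) (M1 : tensor S h k1 -> h)
    (L1 : h -> tensor S h k1) (W1 : tensor S h k1 -> tensor S h k1)
    (K2 : h -> h) (M2 : tensor S h k2 -> h)
    (L2 : h -> tensor S h k2) (W2 : tensor S h k2 -> tensor S h k2)
    (hF1 : unitarity_relations K1 M1 L1 W1)
    (hF2 : unitarity_relations K2 M2 L2 W2)
    (U1 : R -> tensor S h (Fock S k1) -> tensor S h (Fock S k1))
    (U2 : R -> tensor S h (Fock S k2) -> tensor S h (Fock S k2))
    (hU1 : unitary_cocycle U1) (hU2 : unitary_cocycle U2)
    (hdU1 : qsde (block_op K1 M1 L1 (W1 \- id)) U1)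
    (hdU2 : qsde (block_op K2 M2 L2 (W2 \- id)) U2)
    (U : R -> tensor S h (Fock S (hsum k1 k2)) ->
              tensor S h (Fock S (hsum k1 k2)))
    (hU : unitary_cocycle U)
    (hdU : qsde (undistr (block_op (K1 \+ K2) (row_op M1 M2) (col_op L1 L2)
                            (dsum_op (W1 \- id) (W2 \- id)))) U) :
  forall t : R, 0 <= t ->
    forall x : tensor S h (Fock S (hsum k1 k2)),
      (fun n => trotter_product U1 U2 n t x) @ \oo --> U t x.
Proof.
have [bK1 bM1 bL1 /bounded_subid bW1] := unitarity_bounded hF1.
have [bK2 bM2 bL2 /bounded_subid bW2] := unitarity_bounded hF2.
have bF1 := bounded_block bK1 bM1 bL1 bW1.
have bF2 := bounded_block bK2 bM2 bL2 bW2.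
have bF := bounded_undistr (bounded_block (bounded_opD bK1 bK2) (bounded_row bM1 bM2)
  (bounded_pair bL1 bL2) (bounded_dsum bW1 bW2)).
move=> t t0; apply: (weak_to_strong _ _ (@dyadic_clspan R S h (hsum k1 k2))).
- by move=> n; exact: contractive_trotter.
- exact: cocycle_isometric.
move=> _ _ [v [m' [g [dg ->]]]] [u [m [f [df ->]]]] e e0.
have [N hN] := trotter_weak bF1 bF2 bF hU1 hU2 hU hdU1 hdU2 hdU u v t0 df dg e0.
by exists N => n /hN; rewrite !inner_mel.
Qed.
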